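(* Assume that $N>2$, let $s_c=\frac32-\frac2N$, and let $(u_0, u_1) \in (\dot H^{s_c}(\mathbb{R}^3) \cap L^{N+2}(\mathbb{R}^3)) \times \dot H^{s_c-1}(\mathbb{R}^3)$ be radial and outgoing. Then the corresponding solution $u$ of $$u(t)=\Phi_0(t)(u_0, u_1)+\int_0^t \Phi_0(t-s)P_+(0, |u(s)|^N u(s)) \, ds$$ exists globally on $\mathbb{R}^3 \times [0, \infty)$ and $$\|u\|_{L^\infty_t L^{N+2}_x} \leq \|u_0\|_{L^{N+2}}.$$ In addition, if $N>4$ then $\|u(t)\|_{L^{N+2}} \to 0$ as $t \to \infty$.
   Context: For a radial function $u$ on $\mathbb{R}^3$ write $u(r)=u(x)$, $r=|x|$. $\dot H^s$ is the homogeneous Sobolev space. $\|f\|_{L^\infty_tL^q_x}=\operatorname{ess\,sup}_{t\ge0}\|f(t)\|_{L^q(\mathbb{R}^3)}$. $\Phi(t)(u_0,u_1)=(\Phi_0(t)(u_0,u_1),\Phi_1(t)(u_0,u_1)):=(w(t),w_t(t))$, where $w$ solves the linear wave equation $w_{tt}-\Delta w=0$ on $\mathbb{R}^{3+1}$, $w(0)=u_0$, $w_t(0)=u_1$; i.e. $\Phi_0(t)(u_0,u_1)=\cos(t\sqrt{-\Delta})u_0+\frac{\sin(t\sqrt{-\Delta})}{\sqrt{-\Delta}}u_1$. On radial pairs, the projections on outgoing/incoming states are $$P_+(u_0,u_1)=\Big(\tfrac12\Big(u_0-\tfrac1r\int_0^r\rho u_1(\rho)\,d\rho\Big),\ \tfrac12\big(-(u_0)_r-\tfrac{u_0}{r}+u_1\big)\Big),$$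 $$P_-(u_0,u_1)=\Big(\tfrac12\Big(u_0+\tfrac1r\int_0^r\rho u_1(\rho)\,d\rho\Big),\ \tfrac12\big((u_0)_r+\tfrac{u_0}{r}+u_1\big)\Big).$$ A radial pair $(u_0,u_1)$ is outgoing if $P_-(u_0,u_1)=0$; in particular $u_1=-(u_0)_r-u_0/r$ (in the sense of distributions for low regularity). For outgoing $(u_0,u_1)$ and $t\ge0$, the linear evolution is $\Phi_0(t)(u_0,u_1)(r)=\frac{r-t}{r}u_0(r-t)$ for $r\ge t$ and $0$ for $0\le r\le t$. A solution on $\mathbb{R}^3\times I$ with data $(u_0,u_1)$ is a radial function $u$ satisfying the displayed integral equation for all $t\in I$. *)

(* Defs.v *)
From HB Require Import structures.
From mathcomp Require Import all_boot all_order all_algebra.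
From mathcomp Require Import all_classical all_reals all_analysis ess_sup_inf.
Import Order.TTheory GRing.Theory Num.Theory numFieldNormedType.Exports.

Set Implicit Arguments.
Unset Strict Implicit.
Unset Printing Implicit Defensive.

Local Open Scope classical_set_scope.
Local Open Scope ring_scope.

(* R^3 is R * R * R; its library norm is the sup norm, hence [enorm] below for
   the Euclidean one.  All functions are real valued. *)
Notation E3 R := (R * R * R)%type.

Definition leb3 (R : realType) :
    {measure set (measurableTypeR R * measurableTypeR R * measurableTypeR R)
       -> \bar R} :=
  ((@lebesgue_measure R \x @lebesgue_measure R) \x @lebesgue_measure R)%E.

Section Euclidean.
Context {R : realType}.
Implicit Types (x y : E3 R) (f : E3 R -> R).

Definition dot3 x y : R := x.1.1 * y.1.1 + x.1.2 * y.1.2 + x.2 * y.2.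
Definition enorm x : R := Num.sqrt (dot3 x x).

Definition basis3 : seq (E3 R) := [:: (1, 0, 0); (0, 1, 0); (0, 0, 1)].

Definition radial f : Prop := forall x y, enorm x = enorm y -> f x = f y.

(* The identification u(r) = u(x), r = |x|, of a radial u with its profile. *)
Definition profile f (r : R) : R := f (r, 0, 0).

Definition locally_integrable3 f : Prop :=
  forall r : R, (leb3 R).-integrable [set x | enorm x <= r] (EFin \o f).

Definition laplacian f (x : E3 R) : R :=
  \sum_(e <- basis3) 'D_e (fun y => 'D_e f y) x.

(* f_r = (x / |x|) . grad f *)
Definition radial_deriv f (x : E3 R) : R := 'D_((enorm x)^-1 *: x) f x.

End Euclidean.

Section Distributions.
Context {R : realType}.
Implicit Types (f g phi : E3 R -> R) (vs : seq (E3 R)).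

Fixpoint iter_deriv vs f : E3 R -> R :=
  if vs is v :: vs' then fun x => 'D_v (iter_deriv vs' f) x else f.

Definition smooth f : Prop := forall vs,
  continuous (iter_deriv vs f) /\
  forall x v : E3 R, derivable (iter_deriv vs f) x v.

Definition test_function phi : Prop :=
  smooth phi /\ exists r : R, forall x, r < enorm x -> phi x = 0.

Definition schwartz phi : Prop :=
  smooth phi /\ forall vs (k : nat), exists C : R, forall x,
    (1 + enorm x) ^+ k * `|iter_deriv vs phi x| <= C.

(* Only the values on Schwartz functions (or on test functions) matter. *)
Definition distribution3 : Type := (E3 R -> R) -> R.

Definition tempered (T : distribution3) : Prop :=
  (forall (a : R) phi psi, schwartz phi -> schwartz psi ->
     T (fun x => a * phi x + psi x) = a * T phi + T psi) /\
  exists (C : R) (n k : nat), forall phi (M : R), schwartz phi ->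
    (forall vs x, {subset vs <= basis3} -> (size vs <= n)%N ->
       (1 + enorm x) ^+ k * `|iter_deriv vs phi x| <= M) ->
    `|T phi| <= C * M.

Definition dist_of f : distribution3 :=
  fun phi => \int[leb3 R]_x (f x * phi x).

(* Invariance under the linear isometries of Euclidean space. *)
Definition radial_dist (T : distribution3) : Prop :=
  forall Q : E3 R -> E3 R, Q 0 = 0 ->
    (forall x y, enorm (Q x - Q y) = enorm (x - y)) ->
    forall phi, schwartz phi -> T (phi \o Q) = T phi.

(* The Fourier transform of a real phi is fourier_cos phi - i fourier_sin phi. *)
Definition fourier_cos phi (x : E3 R) : R :=
  \int[leb3 R]_xi (phi xi * cos (dot3 x xi)).
Definition fourier_sin phi (x : E3 R) : R :=
  \int[leb3 R]_xi (phi xi * sin (dot3 x xi)).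

(* The homogeneous Sobolev space of order s, meant for |s| < 3/2: tempered
   distributions whose Fourier transform is a function a - i b with
   |xi|^s (a - i b) in L^2.  The transform of T is defined by duality,
   <T^, phi> = <T, phi^>.  In the range |s| < 3/2 the finiteness of the weighted
   integral makes a * phi and b * phi integrable for every Schwartz phi. *)
Definition homog_sobolev (s : R) (T : distribution3) : Prop :=
  tempered T /\
  exists a b : E3 R -> R,
    [/\ measurable_fun [set: E3 R] a, measurable_fun [set: E3 R] b,
        (\int[leb3 R]_xi
           ((enorm xi `^ (2 * s)) * (a xi ^+ 2 + b xi ^+ 2))%:E < +oo)%E &
        forall phi, schwartz phi ->
          T (fourier_cos phi) = \int[leb3 R]_xi (a xi * phi xi) /\
          T (fourier_sin phi) = \int[leb3 R]_xi (b xi * phi xi)].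

(* The distribution f_r for f radial, possibly singular at the origin:
   the transpose of x/|x| . grad is - div (x/|x| .) = - (d_r + 2/r). *)
Definition dist_radial_deriv f : distribution3 := fun phi =>
  - \int[leb3 R]_x (f x * (radial_deriv phi x + 2 * phi x / enorm x)).

Definition dist_over_r f : distribution3 :=
  dist_of (fun x => f x / enorm x).

End Distributions.

Section OutgoingIncoming.
Context {R : realType}.
Implicit Types (g U : E3 R -> R).

(* (1/r) \int_0^r rho g(rho) drho, for g a function *)
Definition radial_avg g (x : E3 R) : R :=
  (\int[lebesgue_measure]_(rho in `[0, enorm x]) (rho * profile g rho))
    / enorm x.

(* U = (1/r) \int_0^r rho u1(rho) drho for u1 a distribution: r U is a
   primitive of r u1, i.e. U_r + U/r = u1, which vanishes at r = 0.  The last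
   clause expresses the vanishing for an r U that need not be continuous; it
   excludes the nonzero multiples of 1/r, the solutions of U_r + U/r = 0.
   For u1 = dist_of g with rho g(rho) integrable near 0, U = radial_avg g a.e. *)
Definition is_radial_avg (u1 : distribution3) U : Prop :=
  [/\ radial U,
      forall r : R, lebesgue_measure.-integrable `[0, r]
                      (fun rho => (rho * profile U rho)%:E),
      forall phi, test_function phi ->
        dist_radial_deriv U phi + dist_over_r U phi = u1 phi &
      r^-1 * \int[lebesgue_measure]_(rho in `[0, r]) (rho * `|profile U rho|)
        @[r --> 0^'+] --> (0 : R)].

(* The components of P_+ and P_-; U stands for (1/r) \int_0^r rho u1(rho) drho *)
Definition Pplus0 (u0 : E3 R -> R) U (x : E3 R) : R := (u0 x - U x) / 2.
Definition Pplus1 (u0 : E3 R -> R) (u1 : distribution3) : distribution3 :=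
  fun phi => (- dist_radial_deriv u0 phi - dist_over_r u0 phi + u1 phi) / 2.
Definition Pminus0 (u0 : E3 R -> R) U (x : E3 R) : R := (u0 x + U x) / 2.
Definition Pminus1 (u0 : E3 R -> R) (u1 : distribution3) : distribution3 :=
  fun phi => (dist_radial_deriv u0 phi + dist_over_r u0 phi + u1 phi) / 2.

Definition outgoing (u0 : E3 R -> R) (u1 : distribution3) : Prop :=
  (exists2 U, is_radial_avg u1 U &
     {ae leb3 R, forall x, Pminus0 u0 U x = 0}) /\
  (forall phi, test_function phi -> Pminus1 u0 u1 phi = 0).

End OutgoingIncoming.

Section Equation.
Context {R : realType}.
Implicit Types f : E3 R -> R.

(* w solves w_tt - Laplacian w = 0 on R^3 x R, w(0) = u0, w_t(0) = u1, in the
   sense of distributions in x: w(t) = Phi_0(t)(u0, u1).  Such a w is unique up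
   to a Lebesgue-null set of x for each t.  The pair (u0, u1) consists of a
   function and a distribution, as u1 need not be a function when s_c < 1. *)
Definition free_wave (u0 : E3 R -> R) (u1 : distribution3)
    (w : R -> E3 R -> R) : Prop :=
  (forall t, locally_integrable3 (w t)) /\
  forall phi, test_function phi ->
    let m := fun t : R => \int[leb3 R]_x (w t x * phi x) in
    [/\ m 0 = \int[leb3 R]_x (u0 x * phi x),
        derive1 m 0 = u1 phi &
        forall t, [/\ derivable m t 1, derivable (derive1 m) t 1 &
          derive1 (derive1 m) t = \int[leb3 R]_x (w t x * laplacian phi x)]].

Definition nonlinearity (N : R) f (x : E3 R) : R := `|f x| `^ N * f x.

(* Radial solutions on R^3 x I of
     u(t) = Phi_0(t)(u0,u1)
            + \int_0^t Phi_0(t-s) P_+(0, |u(s)|^N u(s)) ds.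
   w is the first term; W s is the free wave t |-> Phi_0(t) P_+(0, F(s)) with
   F(s) = |u(s)|^N u(s), for almost every s.  Joint measurability in (s,x) makes
   the s-integral independent, for almost every x, of the representatives
   chosen for the W s. *)
Definition solution (N : R) (I : set R) (u0 : E3 R -> R)
    (u1 : distribution3) (u : R -> E3 R -> R) : Prop :=
  [/\ forall t, I t -> radial (u t),
      measurable_fun (I `*` [set: E3 R]) (fun p : R * E3 R => u p.1 p.2) &
      exists (w : R -> E3 R -> R) (W : R -> R -> E3 R -> R),
        [/\ free_wave u0 u1 w,
            {ae @lebesgue_measure R, forall s, I s ->
               let F := nonlinearity N (u s) in
               (forall r : R, lebesgue_measure.-integrable `[0, r]
                                (fun rho => (rho * profile F rho)%:E)) /\
               free_wave (Pplus0 (cst 0) (radial_avg F))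
                         (Pplus1 (cst 0) (dist_of F)) (W s)} &
            forall t, I t ->
              measurable_fun (`[0, t] `*` [set: E3 R])
                (fun p : R * E3 R => W p.1 (t - p.1) p.2) /\
              {ae leb3 R, forall x,
                 lebesgue_measure.-integrable `[0, t]
                   (fun s => (W s (t - s) x)%:E) /\
                 u t x = w t x
                   + \int[lebesgue_measure]_(s in `[0, t]) W s (t - s) x}]].

Definition norm_Lq (q : R) f : \bar R :=
  ('N[leb3 R]_(q%:E)[EFin \o f])%E.

(* ess sup over t >= 0 of the L^q norm of u(t); [\_] extends by 0 to t < 0. *)
Definition norm_LinfLq (q : R) (u : R -> E3 R -> R) : \bar R :=
  ess_sup (@lebesgue_measure R) ((fun t => norm_Lq q (u t)) \_ `[0, +oo[).

End Equation.

(* Main.v *)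
(* The function v = r u of an outgoing solution is transported along t - r, so
   V(t, a) = v(t, a + t) satisfies, for a >= 0,
     V(t, a) = v0(a) - 1/2 \int_0^t G(s, a) ds,
     G(s, a) = \int_0^a (b + s)^-N |V(s, b)|^N V(s, b) db,
   and u vanishes inside the light cone r < t.  The weighted energy
   \int (b + t)^-N |V(t, b)|^(N + 2) db is a multiple of ||u(t)||^(N + 2) in L^(N + 2).
   It does not increase, since its weight decreases and since
   \int_0^A g(b) \int_0^b g = (\int_0^A g)^2 / 2 >= 0.  The same square controls
   G in L^2 in time, so that |V(t, a) - v0(a)| <= sqrt (t E); for N > 4 this bound and the
   weight (a + t)^-N make the energy tend to 0.  A solution V is a limit of explicit Euler
   schemes with truncated nonlinearity and regularized weight, which are equicontinuous.

   To read V as a solution on R^3, write the integral of f(|x|) phi(x) as that of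
   f(r) r psi(r), where psi(r) is r times the integral of phi(r w) over the unit sphere.
   Then psi'' is the same function for the Laplacian of phi, which makes
   [h(r - t) - h(- r - t)] / r a free wave; the outgoing condition and P_+ become
   statements about the pairing of h with psi'. *)
Require Import Defs.
From HB Require Import structures.
From mathcomp Require Import all_boot all_order all_algebra.
From mathcomp Require Import all_classical all_reals all_analysis.
From mathcomp Require Import measurable_realfun ess_sup_inf ring lra.
Import Order.TTheory GRing.Theory Num.Theory numFieldNormedType.Exports.
Set Implicit Arguments.
Unset Strict Implicit.
Unset Printing Implicit Defensive.
Local Open Scope classical_set_scope.
Local Open Scope ring_scope.

(** * Integrals over intervals *)

(** The energy controls the data only in a weighted L^(N+2), with a weight singular at b + s = 0, so
    compactness takes the place of a contraction. The truncation is made at the level of the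
    potential: the truncated nonlinearity keeps a convex primitive lying below |x|^(N+2)/(N+2), so
    the initial energy does not exceed the true one, and an explicit step costs O(h^2), made
    negligible by the choice of [es_h]. Since v0 is only measurable, compactness is applied to V -
    v0: Cauchy-Schwarz on the sum of the squares of G gives a square-root modulus in time, and
    Young's inequality |V|^(N+1) <= lam |V|^(N+2) + lam^-(N+1) gives a modulus in a, locally uniform
    for a > 0. With lam a power of s, the same inequality bounds G by C s^(-N/(N+1)) + a, integrable
    in time. Convergence holds at every point, so the integral equation has no exceptional set.

    Sphere integrals are never formed: [psi] combines integrals over the unit ball of phi and of (1
    - |y|^2)/2 times its Laplacian, and the identities for its derivatives follow from a divergence
    theorem on the ball, itself a consequence of translation invariance. *)

Section real_integrals.
Context {d : measure_display} {T : measurableType d} {R : realType}.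
Variable mu : {measure set T -> \bar R}.
Implicit Types (D : set T) (f g : T -> R).

Lemma integrable_dominated D f g : measurable D -> measurable_fun D f ->
  (forall x, D x -> `|f x| <= g x) -> mu.-integrable D (EFin \o g) ->
  mu.-integrable D (EFin \o f).
Proof.
move=> mD mf fg; apply: le_integrable => //; first exact/measurable_EFinP.
by move=> x Dx /=; rewrite lee_fin (le_trans (fg _ Dx))// ler_norm.
Qed.

Lemma integrable_measurable_fun D f :
  mu.-integrable D (EFin \o f) -> measurable_fun D f.
Proof. by move=> /integrableP[/measurable_EFinP]. Qed.

Lemma integrable_addr D f g : measurable D -> mu.-integrable D (EFin \o f) ->
  mu.-integrable D (EFin \o g) -> mu.-integrable D (EFin \o (fun x => f x + g x)).
Proof. by move=> mD i1 i2; have := integrableD mD i1 i2. Qed.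

Lemma integrable_subr D f g : measurable D -> mu.-integrable D (EFin \o f) ->
  mu.-integrable D (EFin \o g) -> mu.-integrable D (EFin \o (fun x => f x - g x)).
Proof. by move=> mD i1 i2; have := integrableB mD i1 i2. Qed.

Lemma integrable_mull D f (r : R) : measurable D ->
  mu.-integrable D (EFin \o f) -> mu.-integrable D (EFin \o (fun x => r * f x)).
Proof. by move=> mD i1; have := integrableZl mD r i1. Qed.

Lemma integrable_normr D f : measurable D ->
  mu.-integrable D (EFin \o f) -> mu.-integrable D (EFin \o (fun x => `|f x|)).
Proof. by move=> mD i1; have := integrable_norm i1. Qed.

Lemma integrable_bounded D f (M : R) : measurable D -> (mu D < +oo)%E ->
  measurable_fun D f -> (forall x, D x -> `|f x| <= M) ->
  mu.-integrable D (EFin \o f).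
Proof.
move=> mD muD mf fM; apply: measurable_bounded_integrable => //.
exists M; split; first exact: num_real.
by move=> y My x Dx /=; rewrite (le_trans (fM _ Dx))// ltW.
Qed.

(** The domination is asked only from rank [n0] on: the bounds on the n-th Euler scheme hold once
    [0, n] contains the time and the radius considered. *)
Lemma Rintegral_dominated_cvg D (f_ : nat -> T -> R) f g (n0 : nat) :
  measurable D -> (forall n, measurable_fun D (f_ n)) ->
  (forall x, D x -> f_ n x @[n --> \oo] --> f x) ->
  mu.-integrable D (EFin \o g) ->
  (forall n x, (n0 <= n)%N -> D x -> `|f_ n x| <= g x) ->
  mu.-integrable D (EFin \o f) /\
  \int[mu]_(x in D) f_ n x @[n --> \oo] --> \int[mu]_(x in D) f x.
Proof.
move=> mD mf_ f_f ig fg.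
have mf : measurable_fun D f.
  exact: measurable_fun_cvg f_f.
have fgx x : D x -> `|f x| <= g x.
  move=> Dx; have /cvg_norm nf := f_f _ Dx.
  rewrite -(cvg_lim _ nf)//; apply: limr_le; first by apply/cvg_ex; exists `|f x|.
  by exists n0 => // n /= n0n; exact: fg.
have i_f : mu.-integrable D (EFin \o f) by exact: integrable_dominated ig.
split=> //; rewrite -(cvg_shiftn n0); apply: fine_cvg.
rewrite fineK; last exact: integrable_fin_num.
apply: (@dominated_cvg _ _ _ mu _ _ (fun n x => (f_ (n + n0)%N x)%:E) _
  (EFin \o g)) => //=.
- by move=> n; exact/measurable_EFinP.
- move=> x Dx; apply: cvg_EFin; first exact: nearW.
  by have := f_f _ Dx; rewrite -(cvg_shiftn n0).
- by move=> n x Dx; rewrite lee_fin fg// leq_addl.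
Qed.

End real_integrals.

(** Tonelli applies to the positive and negative parts separately; where their difference is
    infinite [fine] returns 0, which is still measurable in x. *)
Lemma measurable_Rintegral_param {d1 d2 : measure_display}
  {X : measurableType d1} {Y : measurableType d2} {R : realType}
  (m : {sigma_finite_measure set Y -> \bar R}) (f : X * Y -> R) :
  measurable_fun setT f -> measurable_fun setT (fun x => \int[m]_y f (x, y)).
Proof.
move=> mf; apply: (measurableT_comp (@fine_measurable R _ measurableT)) => //.
have mfE : measurable_fun setT (EFin \o f) by exact/measurable_EFinP.
rewrite (_ : (fun x => _) = (fun x => \int[m]_y ((EFin \o f)^\+ (x, y)) -
    \int[m]_y ((EFin \o f)^\- (x, y)))%E).
  apply: emeasurable_funB.
    by apply: measurable_fun_fubini_tonelli_F => //; exact: measurable_funepos.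
  by apply: measurable_fun_fubini_tonelli_F => //; exact: measurable_funeneg.
apply/funext => x; rewrite [LHS]integralE.
by congr (_ - _)%E; apply: eq_integral => y _; rewrite /= !(funeposE, funenegE).
Qed.

Section Fubini.
Context {d1 d2 : measure_display} {X : measurableType d1}
  {Y : measurableType d2} {R : realType}.
Variables (m1 : {sigma_finite_measure set X -> \bar R})
  (m2 : {sigma_finite_measure set Y -> \bar R}) (f : X * Y -> R).
Hypothesis intf : (m1 \x m2)%E.-integrable setT (EFin \o f).

(** The inner integrals are finite only for almost every point, so [fine] is removed from them by an
    almost everywhere equality. *)
Lemma Rintegral_Fubini :
  \int[m1]_x \int[m2]_y f (x, y) = \int[m2]_y \int[m1]_x f (x, y).
Proof.
rewrite /Rintegral.
transitivity (fine (\int[m1]_x \int[m2]_y (EFin \o f) (x, y))%E).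
  congr fine; apply: ae_eq_integral => //.
  - apply: measurableT_comp => //.
    apply: (measurableT_comp (@fine_measurable R _ measurableT)) => //.
    exact: measurable_fubini_F intf.
  - exact: measurable_fubini_F intf.
  - apply: filterS (ae_integrable1 intf) => x ix _ /=.
    by rewrite fineK//; exact: integrable_fin_num ix.
rewrite (Fubini intf); congr fine; apply: ae_eq_integral => //.
- exact: measurable_fubini_G intf.
- apply: measurableT_comp => //.
  apply: (measurableT_comp (@fine_measurable R _ measurableT)) => //.
  exact: measurable_fubini_G intf.
- apply: filterS (ae_integrable2 intf) => x ix _ /=.
  by rewrite fineK//; exact: integrable_fin_num ix.
Qed.

End Fubini.

Lemma integrable_tensor {d1 d2 : measure_display} {X : measurableType d1}
  {Y : measurableType d2} {R : realType}
  (m1 : {sigma_finite_measure set X -> \bar R})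
  (m2 : {sigma_finite_measure set Y -> \bar R}) (f : X -> R) (g : Y -> R) :
  m1.-integrable setT (EFin \o f) -> m2.-integrable setT (EFin \o g) ->
  (m1 \x m2)%E.-integrable setT (EFin \o (fun p => f p.1 * g p.2)).
Proof.
move=> i1 i2.
have mf := integrable_measurable_fun i1.
have mg := integrable_measurable_fun i2.
have mfg : measurable_fun setT (fun p : X * Y => f p.1 * g p.2).
  by apply: measurable_funM; exact: measurableT_comp.
apply/integrable12ltyP; first exact/measurable_EFinP.
have [_ j2] := integrableP _ _ _ i2; have [_ j1] := integrableP _ _ _ i1.
have g0 : (0 <= \int[m2]_y `|(EFin \o g) y|)%E by exact: integral_ge0.
rewrite [ltLHS](_ : _ = (\int[m1]_x `|(EFin \o f) x| *
    \int[m2]_y `|(EFin \o g) y|)%E).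
  by rewrite lte_mul_pinfty// ?integral_ge0// ge0_fin_numE// integral_ge0.
rewrite -ge0_integralZr//; last by apply: measurableT_comp => //; exact/measurable_EFinP.
apply: eq_integral => x _.
rewrite -ge0_integralZl//; last by apply: measurableT_comp => //; exact/measurable_EFinP.
by apply: eq_integral => y _ /=; rewrite -EFinM normrM.
Qed.

Lemma ge0_integral_bigcup_le {d : measure_display} {T : measurableType d}
    {R : realType} (mu : {measure set T -> \bar R}) (F : nat -> set T)
    (f : T -> \bar R) (M : \bar R) :
  (forall n, measurable (F n)) -> (forall n m, (n <= m)%N -> F n `<=` F m) ->
  (forall n, measurable_fun (F n) f) -> (forall x, (0 <= f x)%E) ->
  (forall n, (\int[mu]_(x in F n) f x <= M)%E) ->
  (\int[mu]_(x in \bigcup_n F n) f x <= M)%E.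
Proof.
move=> mF ndF mf f0 fM.
have cI : (\int[mu]_(x in F n) f x)%E @[n --> \oo] --> (\int[mu]_(x in \bigcup_n F n) f x)%E.
  apply: ge0_nondecreasing_set_cvg_integral => //.
  by move=> n m nm; apply/subsetPset; exact: ndF.
rewrite -(cvg_lim _ cI)//; apply: lime_le; first by apply/cvg_ex; eexists; exact: cI.
exact: nearW.
Qed.

Section triangle.
Context {R : realType}.
Notation mu := (@lebesgue_measure R).
Implicit Types (g : R -> R) (A : R).

Section itv.
Variable I : interval R.
Implicit Types f h : R -> R.

Lemma integrable_itvD f h : mu.-integrable [set` I] (EFin \o f) ->
  mu.-integrable [set` I] (EFin \o h) ->
  mu.-integrable [set` I] (EFin \o (fun x => f x + h x)).
Proof. exact: integrable_addr. Qed.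

Lemma integrable_itvB f h : mu.-integrable [set` I] (EFin \o f) ->
  mu.-integrable [set` I] (EFin \o h) ->
  mu.-integrable [set` I] (EFin \o (fun x => f x - h x)).
Proof. exact: integrable_subr. Qed.

Lemma integrable_itvZ f r : mu.-integrable [set` I] (EFin \o f) ->
  mu.-integrable [set` I] (EFin \o (fun x => r * f x)).
Proof. exact: integrable_mull. Qed.

Lemma integrable_itv_norm f : mu.-integrable [set` I] (EFin \o f) ->
  mu.-integrable [set` I] (EFin \o (fun x => `|f x|)).
Proof. exact: integrable_normr. Qed.

Lemma integrable_itvS (J : interval R) f : [set` J] `<=` [set` I] ->
  mu.-integrable [set` I] (EFin \o f) -> mu.-integrable [set` J] (EFin \o f).
Proof. by move=> JI; apply: integrableS. Qed.

End itv.

Lemma bounded_itv (a b : R) : (mu `[a, b] < +oo)%E.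
Proof. by rewrite lebesgue_measure_itv/=; case: ifP => _; rewrite ltry. Qed.

Lemma mu_itv (a b : R) : a <= b -> fine (mu `[a, b]) = b - a.
Proof.
rewrite lebesgue_measure_itv/= lte_fin le_eqVlt => /predU1P[->|->//].
by rewrite ltxx subrr.
Qed.

Lemma integrable_itv_bounded (a b M : R) (f : R -> R) :
  measurable_fun `[a, b] f -> (forall x, x \in `[a, b] -> `|f x| <= M) ->
  mu.-integrable `[a, b] (EFin \o f).
Proof.
move=> mf fM; apply: (@integrable_bounded _ _ _ mu _ _ M) => //.
exact: bounded_itv.
Qed.

Lemma integrable_itv_cst (a b r : R) : mu.-integrable `[a, b] (EFin \o (fun=> r)).
Proof. exact: (@integrable_itv_bounded _ _ `|r|). Qed.

Lemma integrable_itv_mulr_bounded (I : interval R) (f b : R -> R) (M : R) :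
  mu.-integrable [set` I] (EFin \o f) -> measurable_fun [set` I] b ->
  (forall x, x \in I -> `|b x| <= M) ->
  mu.-integrable [set` I] (EFin \o (fun x => f x * b x)).
Proof.
move=> intf mb bM.
have mf := integrable_measurable_fun intf.
apply: (@integrable_dominated _ _ _ mu _ _ (fun x => `|f x| * M)) => //.
- exact: measurable_funM.
- by move=> x Ix; rewrite normrM ler_wpM2l// bM.
- rewrite (_ : EFin \o _ = (fun x => M%:E * (EFin \o (Num.norm \o f)) x)%E).
    by apply: integrableZl => //; exact: integrable_norm.
  by apply/funext => x /=; rewrite -EFinM mulrC.
Qed.

Lemma measurable_le2 : measurable [set p : R * R | p.2 <= p.1].
Proof.
rewrite (_ : [set p | _] = setT `&` [set p : R * R | p.2 <= p.1]); last by rewrite setTI.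
exact: measurable_fun_le.
Qed.

(** Fubini on the square [0, A] x [0, A] for g1(x) g2(y) times the indicator of {y <= x}, which is
    dominated by the tensor product of the two restrictions. *)
Lemma Rintegral_triangle g1 g2 A :
  mu.-integrable `[0, A] (EFin \o g1) -> mu.-integrable `[0, A] (EFin \o g2) ->
  \int[mu]_(x in `[0, A]) (g1 x * \int[mu]_(y in `[0, x]) g2 y) =
  \int[mu]_(y in `[0, A]) (g2 y * \int[mu]_(x in `[y, A]) g1 x).
Proof.
move=> i1 i2.
set D := `[0, A]%classic.
pose f (p : measurableTypeR R * measurableTypeR R) := (g1 \_ D) p.1 * (g2 \_ D) p.2 * \1_[set p : R * R | p.2 <= p.1] p.
have mD : measurable D by exact: measurable_itv.
have ind (x y : R) : \1_[set p : R * R | p.2 <= p.1] (x, y) = (y <= x)%R%:R :> R.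
  by rewrite indicE; congr (nat_of_bool _)%:R; apply/idP/idP; rewrite inE.
have mg1 : measurable_fun setT (g1 \_ D).
  by apply/(measurable_restrictT _ _).1 => //; exact: integrable_measurable_fun i1.
have mg2 : measurable_fun setT (g2 \_ D).
  by apply/(measurable_restrictT _ _).1 => //; exact: integrable_measurable_fun i2.
have mf : measurable_fun setT f.
  apply: measurable_funM; first apply: measurable_funM.
  - by apply: measurableT_comp.
  - by apply: measurableT_comp.
  - by apply: measurable_indic; exact: measurable_le2.
have j1 : mu.-integrable setT (EFin \o (g1 \_ D)).
  by rewrite -restrict_EFin; apply/integrable_restrict => //=; rewrite setTI.
have j2 : mu.-integrable setT (EFin \o (g2 \_ D)).
  by rewrite -restrict_EFin; apply/integrable_restrict => //=; rewrite setTI.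
have intf : (mu \x mu)%E.-integrable setT (EFin \o f).
  have i12 := integrable_tensor j1 j2.
  apply: (le_integrable _ _ _ i12) => //; first exact/measurable_EFinP.
  move=> p _; rewrite /f/= lee_fin [leLHS]normrM ler_piMr// indicE.
  by case: (_ \in _); rewrite ?normr1 ?normr0.
transitivity (\int[mu]_x \int[mu]_y f (x, y)).
  rewrite Rintegral_mkcond; apply: eq_Rintegral => x _.
  rewrite /f /= [LHS]/patch; case: ifPn => xD; last first.
    rewrite /patch (negbTE xD); under eq_Rintegral do rewrite !mul0r.
    by rewrite Rintegral_cst// mul0r.
  rewrite {1}/patch xD Rintegral_mkcond -RintegralZl//; last first.
    rewrite -restrict_EFin; apply/integrable_restrict => //=; rewrite setTI.
    apply: integrableS i2 => //; apply: subset_itvl.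
    by move: xD; rewrite /D inE/= in_itv/= bnd_simp => /andP[].
  apply: eq_Rintegral => y _; rewrite -mulrA; congr (_ * _).
  move: xD; rewrite /D inE/= in_itv/= => /andP[x0 xA].
  rewrite ind /patch /D !mem_setE !in_itv/=.
  have [y0/=|y0/=] := leP 0 y; last by rewrite mul0r.
  have [yx|yx] := leP y x.
    by rewrite (le_trans yx xA)/= mulr1.
  by rewrite mulr0.
rewrite (Rintegral_Fubini intf).
rewrite [RHS]Rintegral_mkcond; apply: eq_Rintegral => y _.
rewrite /f /= [RHS]/patch; case: ifPn => yD; last first.
  rewrite /patch (negbTE yD); under eq_Rintegral do rewrite mulr0 mul0r.
  by rewrite Rintegral_cst// mul0r.
rewrite [in RHS]Rintegral_mkcond -RintegralZl//; last first.
  rewrite -restrict_EFin; apply/integrable_restrict => //=; rewrite setTI.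
  apply: integrableS i1 => //; apply: subset_itvr.
  by move: yD; rewrite /D inE/= in_itv/= bnd_simp => /andP[].
apply: eq_Rintegral => x _; rewrite -mulrA mulrCA; rewrite {1}/patch yD; congr (_ * _).
move: yD; rewrite /D inE/= in_itv/= => /andP[y0 yA].
rewrite ind /patch /D !mem_setE !in_itv/=.
have [xA/=|xA/=] := leP x A; last by rewrite !andbF/= mul0r.
rewrite !andbT; have [yx|yx] := leP y x.
  by rewrite (le_trans y0 yx)/= mulr1.
by rewrite mulr0.
Qed.

Lemma Rintegral_split g (x A : R) : 0 <= x <= A ->
  mu.-integrable `[0, A] (EFin \o g) ->
  \int[mu]_(y in `[0, A]) g y =
  \int[mu]_(y in `[0, x]) g y + \int[mu]_(y in `[x, A]) g y.
Proof.
move=> /andP[x0 xA] ig; rewrite -[RHS]addrC -Rintegral_itv_obnd_cbnd; last first.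
  by apply: integrableS ig => //; apply: subset_itvr; rewrite bnd_simp.
by rewrite -(@Rintegral_itvB _ g (BLeft 0) (BRight A) x)// ?bnd_simp// subrK.
Qed.

(* Symmetrizing the triangle {y <= x} into the square shows that
   convolution with the Heaviside function is a monotone operator. *)
Lemma Rintegral_mul_primitive g A : 0 <= A ->
  mu.-integrable `[0, A] (EFin \o g) ->
  \int[mu]_(x in `[0, A]) (g x * \int[mu]_(y in `[0, x]) g y) =
  (\int[mu]_(x in `[0, A]) g x) ^+ 2 / 2.
Proof.
move=> A0 ig; set G := \int[mu]_(x in _) g x.
set L := LHS.
pose P x := \int[mu]_(y in `[0, x]) g y.
have PM x : x \in `[0, A] -> `|P x| <= \int[mu]_(y in `[0, A]) `|g y|.
  rewrite in_itv/= => /andP[x0 xA].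
  have igx : mu.-integrable `[0, x] (EFin \o g).
    by apply: integrableS ig => //; apply: subset_itvl; rewrite bnd_simp.
  apply: le_trans (le_normr_Rintegral _ igx) _ => //.
  rewrite [leRHS](@Rintegral_split (Num.norm \o g) x)/= ?x0//; last exact: integrable_norm.
  by rewrite lerDl Rintegral_ge0.
have mP : measurable_fun `[0, A] P.
  apply: subspace_continuous_measurable_fun => //.
  exact: parameterized_integral_continuous.
have igP : mu.-integrable `[0, A] (EFin \o (fun x => g x * P x)).
  exact: integrable_itv_mulr_bounded ig mP PM.
(* Exchanging the order turns the inner integral over [0, x] into one over [x, A], which is G minus
   the former. *)
have : L = G ^+ 2 - L.
  rewrite {1}/L (Rintegral_triangle ig ig).
  rewrite (_ : G ^+ 2 = \int[mu]_(x in `[0, A]) (g x * G)); last first.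
    by rewrite RintegralZr// expr2.
  rewrite /L -RintegralB//; last first.
    by apply: (@integrable_itv_mulr_bounded _ g (cst G) `|G|).
  apply: eq_Rintegral => x; rewrite inE/= in_itv/= => x0A.
  by rewrite -mulrBr /G (Rintegral_split x0A ig) [X in X - _]addrC addrK.
by move=> H; apply: (@mulIf _ 2) => //; rewrite mulfVK// mulrDr mulr1 {2}H; ring.
Qed.

End triangle.

(** * Compactness of equicontinuous sequences *)

Section compactness.
Context {R : realType}.
Import ArrowAsProduct.

(** Tychonoff's theorem on a product of segments gives a cluster point of the sequence of sequences;
    [phi k] is an index at least k whose first k coordinates are within 1/(k+1) of it. The
    inequality k <= phi k is enough to carry limits at infinity along [phi]. *)
Lemma diagonal_subsequence (x : nat -> nat -> R) :
  (forall m, exists (B : R) n0, forall n, (n0 <= n)%N -> `|x n m| <= B) ->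
  exists phi : nat -> nat, (forall k, (k <= phi k)%N) /\
    forall m, cvgn (fun k => x (phi k) m).
Proof.
move=> xB.
have {}xB m : exists B : R, forall n, `|x n m| <= B.
  have [B [n0 Bn0]] := xB m.
  exists (`|B| + \sum_(i < n0) `|x i m|) => n.
  have [n0n|nn0] := leqP n0 n.
    rewrite (le_trans (Bn0 _ n0n))// (le_trans (ler_norm B))// lerDl.
    exact: sumr_ge0.
  rewrite (bigD1 (Ordinal nn0))//= addrCA lerDl addr_ge0//.
  exact: sumr_ge0.
have [B {}xB] := choice xB.
have cA m : compact `[- B m, B m] by exact: segment_compact.
have [] := @tychonoff _ _ _ cA
    ((fun n => x n : forall m : nat, (fun _ => R) m) @ \oo) _ _.
  by exists 0%N => // n _ m /=; rewrite in_itv/= -ler_norml; exact: xB.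
move=> /= l [_ cl].
have nl (k : nat) (e : R) : 0 < e -> nbhs l [set f : nat -> R | forall m, (m < k)%N ->
    `|l m - f m| < e].
  move=> e0; elim: k => [|k IH]; first by rewrite (_ : mkset _ = setT); [exact: filterT|apply/seteqP; split].
  have nk : nbhs l [set f : nat -> R | `|l k - f k| < e].
    have := @proj_continuous nat (fun _ => R) k l.
    by move/cvgrPdist_lt => /(_ _ e0).
  apply: filterS2 IH nk => f /= fk fkk m.
  by rewrite ltnS leq_eqVlt => /predU1P[->//|]; exact: fk.
have [phi phiP] : {phi : nat -> nat & forall k, (k <= phi k)%N /\
    forall m, (m < k)%N -> `|l m - x (phi k) m| < k.+1%:R^-1}.
  apply: (@choice _ _ (fun k n => (k <= n)%N /\
    forall m, (m < k)%N -> `|l m - x n m| < k.+1%:R^-1)) => k.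
  have [] := cl ((fun n => x n) @` [set n | (k <= n)%N])
    [set f : nat -> R | forall m, (m < k)%N -> `|l m - f m| < k.+1%:R^-1].
  - by exists k => // n /= kn; exists n.
  - by apply: nl; rewrite invr_gt0.
  by move=> _ /= [[n kn <-] H]; exists n.
exists phi; split=> [k|m]; first by have [] := phiP k.
apply/cvg_ex; exists (l m); apply/cvgrPdist_lt => e e0.
near=> k.
have [_ /(_ m) H] := phiP k.
apply: lt_trans (H _) _.
  by near: k; exact: nbhs_infty_gt.
by near: k; exact: near_infty_natSinv_lt (PosNum e0).
Unshelve. all: end_near. Qed.

(** A variant of Arzela-Ascoli in which closeness to the values on the sequence [q] is required only
    for large n. It therefore applies to functions that are not continuous, such as the Euler
    schemes, which jump in time. *)
Lemma subsequence_cvg_of_asymptotic_equicontinuity (T : Type)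
    (D : nat -> T -> R) (q : nat -> T) :
  (forall m, exists (B : R) n0, forall n, (n0 <= n)%N -> `|D n (q m)| <= B) ->
  (forall x e, 0 < e -> exists m n0, forall n, (n0 <= n)%N ->
    `|D n x - D n (q m)| <= e) ->
  exists phi : nat -> nat, (forall k, (k <= phi k)%N) /\
    forall x, cvgn (fun k => D (phi k) x).
Proof.
move=> DB Deq; have [phi [phik cphi]] := diagonal_subsequence DB.
exists phi; split=> // x; apply: cauchy_cvg; apply: cauchy_exP => e e0.
have e2 : 0 < e / 2 by rewrite divr_gt0.
have [m [n0 H]] := Deq x _ e2.
exists (limn (fun k => D (phi k) (q m))).
have /cvgrPdist_lt/(_ _ e2) := cphi m.
apply: filterS2 (nbhs_infty_ge n0) => k n0k Hk.
rewrite /ball/= -[X in `|X|](subrKA (D (phi k) (q m))).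
rewrite (le_lt_trans (ler_normD _ _))// [ltRHS]splitr ltr_leD// distrC H//.
exact: leq_trans n0k _.
Qed.

End compactness.

(** * The truncated nonlinearity *)

Section nonlinearity.
Context {R : realType}.
Implicit Types (x y c p M lam : R).

(** Young's inequality for x and y^(p-1), with the conjugate exponents p and p/(p-1). *)
Lemma powR_tangent p x y : 1 < p -> 0 <= x -> 0 <= y ->
  y `^ p + p * y `^ (p - 1) * (x - y) <= x `^ p.
Proof.
move=> p1 x0 y0.
have p0 : 0 < p by lra.
have q0 : 0 < p / (p - 1) by rewrite divr_gt0//; lra.
have := @conjugate_powR R x (y `^ (p - 1)) p (p / (p - 1)) x0 (powR_ge0 _ _) p0 q0.
have -> : p^-1 + (p / (p - 1))^-1 = 1 by field; rewrite !gt_eqF//; lra.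
move=> /(_ erefl); rewrite -powRrM.
have -> : (p - 1) * (p / (p - 1)) = p by field; rewrite gt_eqF//; lra.
have -> : y `^ p = y * y `^ (p - 1).
  have [->|yn0] := eqVneq y 0; first by rewrite mul0r powR0// gt_eqF.
  by rewrite -{2}(powRr1 y0) -powRD ?yn0 ?implybT//; congr (_ `^ _); ring.
rewrite -(ler_pM2l p0) => H.
have pp : p * (x `^ p / p + y * y `^ (p - 1) / (p / (p - 1))) =
    x `^ p + (p - 1) * (y * y `^ (p - 1)) by field; rewrite !gt_eqF//; lra.
rewrite pp in H; nra.
Qed.

Lemma near_dist_le x (e : R) : 0 < e -> \forall y \near x, `|x - y| <= e.
Proof. by move=> e0; exists e => // y /= /ltW. Qed.

Variable N : R.
Hypothesis N0 : 0 < N.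

Let N1 : 0 < N + 1. Proof. by move: (N0); lra. Qed.
Let N2 : 0 < N + 2. Proof. by move: (N0); lra. Qed.
Local Ltac plra := move: (N0) (N1) (N2) => ? ? ?; lra.

Definition nl x : R := `|x| `^ N * x.
Definition pot x : R := `|x| `^ (N + 2) / (N + 2).

Lemma powRS x : 0 <= x -> x `^ (N + 1) = x `^ N * x.
Proof.
move=> x0; have [->|xn0] := eqVneq x 0.
  by rewrite mulr0 powR0 ?gt_eqF.
by rewrite powRD ?xn0 ?implybT// powRr1.
Qed.

Lemma powRSS x : 0 <= x -> x `^ (N + 2) = x `^ (N + 1) * x.
Proof.
move=> x0; have [->|xn0] := eqVneq x 0.
  by rewrite mulr0 powR0 ?gt_eqF.
rewrite -{3}(powRr1 x0) -powRD ?xn0 ?implybT//; congr (_ `^ _); plra.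
Qed.

Lemma normr_nl x : `|nl x| = `|x| `^ (N + 1).
Proof. by rewrite normrM ger0_norm ?powR_ge0// powRS. Qed.

Lemma nl_mulr x : nl x * x = `|x| `^ (N + 2).
Proof.
rewrite powRSS// powRS// /nl -!mulrA; congr (_ * _).
by rewrite -!expr2 real_normK// num_real.
Qed.

Lemma le_nl x y : x <= y -> nl x <= nl y.
Proof.
move=> xy; rewrite /nl; have [x0|x0] := leP 0 x.
  rewrite ler_pM// ?powR_ge0// ge0_ler_powR ?(ltW N0) ?nnegrE//.
  by rewrite !ger0_norm// (le_trans x0).
have [y0|y0] := leP 0 y.
  apply: (@le_trans _ _ 0); last by rewrite mulr_ge0 ?powR_ge0.
  by rewrite mulr_ge0_le0 ?powR_ge0// ltW.
rewrite -lerN2 -!mulrN ler_pM ?powR_ge0 ?oppr_ge0 ?(ltW y0) ?lerN2//.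
rewrite ge0_ler_powR ?(ltW N0) ?nnegrE//.
by rewrite !ltr0_norm// lerN2.
Qed.

(** [powR_tangent] with exponent N + 2 at |x| and |c|; the signs are recovered from nl c * x <= |nl
    c| |x|. *)
Lemma pot_convex c x : pot c + nl c * (x - c) <= pot x.
Proof.
have p0 : 0 < N + 2 by exact: N2.
rewrite /pot -(ler_pM2l p0) mulrDr.
have -> : (N + 2) * (`|c| `^ (N + 2) / (N + 2)) = `|c| `^ (N + 2).
  by rewrite mulrCA mulfV ?mulr1// gt_eqF.
have -> : (N + 2) * (`|x| `^ (N + 2) / (N + 2)) = `|x| `^ (N + 2).
  by rewrite mulrCA mulfV ?mulr1// gt_eqF.
apply: le_trans (@powR_tangent (N + 2) `|x| `|c| _ _ _) => //; last plra.
rewrite lerD2l -mulrA ler_wpM2l ?(ltW p0)//.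
have -> : N + 2 - 1 = N + 1 by ring.
rewrite mulrBr nl_mulr mulrBr -powRSS// lerB//.
by rewrite (le_trans (ler_norm _))// normrM normr_nl.
Qed.

Lemma pot_ge0 x : 0 <= pot x.
Proof. by rewrite divr_ge0 ?powR_ge0//; plra. Qed.

Definition clamp M x : R := Num.max (- M) (Num.min M x).

Lemma clamp_itv M x : 0 <= M -> - M <= clamp M x <= M.
Proof.
move=> M0; rewrite /clamp le_max lexx/= ge_max ge_min lexx/=.
by rewrite andbT (le_trans _ M0)// oppr_le0.
Qed.

Lemma clamp_id M x : `|x| <= M -> clamp M x = x.
Proof.
by rewrite ler_norml => /andP[Mx xM]; rewrite /clamp min_r// max_r.
Qed.

Lemma norm_clamp_le M x : 0 <= M -> `|clamp M x| <= M.
Proof. by move=> M0; rewrite ler_norml clamp_itv. Qed.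

Lemma clampP M x : 0 <= M -> [\/ clamp M x = x, clamp M x = M /\ M < x
  | clamp M x = - M /\ x < - M].
Proof.
move=> M0; rewrite /clamp.
have [Mx|xM] := ltP M x.
  by apply: Or32; split=> //; rewrite max_r// (le_trans _ M0)// oppr_le0.
have [Mx|xM'] := leP (- M) x; first by apply: Or31.
by apply: Or33.
Qed.

Lemma norm_clamp_le_norm M x : 0 <= M -> `|clamp M x| <= `|x|.
Proof.
move=> M0; have [->//|[-> Mx]|[-> xM]] := clampP x M0.
  by rewrite !ger0_norm// ?ltW// (le_lt_trans M0).
rewrite normrN ger0_norm// ltr0_norm; first by rewrite lerNr ltW.
by rewrite (lt_le_trans xM)// oppr_le0.
Qed.

Lemma clamp_lipschitz M x y : 0 <= M -> `|clamp M x - clamp M y| <= `|x - y|.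
Proof.
move=> M0; move: (clamp_itv x M0) (clamp_itv y M0).
move: (ler_norm (x - y)) (ler_norm (- (x - y))); rewrite normrN.
have [->|[-> ?]|[-> ?]] := clampP x M0; have [->|[-> ?]|[-> ?]] := clampP y M0.
all: move=> ? ? /andP[? ?] /andP[? ?].
all: by rewrite ler_norml; apply/andP; split; lra.
Qed.

Definition nlc M x : R := nl (clamp M x).
(** The primitive of [nlc M] that vanishes at 0: it is [pot] on [-M, M], continued by its tangents
    at the two end points. This keeps it convex and below [pot], with a Lipschitz derivative. *)
Definition potc M x : R := pot (clamp M x) + nlc M x * (x - clamp M x).

Lemma potc_ge_pot_clamp M x : 0 <= M -> pot (clamp M x) <= potc M x.
Proof.
move=> M0; rewrite lerDl /nlc /nl.
have [->|[-> ?]|[-> ?]] := clampP x M0; first by rewrite subrr mulr0.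
  by rewrite !mulr_ge0 ?powR_ge0//; plra.
by rewrite mulrN mulNr -mulrN !mulr_ge0 ?powR_ge0//; plra.
Qed.

Lemma potc_ge0 M x : 0 <= M -> 0 <= potc M x.
Proof. by move=> M0; rewrite (le_trans (pot_ge0 _) (potc_ge_pot_clamp x M0)). Qed.

Lemma potc_le_pot M x : potc M x <= pot x.
Proof. exact: pot_convex. Qed.

(** The increment is split at the clamped value of x: [pot_convex] compares the clamped points, and
    the excess x - clamp M x has the sign for which the monotonicity of [nl] lets nlc M x replace
    nlc M y. *)
Lemma potc_convex M x y : 0 <= M -> potc M y + nlc M y * (x - y) <= potc M x.
Proof.
move=> M0.
have -> : potc M y + nlc M y * (x - y) =
    (pot (clamp M y) + nlc M y * (clamp M x - clamp M y)) +
    nlc M y * (x - clamp M x) by rewrite /potc; ring.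
apply: lerD; first exact: pot_convex.
have /andP[? ?] := clamp_itv y M0.
rewrite /nlc; have [->|[-> ?]|[-> ?]] := clampP x M0; first by rewrite subrr !mulr0.
  by rewrite ler_wpM2r ?le_nl// subr_ge0 ltW.
by rewrite ler_wnM2r ?le_nl// subr_le0 ltW.
Qed.

(** For arguments of the same sign this is the tangent inequality of the power N + 1 at the one of
    larger modulus; for opposite signs |x - y| = |x| + |y| and the factor N + 1 >= 1 leaves room. *)
Lemma nl_lipschitz M x y : `|x| <= M -> `|y| <= M ->
  `|nl x - nl y| <= (N + 1) * M `^ N * `|x - y|.
Proof.
wlog xy : x y / `|y| <= `|x|.
  move=> H xM yM; have [yx|/ltW xy] := leP `|y| `|x|; first exact: H.
  by rewrite distrC (distrC x); exact: H.
move=> xM yM.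
have xN : `|x| `^ N <= M `^ N.
  by rewrite ge0_ler_powR ?nnegrE ?(ltW N0)// (le_trans _ xM).
have [xy0|xy0] := leP 0 (x * y); last first.
  have -> : `|x - y| = `|x| + `|y|.
    have [x0|x0] := leP 0 x.
      have y0 : y < 0 by nra.
      by rewrite (ltr0_norm y0) !ger0_norm//; plra.
    have y0 : 0 < y by nra.
    by rewrite (gtr0_norm y0) !ltr0_norm//; plra.
  rewrite (le_trans (ler_normB _ _))// !normr_nl !powRS// [leRHS]mulrDr.
  have yN : `|y| `^ N <= M `^ N.
    by rewrite ge0_ler_powR ?nnegrE ?(ltW N0)// (le_trans _ yM).
  have := powR_ge0 M N.
  by move=> ?; apply: lerD; rewrite ler_wpM2r// (le_trans xN, le_trans yN)//;
    rewrite ler_peMl//; plra.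
have E : `|nl x - nl y| = `|x| `^ (N + 1) - `|y| `^ (N + 1) /\
    `|x - y| = `|x| - `|y|.
  have yN : `|y| `^ N <= `|x| `^ N by rewrite ge0_ler_powR ?nnegrE ?(ltW N0).
  rewrite !powRS// /nl; have [x0|x0] := leP 0 x.
    have [y0|y0] := leP 0 y; last first.
      have x0' : x = 0 by nra.
      by move: xy; rewrite x0' normr0 normr_le0 => /eqP yy; rewrite yy ltxx in y0.
    rewrite (ger0_norm x0) (ger0_norm y0) in xy yN *.
    by rewrite !ger0_norm ?subr_ge0// ler_pM ?powR_ge0.
  have [y0|y0] := ltP 0 y; first by nra.
  rewrite (ltr0_norm x0) (ler0_norm y0) in xy yN *; split; last first.
    by rewrite ler0_norm; plra.
  have H : (- y) `^ N * (- y) <= (- x) `^ N * (- x).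
    by rewrite ler_pM ?powR_ge0 ?oppr_ge0.
  by rewrite ler0_norm; [ring|rewrite subr_le0; plra].
have [-> ->] := E.
have := @powR_tangent (N + 1) `|y| `|x| _ (normr_ge0 _) (normr_ge0 _).
have -> : N + 1 - 1 = N by ring.
have p1 : 1 < N + 1 by plra.
move=> /(_ p1) H; apply: (@le_trans _ _ ((N + 1) * `|x| `^ N * (`|x| - `|y|))); first plra.
by rewrite ler_wpM2r ?subr_ge0// ler_wpM2l// ltW.
Qed.

Lemma nlc_lipschitz M x y : 0 <= M ->
  `|nlc M x - nlc M y| <= (N + 1) * M `^ N * `|x - y|.
Proof.
move=> M0; apply: le_trans (nl_lipschitz _ _) _; try exact: norm_clamp_le.
by rewrite ler_wpM2l ?clamp_lipschitz// mulr_ge0 ?powR_ge0//; plra.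
Qed.

(** Convexity with the tangent taken at x bounds the increment by the slope at x, which differs from
    the slope at y by at most the Lipschitz constant times |x - y|. *)
Lemma potc_taylor M x y : 0 <= M ->
  potc M x <= potc M y + nlc M y * (x - y) + (N + 1) * M `^ N * (x - y) ^+ 2.
Proof.
move=> M0; have := potc_convex y x M0.
have : (nlc M x - nlc M y) * (x - y) <= (N + 1) * M `^ N * (x - y) ^+ 2.
  rewrite (le_trans (ler_norm _))// normrM.
  rewrite -[X in _ <= _ * X]real_normK ?num_real// expr2 mulrA.
  by rewrite ler_wpM2r// nlc_lipschitz.
by rewrite mulrBl; plra.
Qed.

Lemma norm_nlc_le M x : 0 <= M -> `|nlc M x| <= M `^ (N + 1).
Proof.
move=> M0; rewrite normr_nl ge0_ler_powR ?nnegrE ?norm_clamp_le//; plra.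
Qed.

Lemma norm_nlc_le_powR M x : 0 <= M -> `|nlc M x| <= `|x| `^ (N + 1).
Proof.
move=> M0; rewrite normr_nl ge0_ler_powR ?nnegrE ?norm_clamp_le_norm//; plra.
Qed.

(** The threshold is x = 1/lam: above it x^(N+1) <= lam x^(N+2), below it x^(N+1) <= lam^-(N+1). The
    free parameter trades a small multiple of the energy against a large multiple of the weight. *)
Lemma powRS_le_young lam x : 0 < lam -> 0 <= x ->
  x `^ (N + 1) <= lam * x `^ (N + 2) + (lam `^ (N + 1))^-1.
Proof.
move=> l0 x0; have [xl|xl] := leP (lam^-1) x.
  rewrite powRSS// mulrCA -[leLHS]mulr1 (@le_trans _ _ (x `^ (N + 1) * (lam * x)))//.
    rewrite ler_wpM2l ?powR_ge0//.
    by rewrite -(mulfV (lt0r_neq0 l0)) ler_pM2l.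
  by rewrite lerDl invr_ge0 powR_ge0.
apply: (@le_trans _ _ ((lam `^ (N + 1))^-1)).
  have -> : (lam `^ (N + 1))^-1 = lam^-1 `^ (N + 1).
    by rewrite -[lam^-1]powR_inv1 ?ltW// -powRrM mulN1r powRN.
  rewrite ge0_ler_powR ?nnegrE ?invr_ge0 ?(ltW l0) ?(ltW xl) ?(ltW N1)//.
by rewrite lerDr mulr_ge0 ?powR_ge0// ltW.
Qed.

Lemma norm_nlc_le_young M lam x : 0 <= M -> 0 < lam ->
  `|nlc M x| <= lam * (N + 2) * potc M x + (lam `^ (N + 1))^-1.
Proof.
move=> M0 l0; rewrite normr_nl (le_trans (powRS_le_young l0 _))// lerD2r.
rewrite -mulrA ler_wpM2l ?(ltW l0)//.
have p0 : 0 < N + 2 by exact: N2.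
apply: (@le_trans _ _ ((N + 2) * pot (clamp M x))).
  by rewrite /pot mulrCA mulfV ?mulr1// gt_eqF.
by rewrite ler_pM2l// potc_ge_pot_clamp.
Qed.

Lemma powR_normD_le p x y : 0 <= p ->
  `|x + y| `^ p <= 2 `^ p * (`|x| `^ p + `|y| `^ p).
Proof.
move=> p0; wlog yx : x y / `|y| <= `|x|.
  move=> H; have [yx|/ltW xy] := leP `|y| `|x|; first exact: H.
  by rewrite addrC [X in _ * X]addrC H.
apply: (@le_trans _ _ (2 `^ p * `|x| `^ p)).
  rewrite -powRM// ge0_ler_powR ?nnegrE//.
  by rewrite (le_trans (ler_normD _ _))//; lra.
by rewrite ler_wpM2l ?powR_ge0// lerDl powR_ge0.
Qed.

Lemma nl_continuous : continuous nl.
Proof.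
move=> x; apply/cvgrPdist_le => e e0.
have M0 : 0 <= `|x| + 1 by rewrite addr_ge0.
pose L := (N + 1) * (`|x| + 1) `^ N + 1.
have L0 : 0 < L.
  by rewrite /L ltr_wpDl// mulr_ge0 ?powR_ge0//; plra.
near=> y.
have xy : `|x - y| <= 1 by near: y; exact: near_dist_le.
apply: le_trans (@nl_lipschitz (`|x| + 1) x y _ _) _.
- by rewrite lerDl.
- have -> : y = x - (x - y) by ring.
  by rewrite (le_trans (ler_normB _ _))// lerD2l.
have : `|x - y| <= e / L.
  by near: y; apply: near_dist_le; rewrite divr_gt0.
rewrite ler_pdivlMr// mulrC => H; apply: le_trans H.
by rewrite ler_wpM2r// lerDl.
Unshelve. all: end_near. Qed.

Lemma pot_continuous : continuous pot.
Proof.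
move=> x; rewrite (_ : pot = fun x => nl x * x / (N + 2)); last first.
  by apply/funext => y; rewrite nl_mulr.
by apply: cvgMl; apply: cvgM => //; exact: nl_continuous.
Qed.

Lemma clamp_continuous M : 0 <= M -> continuous (clamp M).
Proof.
move=> M0 x; apply/cvgrPdist_le => e e0; near=> y.
apply: le_trans (clamp_lipschitz _ _ M0) _.
by near: y; exact: near_dist_le.
Unshelve. all: end_near. Qed.

Lemma nlc_continuous M : 0 <= M -> continuous (nlc M).
Proof.
move=> M0 x; apply: (@continuous_comp _ _ _ (clamp M) nl).
  exact: clamp_continuous.
exact: nl_continuous.
Qed.

Lemma potc_continuous M : 0 <= M -> continuous (potc M).
Proof.
move=> M0 x; apply: cvgD.
  apply: (@continuous_comp _ _ _ (clamp M) pot); first exact: clamp_continuous.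
  exact: pot_continuous.
apply: cvgM; first exact: nlc_continuous.
by apply: cvgB => //; exact: clamp_continuous.
Qed.

Section clamp_limit.
Variables (M x_ : nat -> R) (x : R).
Hypothesis Moo : M n @[n --> \oo] --> +oo.
Hypothesis xx : x_ n @[n --> \oo] --> x.

Let clamp_near : \forall n \near \oo, clamp (M n) (x_ n) = x_ n.
Proof.
near=> n; rewrite clamp_id//.
apply: (@le_trans _ _ (`|x| + 1)).
  have : `|x - x_ n| <= 1 by near: n; exact: cvgr_dist_le.
  move=> H; have -> : x_ n = x - (x - x_ n) by ring.
  by rewrite (le_trans (ler_normB _ _))// lerD2l.
by near: n; exact: cvgry_ge.
Unshelve. all: end_near. Qed.

Lemma nlc_cvg : nlc (M n) (x_ n) @[n --> \oo] --> nl x.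
Proof.
have : nl (x_ n) @[n --> \oo] --> nl x by apply: (cvg_comp _ _ xx); exact: nl_continuous.
apply: cvg_trans; apply: near_eq_cvg.
by apply: filterS clamp_near => n; rewrite /nlc => ->.
Qed.

Lemma potc_cvg : potc (M n) (x_ n) @[n --> \oo] --> pot x.
Proof.
have : pot (x_ n) @[n --> \oo] --> pot x by apply: (cvg_comp _ _ xx); exact: pot_continuous.
apply: cvg_trans; apply: near_eq_cvg.
by apply: filterS clamp_near => n; rewrite /potc => ->; rewrite subrr mulr0 addr0.
Qed.

End clamp_limit.

(** For N > 0 the conventions on powers and inverses give the value 0 at x = 0, not an infinite one.
    Comparisons of weights therefore single out b = 0, where the data vanish. *)
Definition wt x : R := (x `^ N)^-1.

Lemma wt_ge0 x : 0 <= wt x.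
Proof. by rewrite invr_ge0 powR_ge0. Qed.

Lemma wt_gt0 x : 0 < x -> 0 < wt x.
Proof. by move=> x0; rewrite invr_gt0 powR_gt0. Qed.

Lemma wt_le x y : 0 < x -> x <= y -> wt y <= wt x.
Proof.
move=> x0 xy; rewrite lef_pV2 ?posrE ?powR_gt0 ?(lt_le_trans x0)//.
by rewrite ge0_ler_powR ?nnegrE ?(ltW N0) ?(ltW x0)// (le_trans (ltW x0)).
Qed.

Lemma wt_continuous_at x : 0 < x -> {for x, continuous wt}.
Proof.
move=> x0; apply: cvgV; first by rewrite gt_eqF// powR_gt0.
suff : {for x, continuous (fun y => y `^ N)} by [].
apply/differentiable_continuous/derivable1_diffP.
by apply: derivable_powR; rewrite in_itv/= x0.
Qed.

Lemma measurable_wt : measurable_fun setT wt.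
Proof.
rewrite (_ : wt = fun x => x `^ (- N)); first exact: measurable_powR.
by apply/funext => x; rewrite powRN.
Qed.

End nonlinearity.

(** * The Euler scheme and its energy *)

(** An integral with a variable upper end is an integral over the whole line against the indicator
    of the measurable set {0 <= b <= A x}. *)
Lemma measurable_Rintegral_upto {d : measure_display} {X : measurableType d}
    {R : realType} (g : X * measurableTypeR R -> R) (A : X -> R) :
  measurable_fun setT g -> measurable_fun setT A ->
  measurable_fun setT
    (fun x => \int[@lebesgue_measure R]_(b in `[0, A x]) g (x, b)).
Proof.
move=> mg mA.
pose S := [set p : X * measurableTypeR R | (0 : R) <= p.2] `&` [set p | p.2 <= A p.1].
have mS : measurable S.
  apply: measurableI.
    rewrite (_ : [set p | _] = setT `&` [set p : X * measurableTypeR R | cst (0 : R) p <= p.2]);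
      last by rewrite setTI.
    exact: measurable_fun_le.
  rewrite (_ : [set p | _] = setT `&` [set p : X * measurableTypeR R | p.2 <= (A \o fst) p]);
      last by rewrite setTI.
  by apply: measurable_fun_le => //; exact: measurableT_comp.
have mh : measurable_fun setT (fun p => g p * \1_S p).
  by apply: measurable_funM => //; exact: measurable_indic.
have := @measurable_Rintegral_param _ _ _ _ _ (@lebesgue_measure R) _ mh.
congr (measurable_fun _ _); apply/funext => x.
rewrite [RHS]Rintegral_mkcond; apply: eq_Rintegral => b _.
rewrite indicE /patch mem_setE in_itv/=.
suff -> : ((x, b) \in S) = (0 <= b <= A x).
  by case: ifPn; rewrite ?mulr1 ?mulr0.
by apply/idP/idP; rewrite inE /S/= => /andP.
Qed.

Lemma measurable_primitive {R : realType} (g : R -> R) :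
  measurable_fun setT g ->
  measurable_fun setT (fun a : R => \int[@lebesgue_measure R]_(b in `[0, a]) g b).
Proof.
move=> mg.
apply: (@measurable_Rintegral_upto _ (measurableTypeR R) R (g \o snd) idfun).
  exact: measurableT_comp.
exact: measurable_id.
Qed.

(** Cauchy-Schwarz against the constant sequence 1. *)
Lemma sqr_sum_le {R : realFieldType} (n : nat) (x : nat -> R) :
  (\sum_(i < n) x i) ^+ 2 <= n%:R * \sum_(i < n) x i ^+ 2.
Proof.
elim: n => [|n IH]; first by rewrite !big_ord0 expr0n mulr0.
rewrite !big_ord_recr/=; move: IH; set S := \sum_(i < n) x i.
set Q := \sum_(i < n) _; have Q0 : 0 <= Q by apply: sumr_ge0 => i _; exact: sqr_ge0.
rewrite -natr1; move: (ler0n R n); move: n%:R (x n) S Q Q0 => {n x} m x S Q Q0.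
rewrite le_eqVlt => /predU1P[<-|m0] IH.
  have -> : S = 0 by apply/eqP; rewrite -sqrf_eq0 eq_le sqr_ge0 andbT; nra.
  by nra.
have : m * (2 * S * x) <= m * (Q + m * x ^+ 2).
  by have := sqr_ge0 (S - m * x); nra.
by rewrite ler_pM2l// => H; nra.
Qed.

Section euler_scheme.
Context {R : realType}.
Notation mu := (@lebesgue_measure R).
Variable N : R.
Hypothesis N0 : 0 < N.
Let N1 : 0 < N + 1. Proof. by move: (N0); lra. Qed.
Let N2 : 0 < N + 2. Proof. by move: (N0); lra. Qed.
Local Ltac plra := move: (N0) (N1) (N2) => ? ? ?; lra.

Variables (v0 : R -> R) (M eps h : R).
Hypothesis mv0 : measurable_fun setT v0.
Hypothesis M0 : 0 <= M.
Hypothesis eps0 : 0 < eps.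
Hypothesis h0 : 0 < h.

(** The weight at time j h, shifted by [eps] so that it stays bounded near b = 0 at the initial
    time. *)
Definition euler_wt (j : nat) (b : R) : R := wt N (b + (j%:R * h + eps)).
Definition euler_g (V : R -> R) (j : nat) (b : R) : R :=
  euler_wt j b * nlc N M (V b).
Definition euler_G (V : R -> R) (j : nat) (a : R) : R :=
  \int[mu]_(b in `[0, a]) euler_g V j b.
(** The explicit step of length h for dV/dt = - G / 2. *)
Fixpoint euler (j : nat) : R -> R :=
  if j is i.+1 then fun a => euler i a - h / 2 * euler_G (euler i) i a else v0.

Local Notation V := euler.
Local Notation w := euler_wt.
Local Notation G j := (euler_G (V j) j).
Local Notation g j := (euler_g (V j) j).
Local Notation B := (wt N eps * M `^ (N + 1)).

Let je j : eps <= j%:R * h + eps.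
Proof. by rewrite lerDr mulr_ge0// ltW. Qed.

Let je0 j : 0 < j%:R * h + eps.
Proof. exact: lt_le_trans (je j). Qed.

Lemma euler_wt_ge0 j b : 0 <= w j b. Proof. exact: wt_ge0. Qed.

Lemma euler_wt_le j b : 0 <= b -> w j b <= wt N eps.
Proof. by move=> b0; rewrite wt_le// (le_trans (je j))// lerDr. Qed.

Lemma euler_wtS j b : 0 <= b -> w j.+1 b <= w j b.
Proof.
move=> b0; apply: wt_le => //; first by rewrite ltr_wpDl.
by rewrite lerD2l lerD2r ler_wpM2r ?(ltW h0)// ler_nat.
Qed.

Lemma measurable_euler_wt j : measurable_fun setT (w j).
Proof.
apply: (measurableT_comp (measurable_wt N)).
exact: measurable_funD.
Qed.

Lemma measurable_euler_g_aux f j : measurable_fun setT f ->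
  measurable_fun setT (euler_g f j).
Proof.
move=> mf; apply: measurable_funM; first exact: measurable_euler_wt.
apply: measurableT_comp mf.
by apply: continuous_measurable_fun; exact: nlc_continuous.
Qed.

Lemma measurable_euler j : measurable_fun setT (V j).
Proof.
elim: j => [//|j IH] /=; apply: measurable_funB => //.
apply: measurable_funM => //; apply: measurable_primitive.
exact: measurable_euler_g_aux.
Qed.

Lemma measurable_euler_g j : measurable_fun setT (g j).
Proof. by apply: measurable_euler_g_aux; exact: measurable_euler. Qed.

Lemma measurable_euler_G j : measurable_fun setT (G j).
Proof. by apply: measurable_primitive; exact: measurable_euler_g. Qed.

Lemma euler_g_le j b : 0 <= b -> `|g j b| <= B.
Proof.
move=> b0; rewrite normrM ger0_norm ?euler_wt_ge0//.
by rewrite ler_pM ?euler_wt_ge0 ?euler_wt_le ?norm_nlc_le.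
Qed.

Lemma integrable_euler_g j a : mu.-integrable `[0, a] (EFin \o g j).
Proof.
apply: (@integrable_itv_bounded _ _ _ B).
- by apply: measurable_funTS; exact: measurable_euler_g.
- by move=> b; rewrite in_itv/= => /andP[b0 _]; exact: euler_g_le.
Qed.

Lemma euler_G_le j a : 0 <= a -> `|G j a| <= B * a.
Proof.
move=> a0; apply: le_trans (le_normr_Rintegral _ (integrable_euler_g j a)) _ => //.
rewrite -[a in _ * a]subr0 -mu_itv// -Rintegral_cst//.
apply: le_Rintegral => //.
- by apply: integrable_itv_norm; exact: integrable_euler_g.
- exact: integrable_itv_cst.
- by move=> b /=; rewrite in_itv/= => /andP[b0 _]; exact: euler_g_le.
Qed.

Section energy.
Variable A : R.
Hypothesis A0 : 0 <= A.

Definition euler_energy j : R := \int[mu]_(b in `[0, A]) (w j b * potc N M (V j b)).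
Local Notation I := euler_energy.

(** On [0, A] one step moves V by at most (h/2) B A, where B bounds |g|. The quadratic remainder of
    [potc_taylor], multiplied by the largest weight and integrated over [0, A], is this constant
    times h^2. *)
Definition euler_error : R :=
  wt N eps * ((N + 1) * M `^ N) * (B * A) ^+ 2 / 4 * A.

Hypothesis int0 : mu.-integrable `[0, A] (EFin \o (fun b => w 0 b * potc N M (v0 b))).

Let dens j b := w j b * potc N M (V j b).
Let C := wt N eps * ((N + 1) * M `^ N) * (B * A) ^+ 2 / 4.

Let C0 : 0 <= C.
Proof.
rewrite /C !mulr_ge0 ?invr_ge0 ?wt_ge0 ?powR_ge0 ?sqr_ge0 ?(ltW N1)//.
Qed.

Let dens_ge0 j b : 0 <= dens j b.
Proof. by rewrite mulr_ge0 ?euler_wt_ge0 ?potc_ge0. Qed.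

(** The weight decreases with j, so it may be frozen at step j; [potc_taylor] then leaves the
    first-order term - (h/2) g G and a remainder of order h^2. *)
Let densS j b : 0 <= b <= A ->
  dens j.+1 b <= dens j b - h / 2 * (g j b * G j b) + C * h ^+ 2.
Proof.
move=> /andP[b0 bA].
apply: (@le_trans _ _ (w j b * potc N M (V j.+1 b))).
  by rewrite ler_wpM2r ?potc_ge0 ?euler_wtS.
have := @potc_taylor R N N0 M (V j.+1 b) (V j b) M0.
move=> /(ler_wpM2l (euler_wt_ge0 j b))/le_trans; apply.
rewrite [V j.+1 b]/=.
have -> : V j b - h / 2 * G j b - V j b = - (h / 2 * G j b) by ring.
set L := (N + 1) * M `^ N.
have L0 : 0 <= L by rewrite mulr_ge0 ?powR_ge0 ?(ltW N1).
have : w j b * (L * (- (h / 2 * G j b)) ^+ 2) <= C * h ^+ 2.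
  have -> : C * h ^+ 2 = wt N eps * (L * ((h / 2) ^+ 2 * (B * A) ^+ 2)).
    by rewrite /C /L; field.
  rewrite ler_pM ?euler_wt_ge0 ?euler_wt_le//.
    by rewrite (mulr_ge0 L0) ?sqr_ge0.
  rewrite ler_wpM2l// sqrrN exprMn ler_wpM2l ?sqr_ge0//.
  rewrite -[leLHS]real_normK ?num_real// lerXn2r ?nnegrE//.
    by rewrite !mulr_ge0 ?wt_ge0 ?powR_ge0.
  rewrite (le_trans (euler_G_le _ b0))// ler_wpM2l//.
  by rewrite mulr_ge0 ?wt_ge0 ?powR_ge0.
rewrite /dens /euler_g => H; rewrite !mulrDr.
have -> : w j b * (nlc N M (V j b) * - (h / 2 * G j b)) =
  - (h / 2 * (w j b * nlc N M (V j b) * G j b)) by ring.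
by rewrite lerD2l.
Qed.

Let integrable_gG j : mu.-integrable `[0, A] (EFin \o (fun b => g j b * G j b)).
Proof.
apply: (@integrable_itv_mulr_bounded _ _ _ _ (B * A)).
- exact: integrable_euler_g.
- by apply: measurable_funTS; exact: measurable_euler_G.
- move=> b; rewrite in_itv/= => /andP[b0 bA].
  rewrite (le_trans (euler_G_le _ b0))// ler_wpM2l//.
  by rewrite mulr_ge0 ?wt_ge0 ?powR_ge0.
Qed.

Let integrable_rhs j : mu.-integrable `[0, A] (EFin \o dens j) ->
  mu.-integrable `[0, A] (EFin \o
    (fun b => dens j b - h / 2 * (g j b * G j b) + C * h ^+ 2)).
Proof.
move=> ij.
apply: integrable_itvD (integrable_itv_cst _ _ _).
exact: integrable_itvB ij (integrable_itvZ _ (integrable_gG j)).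
Qed.

(** Only the initial density is assumed integrable; [densS] propagates integrability from one step
    to the next by domination. *)
Lemma integrable_euler_energy j : mu.-integrable `[0, A] (EFin \o
  (fun b => w j b * potc N M (V j b))).
Proof.
elim: j => [//|j IH].
apply: (@integrable_dominated _ _ _ mu _ _ _ _ _ _ (integrable_rhs IH)) => //.
  apply: measurable_funTS; apply: measurable_funM; first exact: measurable_euler_wt.
  apply: measurableT_comp (measurable_euler _).
  by apply: continuous_measurable_fun; exact: potc_continuous.
move=> b /=; rewrite in_itv/= => bA.
by rewrite ger0_norm ?dens_ge0// densS.
Qed.

(** As G is the primitive of g, the first-order term integrates to (h/2) G(A)^2/2. It is kept rather
    than discarded, because its sum over the steps controls V in time. *)
Lemma euler_energyS j :
  I j.+1 + h / 4 * G j A ^+ 2 <= I j + euler_error * h ^+ 2.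
Proof.
have H : I j.+1 <= \int[mu]_(b in `[0, A])
    (dens j b - h / 2 * (g j b * G j b) + C * h ^+ 2).
  apply: le_Rintegral => //.
  - exact: (integrable_euler_energy j.+1).
  - exact/integrable_rhs/integrable_euler_energy.
  - by move=> b /=; rewrite in_itv/= => bA; exact: densS.
rewrite RintegralD// in H; last 2 first.
- apply: integrable_itvB; first exact: integrable_euler_energy.
  by apply: integrable_itvZ; exact: integrable_gG.
- exact: integrable_itv_cst.
rewrite RintegralB// in H; last 2 first.
- exact: integrable_euler_energy.
- by apply: integrable_itvZ; exact: integrable_gG.
rewrite (@RintegralZl _ _ _ mu _ (fun b => g j b * G j b))// in H.
rewrite Rintegral_mul_primitive// in H; last exact: integrable_euler_g.
rewrite Rintegral_cst// mu_itv// subr0 -/(euler_energy j) in H.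
by rewrite /euler_error -/C; move: H; rewrite -/(G j A); lra.
Qed.

Lemma euler_energy_sum J :
  I J + h / 4 * (\sum_(j < J) G j A ^+ 2) <= I 0 + J%:R * (euler_error * h ^+ 2).
Proof.
elim: J => [|J IH]; first by rewrite big_ord0 mulr0 mul0r.
rewrite big_ord_recr/= mulrDr -[J.+1%:R]natr1 mulrDl mul1r.
have := euler_energyS J; lra.
Qed.

Lemma euler_energy_ge0 j : 0 <= I j.
Proof. by apply: Rintegral_ge0 => b _; exact: dens_ge0. Qed.

(** A budget: [K] bounds the initial energy together with the error accumulated over [Jm] steps.
    Along the sequence of schemes it is the same for all members. *)
Variables (K : R) (Jm : nat).
Hypothesis IK : I 0 + Jm%:R * (euler_error * h ^+ 2) <= K.

Let error_ge0 : 0 <= euler_error * h ^+ 2.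
Proof. by rewrite mulr_ge0 ?sqr_ge0// /euler_error -/C mulr_ge0. Qed.

Lemma euler_energy_le J : (J <= Jm)%N -> I J <= K.
Proof.
move=> JJ; apply: le_trans IK; apply: (@le_trans _ _ (I 0 + J%:R * (euler_error * h ^+ 2))).
  apply: le_trans (euler_energy_sum J); rewrite lerDl !mulr_ge0//.
    exact: ltW.
  by apply: sumr_ge0 => i _; exact: sqr_ge0.
by rewrite lerD2l ler_wpM2r// ler_nat.
Qed.

Lemma euler_G_sum_le J : (J <= Jm)%N -> h / 4 * (\sum_(j < J) G j A ^+ 2) <= K.
Proof.
move=> JJ; apply: le_trans IK; apply: (@le_trans _ _ (I 0 + J%:R * (euler_error * h ^+ 2))).
  apply: le_trans (euler_energy_sum J); rewrite lerDr; exact: euler_energy_ge0.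
by rewrite lerD2l ler_wpM2r// ler_nat.
Qed.

Lemma euler_subE J n : V (J + n) A - V J A = - (h / 2) * \sum_(i < n) G (J + i)%N A.
Proof.
elim: n => [|n IH]; first by rewrite addn0 subrr big_ord0 mulr0.
rewrite addnS big_ord_recr/= mulrDr -IH; ring.
Qed.

(** Cauchy-Schwarz bounds the square of the increment by (h/2)^2 n times the sum of G^2, that is by
    n h times (h/4) times this sum, and the latter is at most K. *)
Lemma euler_time_holder J n : (J + n <= Jm)%N ->
  `|V (J + n) A - V J A| <= Num.sqrt (n%:R * h * K).
Proof.
move=> JJ; rewrite -sqrtr_sqr ler_wsqrtr// euler_subE exprMn.
have := sqr_sum_le n (fun i => G (J + i)%N A).
have : h / 4 * (\sum_(i < n) G (J + i)%N A ^+ 2) <= K.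
  apply: le_trans (euler_G_sum_le JJ).
  rewrite ler_wpM2l// ?divr_ge0 ?(ltW h0)//.
  rewrite big_split_ord/= lerDr; apply: sumr_ge0 => i _; exact: sqr_ge0.
set Q := \sum_(i < n) _; set S := \sum_(i < n) _ => QK SQ.
have : (h / 2) ^+ 2 * S ^+ 2 <= (h / 2) ^+ 2 * (n%:R * Q).
  by rewrite ler_wpM2l ?sqr_ge0.
rewrite sqrrN => /le_trans; apply.
have -> : (h / 2) ^+ 2 * (n%:R * Q) = n%:R * h * (h / 4 * Q) by field.
by rewrite ler_wpM2l// mulr_ge0 ?(ltW h0).
Qed.

(** On [a, A], Young's inequality with parameter [lam] bounds |g| by lam (N + 2) times the energy
    density plus lam^-(N+1) times the weight, and the weight is largest at b = a. *)
Lemma euler_G_space_modulus j (a : R) lam : (j <= Jm)%N -> 0 <= a <= A -> 0 < lam ->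
  `|G j A - G j a| <= lam * (N + 2) * K +
     (lam `^ (N + 1))^-1 * (wt N (a + (j%:R * h + eps)) * (A - a)).
Proof.
move=> jJ /andP[a0 aA] l0.
have sub : `[a, A] `<=` `[0, A] by apply: subset_itvr; rewrite bnd_simp.
have ig : mu.-integrable `[a, A] (EFin \o g j).
  by apply: integrableS (integrable_euler_g j A).
rewrite /euler_G (@Rintegral_split _ _ a A) ?a0//; last exact: integrable_euler_g.
rewrite addrAC subrr add0r.
apply: le_trans (le_normr_Rintegral _ ig) _ => //.
set c := wt N _.
have id : mu.-integrable `[a, A] (EFin \o dens j).
  by apply: integrableS (integrable_euler_energy j).
have idl : mu.-integrable `[a, A] (EFin \o (fun b => lam * (N + 2) * dens j b)).
  exact: integrable_itvZ.
have ic : mu.-integrable `[a, A] (EFin \o cst ((lam `^ (N + 1))^-1 * c)).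
  exact: integrable_itv_cst.
apply: (@le_trans _ _ (\int[mu]_(b in `[a, A])
    (lam * (N + 2) * dens j b + (lam `^ (N + 1))^-1 * c))).
  apply: le_Rintegral => //.
  - exact: integrable_itv_norm.
  - exact: integrable_itvD.
  move=> b /=; rewrite in_itv/= => /andP[ab bA].
  rewrite normrM ger0_norm ?euler_wt_ge0//.
  have := norm_nlc_le_young N0 (V j b) M0 l0.
  move=> /(ler_wpM2l (euler_wt_ge0 j b))/le_trans; apply.
  rewrite mulrDr; apply: lerD.
    by rewrite /dens mulrCA.
  rewrite mulrC ler_wpM2l ?invr_ge0 ?powR_ge0//.
  apply: wt_le => //; first by rewrite ltr_wpDl.
  by rewrite lerD2r.
rewrite RintegralD// RintegralZl// Rintegral_cst// mu_itv//.
rewrite -!mulrA lerD2r ler_wpM2l ?(ltW l0)// ler_wpM2l ?(ltW N2)//.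
apply: le_trans (euler_energy_le jJ).
rewrite /euler_energy (@Rintegral_split _ _ a A) ?a0//; last exact: integrable_euler_energy.
by rewrite lerDr; apply: Rintegral_ge0 => b _; exact: dens_ge0.
Qed.

End energy.
End euler_scheme.

(** * Step functions of time and power majorants *)

Lemma bounded_itvco {R : realType} (a b : R) : (@lebesgue_measure R `[a, b[ < +oo)%E.
Proof. by rewrite lebesgue_measure_itv/=; case: ifP => _; rewrite ltry. Qed.

Lemma mu_itvco {R : realType} (a b : R) : a <= b ->
  fine (@lebesgue_measure R `[a, b[) = b - a.
Proof.
rewrite lebesgue_measure_itv/= lte_fin le_eqVlt => /predU1P[->|->//].
by rewrite ltxx subrr.
Qed.

Section step_functions.
Context {R : realType}.
Notation mu := (@lebesgue_measure R).
Variable h : R.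
Hypothesis h0 : 0 < h.

Lemma truncn_div_itv (t : R) : 0 <= t ->
  (Num.truncn (t / h))%:R * h <= t < (Num.truncn (t / h))%:R * h + h.
Proof.
move=> t0; have /truncn_itv/andP[] : 0 <= t / h by rewrite divr_ge0// ltW.
by rewrite ler_pdivlMr// ltr_pdivrMr// -natr1 mulrDl mul1r => -> ->.
Qed.

Lemma truncn_div_eq (t : R) (j : nat) : j%:R * h <= t < j.+1%:R * h ->
  Num.truncn (t / h) = j.
Proof.
by move=> tj; apply: truncn_def; rewrite ler_pdivlMr// ltr_pdivrMr.
Qed.

Lemma measurable_truncn_comp (F : nat -> R) (J : nat) :
  measurable_fun `[0, J%:R * h[ (fun s => F (Num.truncn (s / h))).
Proof.
elim: J => [|J IH].
  by rewrite mul0r set_itv_ge ?bnd_simp//; exact: measurable_fun_set0.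
rewrite (@itv_bndbnd_setU _ _ _ (BLeft (J%:R * h))) ?bnd_simp//; last 2 first.
- by rewrite mulr_ge0// ltW.
- by rewrite ler_wpM2r ?(ltW h0)// ler_nat.
apply/measurable_funU => //; split=> //.
apply: (eq_measurable_fun (cst (F J))) => // s; rewrite inE/= in_itv/= => sJ.
by rewrite (truncn_div_eq sJ).
Qed.

Lemma integrable_truncn_comp (F : nat -> R) (J : nat) :
  mu.-integrable `[0, J%:R * h[ (EFin \o (fun s => F (Num.truncn (s / h)))).
Proof.
apply: (@integrable_bounded _ _ _ mu _ _ (\sum_(i < J) `|F i|)) => //.
- exact: bounded_itvco.
- exact: measurable_truncn_comp.
move=> s /=; rewrite in_itv/= => /andP[s0 sJ].
have sJ' : (Num.truncn (s / h) < J)%N.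
  by rewrite truncn_lt_nat ?divr_ge0 ?(ltW h0)// ltr_pdivrMr.
rewrite (bigD1 (Ordinal sJ'))//= lerDl; exact: sumr_ge0.
Qed.

Lemma Rintegral_truncn_comp (F : nat -> R) (J : nat) :
  \int[mu]_(s in `[0, J%:R * h[) F (Num.truncn (s / h)) = h * \sum_(i < J) F i.
Proof.
elim: J => [|J IH].
  by rewrite mul0r set_itv_ge ?bnd_simp// Rintegral_set0 big_ord0 mulr0.
have J1 : J%:R * h <= J.+1%:R * h by rewrite ler_wpM2r ?(ltW h0)// ler_nat.
have J0 : 0 <= J%:R * h by rewrite mulr_ge0// ltW.
have E : `[0, J.+1%:R * h[%classic = `[0, J%:R * h[%classic `|` `[J%:R * h, J.+1%:R * h[%classic.
  by rewrite -itv_bndbnd_setU// bnd_simp.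
rewrite E Rintegral_setU//; last 2 first.
- by rewrite -E; exact: integrable_truncn_comp.
- apply/disj_setPS => y [/=]; rewrite !in_itv/= => /andP[_ yJ] /andP[].
  by rewrite leNgt yJ.
rewrite IH big_ord_recr/= mulrDr; congr (_ + _).
transitivity (\int[mu]_(s in `[(J%:R * h)%R, (J.+1%:R * h)%R[) F J).
  by apply: eq_Rintegral => s; rewrite inE/= in_itv/= => /truncn_div_eq ->.
rewrite Rintegral_cst// mu_itvco//.
by rewrite -mulrBl -natrB// subSnn mul1r mulrC.
Qed.

Lemma measurable_truncn_uncurry (F : nat -> R -> R) :
  (forall j, measurable_fun setT (F j)) ->
  measurable_fun [set p : measurableTypeR R * measurableTypeR R | 0 <= p.1]
    (fun p => F (Num.truncn (p.1 / h)) p.2).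
Proof.
move=> mF.
pose S j := [set p : measurableTypeR R * measurableTypeR R | p.1 \in `[j%:R * h, j.+1%:R * h[].
have mS j : measurable (S j).
  rewrite (_ : S j = `[j%:R * h, j.+1%:R * h[%classic `*` setT).
    by apply: measurableX => //; exact: measurable_itv.
  by apply/seteqP; split=> p /=; [|case].
rewrite (_ : [set p | _] = \bigcup_j S j); last first.
  apply/seteqP; split=> [[t a] /= t0|[t a] [j _]].
    exists (Num.truncn (t / h)) => //; rewrite /S/= in_itv/= -natr1 mulrDl mul1r.
    exact: truncn_div_itv.
  rewrite /S/= in_itv/= => /andP[+ _]; apply: le_trans.
  by rewrite mulr_ge0// ltW.
apply/measurable_fun_bigcup => // j.
apply: (eq_measurable_fun (F j \o snd)).
  by move=> [t a]; rewrite inE /S/= in_itv/= => /truncn_div_eq ->.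
by apply: measurable_funTS; apply: measurableT_comp.
Qed.

End step_functions.

(** Monotone convergence along [t/(n+1), t]: away from 0 the fundamental theorem applies to
    s^(1-theta)/(1-theta), whose value at t bounds all these integrals. *)
Lemma integrable_powR_itv {R : realType} (theta t : R) : theta < 1 -> 0 < t ->
  (@lebesgue_measure R).-integrable `]0, t] (EFin \o (fun s => s `^ (- theta))).
Proof.
move=> th1 t0.
pose F s := (1 - theta)^-1 * s `^ (1 - theta).
have th0 : 0 < 1 - theta by rewrite subr_gt0.
have mp : measurable_fun setT (fun s : R => s `^ (- theta)) by exact: measurable_powR.
have cp : {in `]0, +oo[%R, continuous (fun s : R => s `^ (- theta))}.
  move=> s s0; apply/differentiable_continuous/derivable1_diffP.
  exact: derivable_powR.
have tn n : t / n.+1%:R \in `]0, t].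
  rewrite in_itv/= divr_gt0//= ler_pdivrMr// ler_peMr ?(ltW t0)//.
  by rewrite ler1n.
apply/integrableP; split; first exact/measurable_EFinP/measurable_funTS.
under eq_integral do rewrite /= ger0_norm ?powR_ge0//.
rewrite (_ : `]0, t]%classic = \bigcup_n `[t / n.+1%:R, t]%classic); last first.
  apply/seteqP; split=> [s /=|s [n _] /=]; rewrite !in_itv/= => /andP[s0 st].
    exists (Num.truncn (t / s)) => //=; rewrite in_itv/= st andbT.
    rewrite ler_pdivrMr// mulrC -ler_pdivrMr//.
    by have /truncn_itv/andP[_ /ltW] : 0 <= t / s by rewrite divr_ge0 ?ltW.
  by rewrite st andbT (lt_le_trans _ s0)// divr_gt0.
have F0 (s : R) : 0 <= F s by rewrite mulr_ge0 ?powR_ge0// invr_ge0 ltW.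
have dF (s : R) : 0 < s -> is_derive s (1 : R) F (s `^ (- theta)).
  move=> s0; have := is_deriveZ ((1 - theta)^-1) (is_derive1_powR (1 - theta) s0).
  move=> D; apply: (is_derive_eq D).
  rewrite /GRing.scale/= mulrA mulVf ?mul1r ?gt_eqF//; congr (_ `^ _); ring.
have cF (s : R) : 0 < s -> {for s, continuous F}.
  move=> s0; apply/differentiable_continuous/derivable1_diffP.
  by have [] := dF _ s0.
have Fb n : (\int[@lebesgue_measure R]_(s in `[(t / n.+1%:R)%R, t]) (s `^ (- theta))%:E <= (F t)%:E)%E.
  move: (tn n); rewrite in_itv/= => /andP[tn0].
  rewrite le_eqVlt => /predU1P[->|tnt].
    by rewrite set_itv1 integral_set1 lee_fin.
  rewrite (@continuous_FTC2 _ _ F) //.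
  - by rewrite -EFinB lee_fin lerBlDr lerDl F0.
  - apply: continuous_in_subspaceT => s; rewrite inE/= in_itv/= => /andP[s0 _].
    by apply: cp; rewrite in_itv/= andbT (lt_le_trans tn0).
  - split=> [s| |]; first rewrite in_itv/= => /andP[s0 _].
    - by have [] := dF s (lt_trans tn0 s0).
    - exact/cvg_at_right_filter/cF.
    - exact/cvg_at_left_filter/cF.
  - move=> s; rewrite in_itv/= => /andP[s0 _]; rewrite derive1E.
    by have [_ ->] := dF s (lt_trans tn0 s0).
apply: (@le_lt_trans _ _ (F t)%:E); last exact: ltry.
apply: ge0_integral_bigcup_le => //.
- move=> n m nm; apply: subset_itvr; rewrite bnd_simp.
  by rewrite ler_pM2l// lef_pV2 ?posrE// ler_nat.
- by move=> n; apply/measurable_EFinP/measurable_funTS.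
- by move=> s; rewrite lee_fin powR_ge0.
Qed.

(** * The sequence of schemes and its moduli of continuity *)

Section euler_sequence.
Context {R : realType}.
Notation mu := (@lebesgue_measure R).
Variable N : R.
Hypothesis N0 : 0 < N.
Let N1 : 0 < N + 1. Proof. by move: (N0); lra. Qed.
Let N2 : 0 < N + 2. Proof. by move: (N0); lra. Qed.

Variable v0 : R -> R.
Hypothesis mv0 : measurable_fun setT v0.
Hypothesis v00 : v0 0 = 0.
Hypothesis intE :
  mu.-integrable `[0, +oo[ (EFin \o (fun b => wt N b * pot N (v0 b))).

Definition pot_energy : R := \int[mu]_(b in `[0, +oo[) (wt N b * pot N (v0 b)).
Local Notation E := pot_energy.
Local Notation K := (E + 1).

Definition es_clamp (n : nat) : R := n.+1%:R.
Definition es_eps (n : nat) : R := n.+1%:R^-1.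
(** With these parameters [euler_error] on [0, A] equals es_C n * A^3. *)
Definition es_C (n : nat) : R :=
  wt N (es_eps n) * ((N + 1) * es_clamp n `^ N) *
  (wt N (es_eps n) * es_clamp n `^ (N + 1)) ^+ 2 / 4.
(* The step is small enough for the accumulated error of the explicit scheme on
   [0, n] x [0, n] to be at most [es_eps n]. *)
Definition es_h (n : nat) : R :=
  Num.min (es_eps n) (es_eps n / (n%:R * (es_C n * n%:R ^+ 3) + 1)).
Definition es_V (n j : nat) : R -> R := euler N v0 (es_clamp n) (es_eps n) (es_h n) j.
Definition es_J (n : nat) (t : R) : nat := Num.truncn (t / es_h n).
(** The scheme read as a function of continuous time, constant on each step. Its jumps account for
    the extra term [es_h n] in the time modulus. *)
Definition es_X (n : nat) (t a : R) : R := es_V n (es_J n t) a.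
Definition es_G (n : nat) (j : nat) (a : R) : R :=
  euler_G N (es_clamp n) (es_eps n) (es_h n) (es_V n j) j a.

Lemma pot0 : pot N 0 = 0 :> R.
Proof. by rewrite /pot normr0 powR0 ?mul0r// gt_eqF. Qed.

Lemma pot_energy_ge0 : 0 <= E.
Proof. by apply: Rintegral_ge0 => b _; rewrite mulr_ge0 ?wt_ge0 ?pot_ge0. Qed.

Let K0 : 0 < K. Proof. by rewrite ltr_wpDl// pot_energy_ge0. Qed.

Lemma es_clamp_ge0 n : 0 <= es_clamp n. Proof. exact: ler0n. Qed.
Lemma es_eps_gt0 n : 0 < es_eps n. Proof. by rewrite invr_gt0. Qed.

Lemma es_C_ge0 n : 0 <= es_C n.
Proof.
rewrite /es_C !mulr_ge0 ?invr_ge0 ?wt_ge0 ?powR_ge0 ?sqr_ge0 ?(ltW N1)//.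
Qed.

Let den_gt0 n : 0 < n%:R * (es_C n * n%:R ^+ 3) + 1.
Proof.
rewrite ltr_wpDl//; apply: mulr_ge0 => //; apply: mulr_ge0; first exact: es_C_ge0.
exact: exprn_ge0.
Qed.

Lemma es_h_gt0 n : 0 < es_h n.
Proof. by rewrite lt_min es_eps_gt0/= divr_gt0 ?es_eps_gt0 ?den_gt0. Qed.

Lemma es_h_le n : es_h n <= es_eps n.
Proof. by rewrite ge_min lexx. Qed.

Lemma es_h_error n : n%:R * (es_C n * n%:R ^+ 3) * es_h n <= es_eps n.
Proof.
have : es_h n <= es_eps n / (n%:R * (es_C n * n%:R ^+ 3) + 1).
  by rewrite ge_min lexx orbT.
rewrite ler_pdivlMr ?den_gt0// mulrDr mulr1 mulrC => H.
by apply: le_trans H; rewrite lerDl ltW ?es_h_gt0.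
Qed.

Lemma es_J_itv n t : 0 <= t -> (es_J n t)%:R * es_h n <= t < (es_J n t)%:R * es_h n + es_h n.
Proof. exact/truncn_div_itv/es_h_gt0. Qed.

Let ptw n b : 0 <= b -> 0 <= euler_wt N (es_eps n) (es_h n) 0 b * potc N (es_clamp n) (v0 b)
  <= wt N b * pot N (v0 b).
Proof.
move=> b0; have p0 := potc_ge0 N0 (v0 b) (es_clamp_ge0 n).
rewrite mulr_ge0 ?wt_ge0//=.
(* At b = 0 the unshifted weight has its default value 0 and is no longer the larger one; here both
   sides vanish because v0 0 = 0. *)
have [->|bn0] := eqVneq b 0.
  rewrite v00 pot0 mulr0.
  have := potc_le_pot N0 (es_clamp n) 0; rewrite pot0 => p0'.
  by rewrite mulr_ge0_le0 ?wt_ge0.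
rewrite ler_pM ?wt_ge0 ?potc_le_pot// wt_le//; first by rewrite lt_neqAle eq_sym bn0.
by rewrite lerDl mul0r add0r ltW ?es_eps_gt0.
Qed.

Let subA A : `[0, A]%classic `<=` `[(0 : R), +oo[%classic.
Proof. by apply: subset_itvl; rewrite bnd_simp. Qed.

Lemma es_integrable0 n A : mu.-integrable `[0, A]
  (EFin \o (fun b => euler_wt N (es_eps n) (es_h n) 0 b * potc N (es_clamp n) (v0 b))).
Proof.
apply: (@integrable_dominated _ _ _ mu _ _ (fun b => wt N b * pot N (v0 b))) => //.
- apply: measurable_funTS; apply: measurable_funM; first exact: measurable_euler_wt.
  apply: measurableT_comp mv0; apply: continuous_measurable_fun.
  by apply: potc_continuous => //; exact: es_clamp_ge0.
- move=> b /=; rewrite in_itv/= => /andP[b0 _].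
  by have /andP[? ?] := ptw n b0; rewrite ger0_norm.
- exact: integrable_itvS intE.
Qed.

Lemma es_energy0_le n A : 0 <= A ->
  euler_energy N v0 (es_clamp n) (es_eps n) (es_h n) A 0 <= E.
Proof.
move=> A0; apply: (@le_trans _ _ (\int[mu]_(b in `[0, A]) (wt N b * pot N (v0 b)))).
  apply: le_Rintegral => //.
  - exact: es_integrable0.
  - exact: integrable_itvS intE.
  - by move=> b /=; rewrite in_itv/= => /andP[b0 _]; have /andP[] := ptw n b0.
rewrite /E -[leLHS]addr0 -lerBDl.
rewrite (@Rintegral_itvB _ _ (BLeft 0) +oo%O A)// ?bnd_simp//.
by apply: Rintegral_ge0 => b _; rewrite mulr_ge0 ?wt_ge0 ?pot_ge0.
Qed.

(** For t <= n at most n / h steps are made, each with an error of at most C n^3 h^2; the total n C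
    n^3 h is what [es_h_error] bounds. *)
Lemma es_budget n A t : 0 <= A <= n%:R -> 0 <= t <= n%:R ->
  euler_energy N v0 (es_clamp n) (es_eps n) (es_h n) A 0 +
  (es_J n t)%:R * (euler_error N (es_clamp n) (es_eps n) A * es_h n ^+ 2) <= E + es_eps n.
Proof.
move=> /andP[A0 An] /andP[t0 tn]; apply: lerD; first exact: es_energy0_le.
apply: le_trans (es_h_error n).
have -> : euler_error N (es_clamp n) (es_eps n) A = es_C n * A ^+ 3.
  by rewrite /euler_error /es_C; ring.
have -> : (es_J n t)%:R * (es_C n * A ^+ 3 * es_h n ^+ 2) =
  ((es_J n t)%:R * es_h n) * (es_C n * A ^+ 3) * es_h n by ring.
rewrite ler_wpM2r ?(ltW (es_h_gt0 n))// ler_pM//.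
- by rewrite mulr_ge0 ?(ltW (es_h_gt0 n)).
- by apply: mulr_ge0; [exact: es_C_ge0|exact: exprn_ge0].
- by have /andP[Jt _] := es_J_itv n t0; exact: le_trans Jt tn.
- by rewrite ler_wpM2l ?es_C_ge0// lerXn2r ?nnegrE.
Qed.

Let es_eps_le1 n : es_eps n <= 1.
Proof. by rewrite invf_le1// ler1n. Qed.

Lemma es_budgetK n A t : 0 <= A <= n%:R -> 0 <= t <= n%:R ->
  euler_energy N v0 (es_clamp n) (es_eps n) (es_h n) A 0 +
  (es_J n t)%:R * (euler_error N (es_clamp n) (es_eps n) A * es_h n ^+ 2) <= K.
Proof.
by move=> An tn; rewrite (le_trans (es_budget An tn))// lerD2l.
Qed.

Lemma es_X_energy_le n A t : 0 <= A <= n%:R -> 0 <= t <= n%:R ->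
  euler_energy N v0 (es_clamp n) (es_eps n) (es_h n) A (es_J n t) <= E + es_eps n.
Proof.
move=> /[dup] An /andP[A0 _] tn.
exact: (euler_energy_le N0 mv0 (es_clamp_ge0 n) (es_eps_gt0 n) (es_h_gt0 n)
  A0 (es_integrable0 n A) (es_budget An tn) (leqnn _)).
Qed.

Lemma es_J_le n t t' : 0 <= t' <= t -> (es_J n t' <= es_J n t)%N.
Proof.
by move=> /andP[t0 tt']; apply: le_truncn; rewrite ler_pM2r ?invr_gt0 ?es_h_gt0.
Qed.

Lemma es_time_modulus n a t t' : 0 <= a <= n%:R -> 0 <= t' <= t -> t <= n%:R ->
  `|es_X n t a - es_X n t' a| <= Num.sqrt ((t - t' + es_h n) * K).
Proof.
move=> /[dup] an /andP[a0 _] tt' tn.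
have /andP[t'0 t't] := tt'; have t0 := le_trans t'0 t't.
have JJ := subnKC (es_J_le n tt').
rewrite /es_X -JJ.
have := euler_time_holder N0 mv0 (es_clamp_ge0 n) (es_eps_gt0 n) (es_h_gt0 n)
  a0 (es_integrable0 n a) (es_budgetK an (t := t) _) (J := es_J n t')
  (n := es_J n t - es_J n t').
rewrite t0 tn JJ leqnn => /(_ isT isT)/le_trans; apply.
rewrite ler_wsqrtr// ler_pM2r// natrB ?es_J_le// mulrBl.
by have /andP[? ?] := es_J_itv n t0; have /andP[? ?] := es_J_itv n t'0; lra.
Qed.

Lemma es_X_bound n a t : 0 <= a <= n%:R -> 0 <= t <= n%:R ->
  `|es_X n t a - v0 a| <= Num.sqrt (t * K).
Proof.
move=> /[dup] an /andP[a0 _] /[dup] tn /andP[t0 _].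
have := euler_time_holder N0 mv0 (es_clamp_ge0 n) (es_eps_gt0 n) (es_h_gt0 n)
  a0 (es_integrable0 n a) (es_budgetK an tn) (J := 0%N) (n := es_J n t) (leqnn _).
rewrite add0n => /le_trans; apply.
by rewrite ler_wsqrtr// ler_pM2r//; have /andP[] := es_J_itv n t0.
Qed.

Lemma es_G0 n j : es_G n j 0 = 0.
Proof. by rewrite /es_G /euler_G set_itv1 Rintegral_set1. Qed.

Lemma es_X0 n t : es_X n t 0 = 0.
Proof.
rewrite /es_X /es_V; elim: (es_J n t) => [//|j IH] /=.
by rewrite IH -[euler_G _ _ _ _ _ _ _]/(es_G n j 0) es_G0 mulr0 subrr.
Qed.

Lemma es_XE n a t : es_X n t a - v0 a =
  - (es_h n / 2) * \sum_(i < es_J n t) es_G n i a.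
Proof.
have := euler_subE N v0 (es_clamp n) (es_eps n) (es_h n) a 0 (es_J n t).
by rewrite add0n => ->.
Qed.

Lemma es_G_modulus n (j : nat) a a' t lam : 0 <= a' <= a -> a <= n%:R ->
    0 <= t <= n%:R -> (j <= es_J n t)%N -> 0 < lam ->
  `|es_G n j a - es_G n j a'| <= lam * (N + 2) * K +
     (lam `^ (N + 1))^-1 * (wt N (a' + (j%:R * es_h n + es_eps n)) * (a - a')).
Proof.
move=> /[dup] aa' /andP[a'0 a'a] an tn jJ l0.
have a0 := le_trans a'0 a'a.
have an' : 0 <= a <= n%:R by rewrite a0.
exact: (euler_G_space_modulus N0 mv0 (es_clamp_ge0 n) (es_eps_gt0 n) (es_h_gt0 n)
  a0 (es_integrable0 n a) (es_budgetK an' tn) jJ aa' l0).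
Qed.

(** The moduli of G are added over the steps up to t, whose total length is at most t, with every
    weight bounded by [wt N a']; this bound forces a' > 0. The data are subtracted because v0 has no
    modulus of its own. *)
Lemma es_space_modulus n a a' t lam : 0 < a' <= a -> a <= n%:R ->
    0 <= t <= n%:R -> 0 < lam ->
  `|(es_X n t a - v0 a) - (es_X n t a' - v0 a')| <=
  t / 2 * (lam * (N + 2) * K + (lam `^ (N + 1))^-1 * (wt N a' * (a - a'))).
Proof.
move=> /andP[a'0 a'a] an /[dup] tn /andP[t0 _] l0.
rewrite !es_XE -mulrBr -sumrB normrM normrN (@ger0_norm _ (es_h n / 2)); last first.
  by rewrite divr_ge0// ltW ?es_h_gt0.
set Z := (X in _ <= _ * X).
have Z0 : 0 <= Z.
  by rewrite addr_ge0 ?mulr_ge0 ?invr_ge0 ?powR_ge0 ?wt_ge0 ?subr_ge0 ?(ltW l0) ?(ltW N2) ?(ltW K0).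
apply: (@le_trans _ _ (es_h n / 2 * ((es_J n t)%:R * Z))).
  rewrite ler_wpM2l ?divr_ge0 ?(ltW (es_h_gt0 n))//.
  apply: le_trans (ler_norm_sum _ _ _) _.
  rewrite mulr_natl -[X in _ *+ X]card_ord -sumr_const; apply: ler_sum => i _.
  have iJ : (i <= es_J n t)%N by exact: ltnW.
  have aa' : 0 <= a' <= a by rewrite ltW.
  apply: le_trans (es_G_modulus aa' an tn iJ l0) _.
  rewrite lerD2l ler_wpM2l ?invr_ge0 ?powR_ge0// ler_wpM2r ?subr_ge0//.
  apply: wt_le => //; rewrite lerDl addr_ge0 ?mulr_ge0 ?(ltW (es_h_gt0 n))//.
  exact: ltW (es_eps_gt0 n).
rewrite mulrA ler_wpM2r// mulrAC ler_wpM2r ?invr_ge0//.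
by rewrite mulrC; have /andP[] := es_J_itv n t0.
Qed.

(** The choice lam = s^(-N/(N+1)) makes lam^-(N+1) equal to s^N, which cancels the weight at time s
    in the modulus between 0 and a. What remains is a majorant independent of n and integrable in s,
    since N/(N+1) < 1. *)
Lemma es_G_bound n s a : 0 <= a <= n%:R -> 0 < s <= n%:R ->
  `|es_G n (es_J n s) a| <= (N + 2) * K * s `^ (- (N / (N + 1))) + a.
Proof.
move=> /andP[a0 an] /andP[s0 sn].
have l0 : 0 < s `^ (- (N / (N + 1))) by rewrite powR_gt0.
have sn' : 0 <= s <= n%:R by rewrite ltW.
have a00 : (0 : R) <= 0 <= a by rewrite lexx.
have := es_G_modulus a00 an sn' (leqnn _) l0.
rewrite es_G0 !subr0 add0r => /le_trans; apply.
apply: lerD; first by rewrite -mulrA mulrC.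
have -> : (s `^ (- (N / (N + 1)))) `^ (N + 1) = (s `^ N)^-1.
  rewrite -powRrM mulNr mulfVK ?powRN// gt_eqF//.
rewrite invrK; apply: (@le_trans _ _ (s `^ N * (wt N s * a))).
  rewrite ler_wpM2l ?powR_ge0// ler_wpM2r// wt_le//.
  (* The time is rounded down to j h, but the shift [es_eps n] is at least one step, so j h + eps >=
     s. *)
  have /andP[_ /ltW sJ] := es_J_itv n (ltW s0); apply: le_trans sJ _.
  by rewrite lerD2l es_h_le.
by rewrite mulrA /wt mulfV ?mul1r// gt_eqF// powR_gt0.
Qed.

(** Extended by 0 outside the region where the moduli apply, so that convergence can be claimed at
    every point of the plane. The line a = 0 is left out because the space modulus degenerates
    there; nothing is lost, as the schemes and the data vanish on it. *)
Definition es_D (n : nat) (p : R * R) : R :=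
  if (0 <= p.1) && (0 < p.2) then es_X n p.1 p.2 - v0 p.2 else 0.

Let es_q (m : nat) : R * R :=
  if unpickle m is Some (q1, q2) then (ratr (q1 : rat), ratr (q2 : rat)) else (0, 0).

Let es_q_dense (p : R * R) (d : R) : 0 < d -> exists m,
  [/\ p.1 < (es_q m).1 < p.1 + d & p.2 < (es_q m).2 < p.2 + d].
Proof.
move=> d0.
have [q1] : exists q, ratr q \in `]p.1, p.1 + d[ by apply: rat_in_itvoo; rewrite ltrDl.
have [q2] : exists q, ratr q \in `]p.2, p.2 + d[ by apply: rat_in_itvoo; rewrite ltrDl.
rewrite !in_itv/= => H2 H1; exists (pickle (q1, q2)).
by rewrite /es_q pickleK.
Qed.

Let nat_ge (x : R) : exists n0 : nat, forall n, (n0 <= n)%N -> x <= n%:R.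
Proof.
exists (Num.truncn x).+1 => n xn; have [x0|x0] := leP 0 x.
  have /truncn_itv/andP[_ /ltW xT] := x0; apply: le_trans xT _.
  by rewrite ler_nat.
by rewrite (le_trans (ltW x0)).
Qed.

Let es_D_bounded m : exists (B : R) n0, forall n, (n0 <= n)%N -> `|es_D n (es_q m)| <= B.
Proof.
case: (es_q m) => t a; exists (Num.sqrt (t * K)).
have [n1 H1] := nat_ge t; have [n2 H2] := nat_ge a.
exists (maxn n1 n2) => n; rewrite geq_max => /andP[/H1 tn /H2 an].
rewrite /es_D/=; case: ifPn => [/andP[t0 a0]|_]; last by rewrite normr0 sqrtr_ge0.
by apply: es_X_bound; rewrite ?(ltW a0) ?t0.
Qed.

(** The rational point is taken slightly later and slightly farther than p, hence stays in the
    region. For the time increment, the distance and the step are each at most e^2/(8K), which gives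
    sqrt((e/2)^2). For the space increment, lam = e/(2 c1) and the distance e/(2 c2) make each of
    the two terms at most e/4. *)
Let es_D_equicontinuous (p : R * R) (e : R) : 0 < e -> exists m n0,
  forall n, (n0 <= n)%N -> `|es_D n p - es_D n (es_q m)| <= e.
Proof.
move=> e0; case: p => t a.
have [/andP[t0 a0]|/negbTE ta] := boolP ((0 <= t) && (0 < a)); last first.
  (* Outside the region the value is 0, and so it is at a rational point whose time lies in ]-2,
     -1[. *)
  have [m [/andP[_ qm] _]] := es_q_dense (- 2, - 2) ltr01.
  exists m, 0%N => n _; rewrite /es_D/= ta.
  have /negbTE -> : ~~ (0 <= (es_q m).1) by rewrite -ltNge; move: qm => /=; lra.
  by rewrite /= subrr normr0 ltW.
have c10 : 0 < (t + 1) * ((N + 2) * K) by rewrite !mulr_gt0//; lra.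
set c1 := (t + 1) * _ in c10.
have l0 : 0 < e / (2 * c1) by rewrite divr_gt0// mulr_gt0.
set lam := e / _ in l0.
have c20 : 0 < (t + 1) * ((lam `^ (N + 1))^-1 * wt N a).
  by rewrite !mulr_gt0 ?invr_gt0 ?powR_gt0 ?wt_gt0//; lra.
set c2 := (t + 1) * _ in c20.
have e80 : 0 < e ^+ 2 / (8 * K) by rewrite divr_gt0 ?exprn_gt0// mulr_gt0.
have d0 : 0 < Num.min (e / (2 * c2)) (e ^+ 2 / (8 * K)).
  by rewrite lt_min e80 andbT divr_gt0// mulr_gt0.
set d := Num.min _ _ in d0.
have [m [/andP[]]] := es_q_dense (t, a) d0.
case qE : (es_q m) => [t' a'] /= tt' t'd /andP[aa' a'd].
have [n1 H1] := nat_ge t'; have [n2 H2] := nat_ge a'.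
have [n3 H3] := nat_ge ((e ^+ 2 / (8 * K))^-1).
exists m, (maxn n1 (maxn n2 n3)) => n.
rewrite !geq_max => /andP[/H1 t'n /andP[/H2 a'n /H3 en]].
have t'0 : 0 <= t' by rewrite (le_trans t0)// ltW.
have a'0 : 0 < a' by rewrite (lt_trans a0).
rewrite /es_D qE/= t0 a0 t'0 a'0/=.
have tn : 0 <= t <= n%:R by rewrite t0 (le_trans (ltW tt')).
have A1 := @es_space_modulus n a' a t lam.
rewrite a0 (ltW aa') in A1; move: A1 => /(_ isT a'n tn l0) A1.
have A2 := @es_time_modulus n a' t' t.
rewrite t0 (ltW tt') (ltW a'0) a'n in A2; move: A2 => /(_ isT isT t'n) A2.
rewrite distrC.
have -> : es_X n t' a' - v0 a' - (es_X n t a - v0 a) =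
  (es_X n t' a' - es_X n t a') + ((es_X n t a' - v0 a') - (es_X n t a - v0 a)) by ring.
rewrite (le_trans (ler_normD _ _))// [leRHS]splitr; apply: lerD.
  apply: le_trans A2 _; rewrite -[e / 2]ger0_norm ?divr_ge0 ?(ltW e0)// -sqrtr_sqr.
  rewrite ler_wsqrtr//.
  have dK : d <= e ^+ 2 / (8 * K) by rewrite ge_min lexx orbT.
  have hK : es_h n <= e ^+ 2 / (8 * K).
    apply: le_trans (es_h_le n) _; rewrite /es_eps -[leRHS]invrK lef_pV2 ?posrE ?invr_gt0//.
    by rewrite (le_trans en)// ler_nat.
  have -> : (e / 2) ^+ 2 = (e ^+ 2 / (8 * K) + e ^+ 2 / (8 * K)) * K.
    by field; rewrite gt_eqF.
  by rewrite ler_pM2r//; lra.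
apply: le_trans A1 _.
have dc : d <= e / (2 * c2) by rewrite ge_min lexx.
have B1 : lam * c1 = e / 2 by rewrite /lam; field; rewrite gt_eqF.
have B2 : c2 * (a' - a) <= e / 2.
  have : c2 * (a' - a) <= c2 * (e / (2 * c2)) by rewrite ler_pM2l//; lra.
  by move/le_trans; apply; rewrite le_eqVlt; apply/orP; left; apply/eqP; field; rewrite gt_eqF.
have B3 : t / 2 * (lam * (N + 2) * K) <= (lam * c1) / 2.
  have -> : lam * c1 / 2 = (t + 1) / 2 * (lam * (N + 2) * K) by rewrite /c1; ring.
  apply: ler_wpM2r; last by lra.
  exact: mulr_ge0 (mulr_ge0 (ltW l0) (ltW N2)) (ltW K0).
have B4 : t / 2 * ((lam `^ (N + 1))^-1 * (wt N a * (a' - a))) <= c2 * (a' - a) / 2.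
  have -> : c2 * (a' - a) / 2 = (t + 1) / 2 * ((lam `^ (N + 1))^-1 * (wt N a * (a' - a))).
    by rewrite /c2; ring.
  apply: ler_wpM2r; last by lra.
  by rewrite mulr_ge0 ?invr_ge0 ?powR_ge0// mulr_ge0 ?wt_ge0 ?subr_ge0 ?(ltW aa').
by rewrite mulrDr; lra.
Qed.

Lemma es_subsequence : exists phi : nat -> nat, (forall k, (k <= phi k)%N) /\
  forall p, cvgn (fun k => es_D (phi k) p).
Proof.
exact: subsequence_cvg_of_asymptotic_equicontinuity es_D_bounded es_D_equicontinuous.
Qed.

Lemma measurable_es_D n :
  measurable_fun setT (es_D n : measurableTypeR R * measurableTypeR R -> R).
Proof.
pose S := [set p : measurableTypeR R * measurableTypeR R | 0 <= p.1].
have mS : measurable S.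
  rewrite (_ : S = `[0, +oo[%classic `*` setT).
    by apply: measurableX => //; exact: measurable_itv.
  by apply/seteqP; split=> p /=; rewrite in_itv/= andbT; [|case].
pose S' := [set p : measurableTypeR R * measurableTypeR R | 0 < p.2].
have mS' : measurable S'.
  rewrite (_ : S' = setT `*` `]0, +oo[%classic).
    by apply: measurableX => //; exact: measurable_itv.
  by apply/seteqP; split=> p /=; rewrite in_itv/= andbT; [|case].
have m1 : measurable_fun S (fun p => es_X n p.1 p.2 - v0 p.2).
  apply: measurable_funB; last first.
    by apply: measurable_funTS; apply: measurableT_comp.
  apply: (@measurable_truncn_uncurry _ _ (es_h_gt0 n) (es_V n)) => j.
  by apply: measurable_euler => //; exact: es_clamp_ge0.
have := (measurable_restrictT (fun p => es_X n p.1 p.2 - v0 p.2) (measurableI _ _ mS mS')).1.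
have -> : (fun p => es_X n p.1 p.2 - v0 p.2) \_ (S `&` S') = es_D n.
  apply/funext => p; rewrite /patch /es_D.
  suff -> : (p \in S `&` S') = (0 <= p.1) && (0 < p.2) by [].
  by apply/idP/idP; rewrite inE /S /S'/= => /andP.
by apply; apply: measurable_funS m1.
Qed.

End euler_sequence.

(** * The radial evolution *)

Section open_closed.
Context {R : realType}.
Notation mu := (@lebesgue_measure R).

(** The integrands of the schemes are shown to converge only for 0 < s < t, whereas the equation is
    written on [0, t]. *)
Lemma integral_oo_cc (f : R -> \bar R) (t : R) : measurable_fun `]0, t[ f ->
  measurable_fun `[0, t] f /\
  (\int[mu]_(s in `[0%R, t]) f s)%E = (\int[mu]_(s in `]0%R, t[) f s)%E.
Proof.
move=> mf.
have mf1 : measurable_fun `[0, t[ f.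
  have [t0|t0] := ltP 0 t; last by rewrite set_itv_ge ?bnd_simp -?leNgt//; exact: measurable_fun_set0.
  rewrite -(@setU1itv _ _ (BLeft t) 0 false) ?bnd_simp//.
  by apply/measurable_funU => //; split=> //; exact: measurable_fun_set1.
have mf2 : measurable_fun `[0, t] f.
  have [t0|t0] := leP 0 t; last by rewrite set_itv_ge ?bnd_simp -?ltNge//; exact: measurable_fun_set0.
  rewrite -(@setUitv1 _ _ (BLeft 0) t true) ?bnd_simp//.
  by apply/measurable_funU => //; split=> //; exact: measurable_fun_set1.
by split=> //; rewrite -integral_itv_bndo_bndc// -integral_itv_obnd_cbnd.
Qed.

Lemma Rintegral_oo_cc (f : R -> R) (t : R) : measurable_fun `]0, t[ f ->
  \int[mu]_(s in `[0, t]) f s = \int[mu]_(s in `]0, t[) f s.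
Proof.
by move=> /measurable_EFinP mf; rewrite /Rintegral; have [_ ->] := integral_oo_cc mf.
Qed.

Lemma integrable_oo_cc (f : R -> R) (t : R) : mu.-integrable `]0, t[ (EFin \o f) ->
  mu.-integrable `[0, t] (EFin \o f).
Proof.
move=> /integrableP[mf foo]; have [mf' _] := integral_oo_cc mf.
apply/integrableP; split => //.
have mfn : measurable_fun `]0, t[ (abse \o (EFin \o f)) by exact: measurableT_comp.
by have [_ ->] := integral_oo_cc mfn.
Qed.

End open_closed.

(** * Passage to the limit in the schemes *)

Section limit.
Context {R : realType}.
Notation mu := (@lebesgue_measure R).
Variable N : R.
Hypothesis N0 : 0 < N.
Let N1 : 0 < N + 1. Proof. by move: (N0); lra. Qed.
Let N2 : 0 < N + 2. Proof. by move: (N0); lra. Qed.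

Variable v0 : R -> R.
Hypothesis mv0 : measurable_fun setT v0.
Hypothesis v00 : v0 0 = 0.
Hypothesis intE :
  mu.-integrable `[0, +oo[ (EFin \o (fun b => wt N b * pot N (v0 b))).

Local Notation E := (pot_energy N v0).
Local Notation K := (E + 1).
Let K0 : 0 < K. Proof. by rewrite ltr_wpDl// pot_energy_ge0. Qed.

Lemma integrable_powR_data a :
  mu.-integrable `[0, a] (EFin \o (fun b => `|v0 b| `^ (N + 2))).
Proof.
apply: (@integrable_dominated _ _ _ mu _ _
  (fun b => (N + 2) * a `^ N * (wt N b * pot N (v0 b)))) => //.
- apply: measurable_funTS.
  apply: (measurableT_comp (measurable_powR _)); exact: measurableT_comp.
- move=> b /=; rewrite in_itv/= => /andP[b0 ba].
  rewrite ger0_norm ?powR_ge0//.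
  have -> : `|v0 b| `^ (N + 2) = (N + 2) * pot N (v0 b).
    by rewrite /pot mulrCA mulfV ?mulr1// gt_eqF.
  rewrite -mulrA ler_wpM2l ?(ltW N2)//.
  have [->|bn0] := eqVneq b 0.
    by rewrite v00 pot0// !mulr0.
  have b0' : 0 < b by rewrite lt_neqAle eq_sym bn0.
  rewrite mulrA ler_peMl ?pot_ge0// /wt ler_pdivlMr ?powR_gt0// mul1r.
  by rewrite ge0_ler_powR ?nnegrE ?(ltW N0)// (le_trans b0).
- apply: integrable_itvZ; apply: integrable_itvS intE.
  by apply: subset_itvl; rewrite bnd_simp.
Qed.

Variable phi : nat -> nat.
Hypothesis phik : forall k, (k <= phi k)%N.
Hypothesis cphi : forall p, cvgn (fun k => es_D N v0 (phi k) p).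

Definition evol (t a : R) : R := v0 a + limn (fun k => es_D N v0 (phi k) (t, a)).
Local Notation V := evol.

Let nat_ge (x : R) : exists n0 : nat, forall n, (n0 <= n)%N -> x <= (phi n)%:R.
Proof.
exists (Num.truncn x).+1 => n xn; have [x0|x0] := leP 0 x; last first.
  by rewrite (le_trans (ltW x0)).
have /truncn_itv/andP[_ /ltW xT] := x0; apply: le_trans xT _.
by rewrite ler_nat (leq_trans xn).
Qed.

Let phioo : phi k @[k --> \oo] --> \oo.
Proof.
move=> A [n0 _ HA]; exists n0 => // k /= n0k; apply: HA => /=.
exact: leq_trans n0k (phik k).
Qed.

Let eps_cvg : es_eps (phi k) @[k --> \oo] --> (0 : R).
Proof. by apply: (cvg_comp _ _ phioo); exact: cvg_harmonic. Qed.

Let clamp_cvg : es_clamp (phi k) @[k --> \oo] --> (+oo : set_system R).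
Proof.
apply/cvgryPge => A; have [n0 H] := nat_ge A.
by exists n0 => // n /= n0n; rewrite (le_trans (H _ n0n))// ler_nat.
Qed.

Lemma measurable_evol :
  measurable_fun setT (fun p : measurableTypeR R * measurableTypeR R => V p.1 p.2).
Proof.
apply: measurable_funD; first exact: measurableT_comp.
apply: (@measurable_fun_cvg _ _ _ _ (fun k p => es_D N v0 (phi k) p)) => //.
  by move=> k; exact: measurable_es_D.
by move=> [t a] _ /=; exact: (@cphi (t, a)).
Qed.

Lemma cvg_evol t a : 0 <= t -> 0 <= a ->
  es_X N v0 (phi k) t a @[k --> \oo] --> V t a.
Proof.
move=> t0 a0; have D := @cphi (t, a).
rewrite (_ : (fun k => _) = fun k => v0 a + es_D N v0 (phi k) (t, a)).
  by apply: cvgD => //; exact: cvg_cst.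
apply/funext => k; rewrite /es_D/= t0/= lt_neqAle a0 andbT eq_sym.
have [->|an0]/= := eqVneq a 0; first by rewrite es_X0// v00 addr0.
by rewrite addrC subrK.
Qed.

Lemma evol_bound t a : 0 <= t -> 0 <= a -> `|V t a - v0 a| <= Num.sqrt (t * K).
Proof.
move=> t0 a0.
have cX : `|es_X N v0 (phi k) t a - v0 a| @[k --> \oo] --> `|V t a - v0 a|.
  by apply: cvg_norm; apply: cvgB; [exact: cvg_evol|exact: cvg_cst].
rewrite -(cvg_lim _ cX)//; apply: limr_le; first by apply/cvg_ex; eexists; exact: cX.
have [n1 H1] := nat_ge t; have [n2 H2] := nat_ge a.
exists (maxn n1 n2) => // n /=; rewrite geq_max => /andP[/H1 tn /H2 an].
by apply: es_X_bound => //; rewrite ?t0 ?a0.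
Qed.

Lemma evol_negative t a : t < 0 \/ a <= 0 -> V t a = v0 a.
Proof.
move=> ta; rewrite /evol (_ : (fun k => _) = fun=> 0) ?lim_cst ?addr0//.
apply/funext => k; rewrite /es_D/=.
have -> // : (0 <= t) && (0 < a) = false.
by apply/negbTE; rewrite negb_and -ltNge -leNgt; apply/orP.
Qed.

Lemma evol0 a : V 0 a = v0 a.
Proof.
have [a0|a0] := leP 0 a; last by rewrite evol_negative//; right; exact: ltW.
have := evol_bound (lexx 0) a0.
by rewrite mul0r sqrtr0 normr_le0 subr_eq0 => /eqP.
Qed.

(** The shifted time at which the scheme evaluates its weight. It is at least s, so the weight never
    exceeds [wt N s] for b >= 0. *)
Let tau k s := (es_J N (phi k) s)%:R * es_h N (phi k) + es_eps (phi k).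

Let tau_itv k s : 0 <= s -> s <= tau k s <= s + es_eps (phi k).
Proof.
move=> s0; have /andP[J1 /ltW J2] := es_J_itv N0 (phi k) s0.
rewrite /tau lerD2r J1 andbT (le_trans J2)// lerD2l; exact: es_h_le.
Qed.

Let tau_cvg s : 0 <= s -> tau k s @[k --> \oo] --> s.
Proof.
move=> s0; apply: (@squeeze_cvgr _ _ _ _ (fun=> s) (fun k => s + es_eps (phi k))).
- by apply: nearW => k; exact: tau_itv.
- exact: cvg_cst.
- by rewrite -[X in _ --> X]addr0; apply: cvgD => //; exact: cvg_cst.
Qed.

Definition evol_g (s b : R) : R := wt N (b + s) * nl N (V s b).
Definition evol_G (s a : R) : R := \int[mu]_(b in `[0, a]) evol_g s b.

Let gk k s b := euler_g N (es_clamp (phi k)) (es_eps (phi k)) (es_h N (phi k))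
  (es_V N v0 (phi k) (es_J N (phi k) s)) (es_J N (phi k) s) b.

Let wt_tau_cvg s b : 0 < s -> 0 <= b -> wt N (b + tau k s) @[k --> \oo] --> wt N (b + s).
Proof.
move=> s0 b0; have : b + tau k s @[k --> \oo] --> b + s.
  by apply: cvgD; [exact: cvg_cst|exact: tau_cvg (ltW s0)].
by move=> H; apply: (cvg_comp _ _ H); apply: wt_continuous_at => //; rewrite ltr_wpDl.
Qed.

Let gk_cvg s b : 0 < s -> 0 <= b -> gk k s b @[k --> \oo] --> evol_g s b.
Proof.
move=> s0 b0; apply: cvgM; first exact: wt_tau_cvg.
by apply: nlc_cvg => //; exact: cvg_evol (ltW s0) b0.
Qed.

(** A majorant in b at fixed s: |V|^(N+1) <= 1 + |V|^(N+2), and V differs from v0 by at most sqrt(s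
    K) along the schemes. *)
Let dom s b := wt N s * (1 + 2 `^ (N + 2) * (`|v0 b| `^ (N + 2) + Num.sqrt (s * K) `^ (N + 2))).

Let integrable_dom s a : mu.-integrable `[0, a] (EFin \o dom s).
Proof.
apply: integrable_itvZ; apply: integrable_itvD; first exact: integrable_itv_cst.
apply: integrable_itvZ; apply: integrable_itvD; last exact: integrable_itv_cst.
exact: integrable_powR_data.
Qed.

Let gk_dom k s a b : 0 < s <= (phi k)%:R -> a <= (phi k)%:R -> b \in `[0, a] ->
  `|gk k s b| <= dom s b.
Proof.
move=> /andP[s0 sk] ak; rewrite in_itv/= => /andP[b0 ba].
rewrite /gk /euler_g normrM ger0_norm ?wt_ge0// /dom.
have /andP[st _] := tau_itv k (ltW s0).
apply: ler_pM => //; first exact: wt_ge0.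
  by apply: wt_le => //; rewrite -[leLHS]add0r lerD.
apply: le_trans (norm_nlc_le_powR N0 _ (es_clamp_ge0 _)) _.
apply: le_trans (powRS_le_young N0 ltr01 (normr_ge0 _)) _.
rewrite mul1r powR1 invr1 addrC lerD2l.
set X := es_V _ _ _ _ _.
have -> : X = v0 b + (X - v0 b) by ring.
apply: le_trans (powR_normD_le _ _ (ltW N2)) _.
rewrite ler_wpM2l ?powR_ge0// lerD2l ge0_ler_powR ?nnegrE ?sqrtr_ge0 ?(ltW N2)//.
by apply: es_X_bound => //; rewrite ?b0 ?(ltW s0)//= (le_trans ba).
Qed.

Let evol_G_aux s a : 0 < s -> mu.-integrable `[0, a] (EFin \o evol_g s) /\
  es_G N v0 (phi k) (es_J N (phi k) s) a @[k --> \oo] --> evol_G s a.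
Proof.
move=> s0; have [n1 H1] := nat_ge s; have [n2 H2] := nat_ge a.
apply: (@Rintegral_dominated_cvg _ _ _ mu _ (fun k => gk k s) (evol_g s) (dom s)
  (maxn n1 n2)) => //.
- by move=> k; apply: measurable_funTS; apply: measurable_euler_g => //; exact: es_clamp_ge0.
- by move=> b /=; rewrite in_itv/= => /andP[b0 _]; exact: gk_cvg.
- move=> n b; rewrite geq_max => /andP[/H1 sn /H2 an] /= ba.
  by apply: (gk_dom _ an ba); rewrite s0.
Qed.

Lemma integrable_evol_g s a : 0 < s -> mu.-integrable `[0, a] (EFin \o evol_g s).
Proof. by move=> s0; have [] := evol_G_aux a s0. Qed.

Let evol_G_cvg s a : 0 < s ->
  es_G N v0 (phi k) (es_J N (phi k) s) a @[k --> \oo] --> evol_G s a.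
Proof. by move=> s0; have [] := evol_G_aux a s0. Qed.

Let theta := N / (N + 1).

Let theta1 : theta < 1. Proof. by rewrite ltr_pdivrMr// mul1r ltrDl. Qed.

Let domt a s := (N + 2) * K * s `^ (- theta) + a.

Let integrable_domt a t : 0 < t -> mu.-integrable `]0, t[ (EFin \o domt a).
Proof.
move=> t0; apply: (@integrable_itvS _ `]0, t]).
  by apply: subset_itvl; rewrite bnd_simp.
apply: integrable_itvD.
  apply: integrable_itvZ; exact: integrable_powR_itv.
apply: (@integrable_itvS _ `[0, t]); last exact: integrable_itv_cst.
by apply: subset_itvr; rewrite bnd_simp.
Qed.

(** The flux of the scheme restricted to the completed steps, so that its integral over [0, t] is
    exactly the Euler sum in [es_XE]. *)
Let fk k a t s := ((fun s => es_G N v0 (phi k) (es_J N (phi k) s) a) \_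
  `[0, (es_J N (phi k) t)%:R * es_h N (phi k)[) s.

(** A second dominated convergence, now in s, with the majorant of [es_G_bound]; the first, in b at
    fixed s, identified the limit of the fluxes. *)
Lemma evolE t a : 0 <= t -> 0 <= a ->
  mu.-integrable `[0, t] (EFin \o (fun s => evol_G s a)) /\
  V t a = v0 a - 1 / 2 * \int[mu]_(s in `[0, t]) evol_G s a.
Proof.
rewrite le_eqVlt => /predU1P[<-|t0] a0.
  rewrite set_itv1 Rintegral_set1 mulr0 subr0 evol0; split=> //.
  rewrite -set_itv1; apply: integrable_oo_cc.
  rewrite set_itv_ge ?bnd_simp ?ltxx//.
  by apply/integrableP; split; [exact: measurable_fun_set0|rewrite integral_set0].
have [n1 H1] := nat_ge t; have [n2 H2] := nat_ge a.
have mfk k : measurable_fun setT (fk k a t).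
  apply/(measurable_restrictT _ _).1 => //.
  exact: (measurable_truncn_comp (es_h_gt0 N0 (phi k)) (fun j => es_G N v0 (phi k) j a)).
have [] := @Rintegral_dominated_cvg _ _ _ mu `]0, t[ (fun k => fk k a t) (evol_G ^~ a)
  (domt a) (maxn n1 n2).
- by [].
- by move=> k; apply: measurable_funTS; exact: mfk.
- move=> s /=; rewrite in_itv/= => /andP[s0 st].
  have := @evol_G_cvg s a s0; apply: cvg_trans; apply: near_eq_cvg.
  have ts0 : 0 < t - s by rewrite subr_gt0.
  have /cvgrPdist_lt/(_ _ ts0) := eps_cvg.
  apply: filterS => k; rewrite sub0r normrN gtr0_norm ?es_eps_gt0// => kts.
  rewrite /fk /patch mem_setE in_itv/= (ltW s0)/= ifT//.
  have /andP[_ J2] := es_J_itv N0 (phi k) (ltW t0).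
  have := es_h_le N (phi k); lra.
- exact: integrable_domt.
- move=> n s; rewrite geq_max => /andP[/H1 tn /H2 an] /=; rewrite in_itv/= => /andP[s0 st].
  rewrite /fk /patch; case: ifPn => _; last first.
    by rewrite normr0 addr_ge0 ?mulr_ge0 ?powR_ge0 ?(ltW N2) ?(ltW K0).
  apply: es_G_bound => //; first by rewrite a0.
  by rewrite s0 (le_trans (ltW st)).
move=> iG; rewrite -Rintegral_oo_cc; last exact: integrable_measurable_fun iG.
move=> cG; split; first exact: integrable_oo_cc.
have cB : es_X N v0 (phi k) t a - v0 a @[k --> \oo] -->
    - (1 / 2) * \int[mu]_(s in `[0, t]) evol_G s a.
  rewrite (_ : (fun k => _) = fun k => - (1 / 2) * \int[mu]_(s in `]0, t[) fk k a t s).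
    by apply: cvgM => //; exact: cvg_cst.
  apply/funext => k; rewrite es_XE//.
  have /andP[J1 J2] := es_J_itv N0 (phi k) (ltW t0).
  rewrite -Rintegral_oo_cc; last by apply: measurable_funTS; exact: mfk.
  rewrite /fk -Rintegral_mkcondr.
  rewrite (_ : `[0, t] `&` _ = `[0, (es_J N (phi k) t)%:R * es_h N (phi k)[%classic).
    rewrite (Rintegral_truncn_comp (es_h_gt0 N0 (phi k)) (fun j => es_G N v0 (phi k) j a)).
    by ring.
  by apply/setIidr; apply: subset_itvl; rewrite bnd_simp.
have cA : es_X N v0 (phi k) t a - v0 a @[k --> \oo] --> V t a - v0 a.
  by apply: cvgB; [exact: cvg_evol (ltW t0) a0|exact: cvg_cst].
have EQ : V t a - v0 a = - (1 / 2) * \int[mu]_(s in `[0, t]) evol_G s a.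
  by rewrite -(cvg_lim _ cA)// (cvg_lim _ cB).
by rewrite -[LHS](subrK (v0 a)) EQ; ring.
Qed.

(** For t > 0 the shifted weights converge at every b >= 0, and Fatou's lemma on [0, m] passes to
    the limit in the energies of the schemes; the intervals then exhaust the half-line. At t = 0
    both sides are the same integral. *)
Lemma evol_energy_le t : 0 <= t ->
  (\int[mu]_(b in `[0%R, +oo[) (wt N (b + t) * pot N (V t b))%:E <= E%:E)%E.
Proof.
rewrite le_eqVlt => /predU1P[<-|t0].
  rewrite /pot_energy /Rintegral fineK; last exact: integrable_fin_num.
  rewrite le_eqVlt; apply/orP; left; apply/eqP.
  by apply: eq_integral => b _; rewrite addr0 evol0.
have mpot : measurable_fun setT (pot N).
  by apply: continuous_measurable_fun; exact: pot_continuous.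
have mVt : measurable_fun setT (V t).
  exact: (measurableT_comp measurable_evol (@pair1_measurable _ _ (measurableTypeR R) (measurableTypeR R) t)).
have mdens : measurable_fun setT (fun b : R => wt N (b + t) * pot N (V t b)).
  apply: measurable_funM; last exact: measurableT_comp.
  by apply: (measurableT_comp (measurable_wt N)); exact: measurable_funD.
have -> : `[(0 : R), +oo[%classic = \bigcup_n `[(0 : R), n%:R]%classic.
  apply/seteqP; split=> [x /=|x [n _] /=]; rewrite !in_itv/= ?andbT; last by case/andP.
  move=> x0; exists (Num.truncn x).+1 => //=; rewrite in_itv/= x0/=.
  by have /truncn_itv/andP[_ /ltW] := x0.
apply: ge0_integral_bigcup_le => //.
- by move=> n m nm; apply: subset_itvl; rewrite bnd_simp ler_nat.
- by move=> n; apply/measurable_EFinP; apply: measurable_funTS.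
- by move=> b; rewrite lee_fin mulr_ge0 ?wt_ge0 ?pot_ge0.
move=> m; set A : R := m%:R.
pose dk (k : nat) (b : R) := euler_wt N (es_eps (phi k)) (es_h N (phi k)) (es_J N (phi k) t) b *
  potc N (es_clamp (phi k)) (es_X N v0 (phi k) t b).
have mdk k : measurable_fun setT (dk k).
  apply: measurable_funM; first exact: measurable_euler_wt.
  apply: (@measurableT_comp _ _ _ _ _ _ (potc N (es_clamp (phi k)))).
    by apply: continuous_measurable_fun; apply: potc_continuous => //; exact: es_clamp_ge0.
  by apply: measurable_euler => //; exact: es_clamp_ge0.
have dk0 k b : 0 <= dk k b.
  by rewrite mulr_ge0 ?wt_ge0// potc_ge0//; exact: es_clamp_ge0.
have idk k : mu.-integrable `[0, A] (EFin \o dk k).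
  exact: (integrable_euler_energy N0 mv0 (es_clamp_ge0 _) (es_eps_gt0 _) (es_h_gt0 N0 _)
    (ler0n R m) (es_integrable0 N0 mv0 v00 intE _ _)).
have := @fatou _ _ _ mu `[0, A]%classic (measurable_itv _) (fun k b => (dk k b)%:E) _ _.
rewrite (_ : (\int[mu]_(b in _) limn_einf _)%E =
    (\int[mu]_(b in `[0%R, A]) (wt N (b + t) * pot N (V t b))%:E)%E); last first.
  apply: eq_integral => b; rewrite inE/= in_itv/= => /andP[b0 _].
  have cb : (dk k b)%:E @[k --> \oo] --> (wt N (b + t) * pot N (V t b))%:E.
    apply: cvg_EFin; first exact: nearW.
    apply: cvgM; first exact: wt_tau_cvg.
    by apply: potc_cvg => //; exact: cvg_evol (ltW t0) b0.
  rewrite is_cvg_limn_einfE; first exact: cvg_lim cb.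
  by apply/cvg_ex; eexists; exact: cb.
move=> H; apply: le_trans (H _ _) _.
- by move=> k; apply/measurable_EFinP; apply: measurable_funTS; exact: mdk.
- by move=> k b _; rewrite lee_fin.
have cE : (E + es_eps (phi k))%:E @[k --> \oo] --> E%:E.
  apply: cvg_EFin; first exact: nearW.
  by rewrite -[X in _ --> X]addr0; apply: cvgD => //; exact: cvg_cst.
rewrite -(cvg_lim _ cE)// limn_einf_lim; apply: lee_lim.
- exact: is_cvg_einfs.
- by apply/cvg_ex; eexists; exact: cE.
have [n1 H1] := nat_ge t; have [n2 H2] := nat_ge A.
exists (maxn n1 n2) => // k /=; rewrite geq_max => /andP[/H1 tk /H2 Ak].
have := @es_X_energy_le _ _ N0 _ mv0 v00 intE (phi k) A t.
rewrite ler0n Ak (ltW t0) tk => /(_ isT isT) HE.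
apply: (@le_trans _ _ (\int[mu]_(b in `[0%R, A]) (dk k b)%:E)%E).
  by apply: ereal_inf_lbound; exists k => /=.
rewrite -[leLHS]fineK ?lee_fin//.
exact: integrable_fin_num (idk k).
Qed.

End limit.

(** * Decay of the energy for N > 4 *)

Section decay.
Context {R : realType}.
Notation mu := (@lebesgue_measure R).
Variable N : R.
Hypothesis N1 : 1 < N.
Let N0 : 0 < N. Proof. by move: (N1); lra. Qed.

Lemma powRN_cvg0 (p : R) : 0 < p -> t `^ (- p) @[t --> +oo] --> (0 : R).
Proof.
move=> p0; apply/cvgrPdist_le => e e0.
near=> t; rewrite sub0r normrN ger0_norm ?powR_ge0// powRN.
have t0 : 0 < t by near: t; apply: nbhs_pinfty_gt; rewrite num_real.
have e0' : 0 < e^-1 by rewrite invr_gt0.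
rewrite -[leRHS]invrK lef_pV2 ?posrE ?powR_gt0//.
rewrite -[leLHS](@powRr1 _ e^-1) ?(ltW e0')// -(mulVf (lt0r_neq0 p0)) powRrM.
rewrite ge0_ler_powR ?nnegrE ?powR_ge0 ?(ltW p0) ?(ltW t0)//.
Unshelve. all: end_near. Qed.

Lemma itv0y_bigcup : `[(0 : R), +oo[%classic = \bigcup_n `[(0 : R), n%:R]%classic.
Proof.
apply/seteqP; split=> [x /=|x [n _] /=]; rewrite !in_itv/= ?andbT; last by case/andP.
move=> x0; exists (Num.truncn x).+1 => //=; rewrite in_itv/= x0/=.
by have /truncn_itv/andP[_ /ltW] := x0.
Qed.

Lemma integral_wt_le (t : R) : 0 < t ->
  (\int[mu]_(b in `[0%R, +oo[) (wt N (b + t))%:E <= (t `^ (1 - N) / (N - 1))%:E)%E.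
Proof.
move=> t0.
have N10 : 0 < N - 1 by rewrite subr_gt0.
pose F (b : R) := - (N - 1)^-1 * (b + t) `^ (1 - N).
have dF (b : R) : 0 <= b -> is_derive b (1 : R) F (wt N (b + t)).
  move=> b0; have bt0 : 0 < b + t by rewrite ltr_wpDl.
  have D1 : is_derive b (1 : R) (fun b : R => b + t) (1 + 0).
    exact: (is_deriveD (is_derive_id _ _) (is_derive_cst _ _ _)).
  have D2 := is_derive1_powR (1 - N) bt0.
  have D3 := @is_derive1_comp _ (@powR R ^~ (1 - N)) (fun b : R => b + t) b _ _ D2 D1.
  have D4 := is_deriveZ (- (N - 1)^-1) D3.
  apply: (is_derive_eq D4).
  rewrite /wt -powRN /GRing.scale/= addr0 mulr1 mulrA.
  have -> : - (N - 1)^-1 * (1 - N) = 1 by field; rewrite gt_eqF.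
  by rewrite mul1r; congr (_ `^ _); ring.
have cF (b : R) : 0 <= b -> {for b, continuous F}.
  move=> b0; apply/differentiable_continuous/derivable1_diffP.
  by have [] := dF _ b0.
rewrite itv0y_bigcup; apply: ge0_integral_bigcup_le => //.
- by move=> n m nm; apply: subset_itvl; rewrite bnd_simp ler_nat.
- move=> n; apply/measurable_EFinP; apply: measurable_funTS.
  by apply: (measurableT_comp (measurable_wt N)); exact: measurable_funD.
- by move=> b; rewrite lee_fin wt_ge0.
case=> [|n].
  by rewrite set_itv1 integral_set1 lee_fin divr_ge0 ?powR_ge0// ltW.
rewrite (@continuous_FTC2 _ _ F) ?ltr0n//.
- rewrite -EFinB lee_fin /F add0r !mulNr opprK addrC mulrC lerBlDr lerDl.
  by rewrite mulr_ge0 ?powR_ge0// invr_ge0 ltW.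
- apply: continuous_in_subspaceT => b; rewrite inE/= in_itv/= => /andP[b0 _].
  apply: (@continuous_comp _ _ _ (fun b : R => b + t) (wt N)).
    by apply: cvgD => //; exact: cvg_cst.
  by apply: wt_continuous_at; rewrite ltr_wpDl.
- split=> [s| |]; first rewrite in_itv/= => /andP[s0 _].
  + by have [] := dF s (ltW s0).
  + exact/cvg_at_right_filter/cF.
  + by apply/cvg_at_left_filter/cF.
- move=> s; rewrite in_itv/= => /andP[s0 _]; rewrite derive1E.
  by have [_ ->] := dF s (ltW s0).
Qed.

Variable v0 : R -> R.
Hypothesis mv0 : measurable_fun setT v0.
Hypothesis v00 : v0 0 = 0.
Hypothesis intE :
  mu.-integrable `[0, +oo[ (EFin \o (fun b => wt N b * pot N (v0 b))).

Let mpot : measurable_fun setT (pot N).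
Proof. by apply: continuous_measurable_fun; exact: pot_continuous. Qed.

Let linear_energy (t : R) := \int[mu]_(b in `[0, +oo[) (wt N (b + t) * pot N (v0 b)).

Let mdens t : measurable_fun setT (fun b : R => wt N (b + t) * pot N (v0 b)).
Proof.
apply: measurable_funM; last exact: measurableT_comp.
by apply: (measurableT_comp (measurable_wt N)); exact: measurable_funD.
Qed.

Let dens_le t b : 0 <= t -> 0 <= b ->
  `|wt N (b + t) * pot N (v0 b)| <= wt N b * pot N (v0 b).
Proof.
move=> t0 b0; rewrite ger0_norm; last by rewrite mulr_ge0 ?wt_ge0 ?pot_ge0.
have [->|bn0] := eqVneq b 0; first by rewrite v00 pot0// !mulr0.
rewrite ler_wpM2r ?pot_ge0// wt_le//; last by rewrite lerDl.
by rewrite lt_neqAle eq_sym bn0.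
Qed.

Let integrable_dens t : 0 <= t -> mu.-integrable `[0, +oo[
  (EFin \o (fun b : R => wt N (b + t) * pot N (v0 b))).
Proof.
move=> t0; apply: (@integrable_dominated _ _ _ mu _ _ (fun b => wt N b * pot N (v0 b))) => //.
  by apply: measurable_funTS; exact: mdens.
by move=> b /=; rewrite in_itv/= andbT; exact: dens_le.
Qed.

(** The weight tends to 0 at each b, and the density at time 0 dominates. *)
Let linear_energy_cvg0 : linear_energy t @[t --> +oo] --> (0 : R).
Proof.
apply/cvg_pinftyP => u uoo.
have [n0 _ Hn0] : \forall n \near \oo, 0 <= u n by exact: (cvgryPge _).1 uoo 0.
have [] := @Rintegral_dominated_cvg _ _ _ mu `[0, +oo[%classic
  (fun n b => wt N (b + u n) * pot N (v0 b)) (fun=> 0) (fun b => wt N b * pot N (v0 b)) n0.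
- by [].
- by move=> n; apply: measurable_funTS; exact: mdens.
- move=> b /=; rewrite in_itv/= andbT => b0.
  rewrite -[X in _ --> X](mul0r (pot N (v0 b))); apply: cvgMl.
  have H : b + u n @[n --> \oo] --> +oo.
    apply/cvgryPge => A; have /cvgryPge/(_ (A - b)) := uoo.
    by apply: filterS => n; rewrite lerBlDl.
  rewrite /wt; under eq_fun do rewrite -powRN.
  exact: (cvg_comp _ _ H (powRN_cvg0 N0)).
- exact: intE.
- by move=> n b n0n; rewrite /= in_itv/= andbT; apply: dens_le; exact: Hn0.
by move=> _; rewrite Rintegral_cst// mul0r.
Qed.

(** From |V|^(N+2) <= 2^(N+2) (|v0|^(N+2) + (tK)^((N+2)/2)), the first part has the weight of time t
    against fixed data, and the second is multiplied by the integral of the weight, at most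
    t^(1-N)/(N-1). The resulting exponent (N+2)/2 + 1 - N = 2 - N/2 is negative exactly for N >
    4. *)
Lemma energy_decay (V : R -> R -> R) (K : R) : 4 < N -> 0 <= K ->
  (forall t, measurable_fun setT (V t)) ->
  (forall t a, 0 <= t -> 0 <= a -> `|V t a - v0 a| <= Num.sqrt (t * K)) ->
  exists B : R -> R, B t @[t --> +oo] --> (0 : R) /\ forall t, 0 < t ->
    (\int[mu]_(b in `[0%R, +oo[) (wt N (b + t) * pot N (V t b))%:E <= (B t)%:E)%E.
Proof.
move=> N4 K0 mV VK.
have N20 : 0 < N + 2 by move: (N0); lra.
pose c := 2 `^ (N + 2) * (K `^ ((N + 2) / 2) / (N + 2) / (N - 1)).
exists (fun t => 2 `^ (N + 2) * linear_energy t + c * t `^ (- (N / 2 - 2))); split.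
  rewrite -[X in _ --> X](_ : 2 `^ (N + 2) * 0 + c * 0 = 0); last by rewrite !mulr0 addr0.
  apply: cvgD; apply: cvgM; [exact: cvg_cst|exact: linear_energy_cvg0|exact: cvg_cst|].
  by apply: powRN_cvg0; lra.
move=> t t0.
pose D := 2 `^ (N + 2) * (Num.sqrt (t * K) `^ (N + 2) / (N + 2)).
have D0 : 0 <= D by rewrite mulr_ge0 ?powR_ge0// divr_ge0 ?powR_ge0// ltW.
have mwt : measurable_fun setT (fun b : R => wt N (b + t)).
  by apply: (measurableT_comp (measurable_wt N)); exact: measurable_funD.
apply: (@le_trans _ _ (\int[mu]_(b in `[0%R, +oo[)
    ((2 `^ (N + 2))%:E * (wt N (b + t) * pot N (v0 b))%:E + D%:E * (wt N (b + t))%:E))%E).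
  apply: ge0_le_integral => //.
  - by move=> b _; rewrite lee_fin mulr_ge0 ?wt_ge0 ?pot_ge0.
  - apply/measurable_EFinP; apply: measurable_funTS; apply: measurable_funM => //.
    exact: (measurableT_comp mpot (mV t)).
  - apply: emeasurable_funD.
      apply: measurable_funeM; apply/measurable_EFinP; apply: measurable_funTS; exact: mdens.
    by apply: measurable_funeM; apply/measurable_EFinP; apply: measurable_funTS.
  move=> b; rewrite /= in_itv/= andbT => b0; rewrite -!EFinM -EFinD lee_fin.
  have -> : 2 `^ (N + 2) * (wt N (b + t) * pot N (v0 b)) + D * wt N (b + t) =
     wt N (b + t) * (2 `^ (N + 2) * (`|v0 b| `^ (N + 2) + Num.sqrt (t * K) `^ (N + 2)) / (N + 2)).
    by rewrite /D /pot; ring.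
  rewrite ler_wpM2l ?wt_ge0// /pot ler_wpM2r ?invr_ge0 ?(ltW N20)//.
  have -> : V t b = v0 b + (V t b - v0 b) by ring.
  apply: le_trans (powR_normD_le _ _ (ltW N20)) _.
  rewrite ler_wpM2l ?powR_ge0// lerD2l ge0_ler_powR ?nnegrE ?sqrtr_ge0 ?(ltW N20)//.
  exact: VK (ltW t0) b0.
rewrite ge0_integralD//; last 4 first.
- move=> b _; rewrite -EFinM lee_fin; apply: mulr_ge0; first exact: powR_ge0.
  by apply: mulr_ge0; [exact: wt_ge0|exact: pot_ge0].
- by apply: measurable_funeM; apply/measurable_EFinP; apply: measurable_funTS; exact: mdens.
- by move=> b _; rewrite -EFinM lee_fin; apply: mulr_ge0; [exact: D0|exact: wt_ge0].
- by apply: measurable_funeM; apply/measurable_EFinP; apply: measurable_funTS.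
rewrite EFinD; apply: leeD.
  rewrite ge0_integralZl//; last 2 first.
  - by apply/measurable_EFinP; apply: measurable_funTS; exact: mdens.
  - by move=> b _; rewrite lee_fin mulr_ge0 ?wt_ge0 ?pot_ge0.
  rewrite EFinM /linear_energy /Rintegral fineK//.
  exact: (integrable_fin_num _ (integrable_dens (ltW t0))).
rewrite ge0_integralZl//; last 2 first.
- by apply/measurable_EFinP; apply: measurable_funTS.
- by move=> b _; rewrite lee_fin wt_ge0.
apply: (@le_trans _ _ (D%:E * (t `^ (1 - N) / (N - 1))%:E)%E).
  by rewrite lee_wpmul2l// ?lee_fin// integral_wt_le.
rewrite -EFinM lee_fin le_eqVlt; apply/orP; left; apply/eqP.
rewrite /D /c; set a2 := 2 `^ _.
have -> : Num.sqrt (t * K) `^ (N + 2) = t `^ ((N + 2) / 2) * K `^ ((N + 2) / 2).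
  rewrite -powR12_sqrt ?mulr_ge0 ?(ltW t0)// -powRrM -powRM// ?(ltW t0)//.
  by congr (_ `^ _); field.
have -> : t `^ (- (N / 2 - 2)) = t `^ ((N + 2) / 2) * t `^ (1 - N).
  rewrite -powRD; first by congr (_ `^ _); field.
  by rewrite (gt_eqF t0) implybT.
by ring.
Qed.

(** The integral equation is obtained for every t >= 0 and a >= 0 rather than almost everywhere, so
    it can be evaluated at a = |x| - t for each x. *)
Theorem radial_evolution : exists V : R -> R -> R,
  [/\ measurable_fun setT
        (fun p : measurableTypeR R * measurableTypeR R => V p.1 p.2),
      forall s a, 0 < s ->
        mu.-integrable `[0, a] (EFin \o (fun b => wt N (b + s) * nl N (V s b))),
      forall t a, 0 <= t -> 0 <= a ->
        let G s := \int[mu]_(b in `[0, a]) (wt N (b + s) * nl N (V s b)) in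
        mu.-integrable `[0, t] (EFin \o G) /\
        V t a = v0 a - 1 / 2 * \int[mu]_(s in `[0, t]) G s,
      forall t, 0 <= t ->
        (\int[mu]_(b in `[0%R, +oo[) (wt N (b + t) * pot N (V t b))%:E <=
         \int[mu]_(b in `[0%R, +oo[) (wt N b * pot N (v0 b))%:E)%E &
      4 < N -> exists B : R -> R, B t @[t --> +oo] --> (0 : R) /\
        forall t, 0 < t ->
          (\int[mu]_(b in `[0%R, +oo[) (wt N (b + t) * pot N (V t b))%:E <=
           (B t)%:E)%E].
Proof.
have [phi [phik cphi]] := es_subsequence N0 mv0 v00 intE.
exists (evol N v0 phi).
have mV := measurable_evol N0 mv0 cphi.
split.
- exact: mV.
- by move=> s a s0; exact: (integrable_evol_g N0 mv0 v00 intE phik cphi).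
- by move=> t a t0 a0; exact: (evolE N0 mv0 v00 intE phik cphi t0 a0).
- move=> t t0; have := evol_energy_le N0 mv0 v00 intE phik cphi t0.
  by rewrite /pot_energy /Rintegral fineK//; exact: integrable_fin_num intE.
move=> N4; apply: (energy_decay N4 _ _ (evol_bound N0 mv0 v00 intE phik cphi)).
  by rewrite addr_ge0// pot_energy_ge0.
move=> t; exact: (measurableT_comp mV (@pair1_measurable _ _ (measurableTypeR R) (measurableTypeR R) t)).
Qed.

End decay.

(** * Polar coordinates *)

Section scaling.
Context {d : measure_display} {T : measurableType d} {R : realType}.
Implicit Types (m : {measure set T -> \bar R}) (f : T -> T) (k : R).

(** A change of variables with constant Jacobian k, stated on sets: m is k times its own
    push-forward by f. *)
Definition scales_by m f k : Prop :=
  measurable_fun setT f /\ forall A, measurable A -> m A = (k%:E * m (f @^-1` A))%E.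

Lemma scales_by_ge0_integral m f k (g : T -> \bar R) : 0 <= k -> scales_by m f k ->
  measurable_fun setT g -> (forall x, 0 <= g x)%E ->
  (\int[m]_x g x = k%:E * \int[m]_x g (f x))%E.
Proof.
move=> k0 [mf mE] mg g0.
have mE' A : measurable A -> A `<=` setT ->
    m A = mscale (NngNum k0) (pushforward m f) A.
  by move=> mA _; rewrite mE.
rewrite (eq_measure_integral (mscale (NngNum k0) (pushforward m f))).
  by rewrite ge0_integral_mscale//= ge0_integral_pushforward// preimage_setT.
exact: mE'.
Qed.

Lemma scales_by_Rintegral m f k (g : T -> R) : 0 <= k -> scales_by m f k ->
  measurable_fun setT g -> \int[m]_x g x = k * \int[m]_x g (f x).
Proof.
move=> k0 mfk mg; have [mf _] := mfk.
have mg' : measurable_fun setT (EFin \o g) by exact/measurable_EFinP.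
rewrite /Rintegral integralE.
rewrite (scales_by_ge0_integral k0 mfk (measurable_funepos mg'))//.
rewrite (scales_by_ge0_integral k0 mfk (measurable_funeneg mg'))//.
have fineM (x : \bar R) : fine (k%:E * x) = k * fine x.
  case: x => [r| |]//=; rewrite mulr0; move: k0; rewrite le_eqVlt => /predU1P[<-|k0].
  - by rewrite mul0e.
  - by rewrite gt0_muley ?lte_fin.
  - by rewrite mul0e.
  - by rewrite gt0_muleNy ?lte_fin.
have muleB (x y : \bar R) : (0 <= x)%E -> (0 <= y)%E ->
    (k%:E * x - k%:E * y = k%:E * (x - y))%E.
  case: x => [r| |]//; case: y => [s| |]// _ _.
  - exact: (congr1 EFin (esym (mulrBr k r s))).
  - move: k0; rewrite le_eqVlt => /predU1P[<-|k0]; first by rewrite !mul0e sube0.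
    by rewrite gt0_muley ?lte_fin// gt0_muleNy ?lte_fin.
  - move: k0; rewrite le_eqVlt => /predU1P[<-|k0]; first by rewrite !mul0e sube0.
    by rewrite gt0_muley ?lte_fin// -EFinM.
  - move: k0; rewrite le_eqVlt => /predU1P[<-|k0]; first by rewrite !mul0e sube0.
    by rewrite gt0_muley ?lte_fin// gt0_muleNy ?lte_fin.
rewrite muleB ?integral_ge0// fineM; congr (_ * fine _).
rewrite [RHS]integralE; congr (_ - _)%E.
  by apply: eq_integral => x _; rewrite /= !funeposE.
by apply: eq_integral => x _; rewrite /= !funenegE.
Qed.

End scaling.

(** Uniqueness of the product measure reduces the identity to rectangles, where the two Jacobians
    multiply. *)
Lemma scales_by_prod {d1 d2 : measure_display} {T1 : measurableType d1}
    {T2 : measurableType d2} {R : realType}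
    (m1 : {sigma_finite_measure set T1 -> \bar R})
    (m2 : {sigma_finite_measure set T2 -> \bar R}) f1 f2 (k1 k2 : R) :
  0 <= k1 -> 0 <= k2 -> scales_by m1 f1 k1 -> scales_by m2 f2 k2 ->
  scales_by (m1 \x m2)%E (fun p => (f1 p.1, f2 p.2)) (k1 * k2).
Proof.
move=> k10 k20 [mf1 E1] [mf2 E2].
have mf : measurable_fun setT (fun p : T1 * T2 => (f1 p.1, f2 p.2)).
  apply/measurable_fun_pairP; split.
    exact: (measurableT_comp mf1 measurable_fst).
  exact: (measurableT_comp mf2 measurable_snd).
split=> // A mA.
apply: (@product_measure_unique _ _ _ _ _ m1 m2
  (mscale (NngNum (mulr_ge0 k10 k20)) (pushforward (m1 \x m2)%E
   (fun p : T1 * T2 => (f1 p.1, f2 p.2))))) => //.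
move=> B C mB mC.
have mB' : measurable (f1 @^-1` B) by rewrite -[_ @^-1` _]setTI; exact: mf1.
have mC' : measurable (f2 @^-1` C) by rewrite -[_ @^-1` _]setTI; exact: mf2.
rewrite E1// E2// muleACA -EFinM -product_measure1E//.
Qed.

Section sigma_finite_product.
Context {d1 d2 : measure_display} {T1 : measurableType d1} {T2 : measurableType d2}
  {R : realType}.
Variables (m1 : {sigma_finite_measure set T1 -> \bar R})
  (m2 : {sigma_finite_measure set T2 -> \bar R}).

(** A copy of the product measure that carries a sigma-finite structure, so that it can enter a
    further product and Tonelli's theorem. By conversion [leb3s] is the measure [leb3]. *)
Definition sf_prod : set (T1 * T2) -> \bar R := (m1 \x m2)%E.
HB.instance Definition _ := Measure.on sf_prod.
Let sf_prod_sigma_finite : sigma_finite setT sf_prod.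
Proof.
have /sigma_finiteP[F [TF ndF Foo]] := sigma_finiteT m1.
have /sigma_finiteP[G [TG ndG Goo]] := sigma_finiteT m2.
exists (fun n => F n `*` G n).
  rewrite -setXTT TF TG predeqE => -[x y]; split.
    move=> [/= [n _ Fnx] [k _ Gky]]; exists (maxn n k) => //; split => /=.
    - by move: x Fnx; exact/subsetPset/ndF/leq_maxl.
    - by move: y Gky; exact/subsetPset/ndG/leq_maxr.
  by move=> [n _ []/= ? ?]; split; exists n.
move=> k; have [mF Fk] := Foo k; have [mG Gk] := Goo k.
split; first exact: measurableX.
rewrite /sf_prod product_measure1E// lte_mul_pinfty//.
by rewrite ge0_fin_numE.
Qed.
HB.instance Definition _ := @Measure_isSigmaFinite.Build _ _ _ sf_prod sf_prod_sigma_finite.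

End sigma_finite_product.

Definition leb2 {R : realType} : {sigma_finite_measure
    set (measurableTypeR R * measurableTypeR R)%type -> \bar R} :=
  sf_prod (@lebesgue_measure R) (@lebesgue_measure R).

Definition leb3s {R : realType} : {sigma_finite_measure
    set (measurableTypeR R * measurableTypeR R * measurableTypeR R)%type -> \bar R} :=
  sf_prod leb2 (@lebesgue_measure R).

Section lebesgue_scaling.
Context {R : realType}.
Notation mu := (@lebesgue_measure R).

Lemma scales_by_translation (c : R) :
  scales_by mu (fun x : measurableTypeR R => x + c) 1.
Proof.
pose f : measurableTypeR R -> measurableTypeR R := fun x => x + c.
have mf : measurable_fun setT f by apply: measurable_funD.
split=> // A mA; rewrite mul1e.
apply: (@lebesgue_measure_unique _ (pushforward mu f)) => //.
move=> _ [[a b] _ <-]; rewrite -[RHS]/(mu (f @^-1` _)) /=.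
rewrite (_ : f @^-1` _ = `]a - c, b - c]%classic).
  by rewrite !lebesgue_measure_itv/= !lte_fin ltrD2r -!EFinB; case: ifP => // _; congr (_ %:E); ring.
by apply/seteqP; split=> x /=; rewrite /f !in_itv/= ltrBlDr lerBrDr.
Qed.

Let scales_by_pos (k : R) : 0 < k -> scales_by mu (fun x : measurableTypeR R => k * x) k.
Proof.
move=> k0; pose f : measurableTypeR R -> measurableTypeR R := fun x => k * x.
have mf : measurable_fun setT f by apply: measurable_funM.
split=> // A mA.
apply: (@lebesgue_measure_unique _ (mscale (NngNum (ltW k0)) (pushforward mu f))) => //.
move=> _ [[a b] _ <-].
rewrite -[RHS]/(k%:E * mu (f @^-1` _))%E /=.
rewrite (_ : f @^-1` _ = `]a / k, b / k]%classic).
  rewrite !lebesgue_measure_itv/= !lte_fin ltr_pM2r ?invr_gt0//.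
  case: ifP => // _; last by rewrite mule0.
  by rewrite -!EFinB -EFinM; congr (_ %:E); field; rewrite gt_eqF.
by apply/seteqP; split=> x /=; rewrite /f !in_itv/= ltr_pdivrMr// ler_pdivlMr// !(mulrC x).
Qed.

Lemma scales_by_dilation (c : R) : c != 0 ->
  scales_by mu (fun x : measurableTypeR R => c * x) `|c|.
Proof.
move=> c0; have [cn|cp|ce] := ltgtP c 0; last by rewrite ce eqxx in c0.
  have nc0 : 0 < - c by rewrite oppr_gt0.
  have [mf E] := scales_by_pos nc0.
  pose f : measurableTypeR R -> measurableTypeR R := fun x => c * x.
  have mf' : measurable_fun setT f by apply: measurable_funM.
  split=> // A mA; rewrite ltr0_norm// E//.
  have mA' : measurable (f @^-1` A).
    by rewrite -[_ @^-1` _]setTI; exact: mf'.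
  rewrite -[X in _ = (_ * X)%E](lebesgue_measureN mA') /pushforward; congr (_ * mu _)%E.
  by apply/seteqP; split=> x /=; rewrite /f mulrN mulNr.
by rewrite gtr0_norm//; exact: scales_by_pos.
Qed.

Definition dil (c : R) (x : E3 R) : E3 R := (c * x.1.1, c * x.1.2, c * x.2).

Lemma scales_by_dil (c : R) : c != 0 -> scales_by (leb3 R) (dil c) (`|c| ^+ 3).
Proof.
move=> c0; have S := scales_by_dilation c0.
have S2 : scales_by leb2 _ _ := scales_by_prod (normr_ge0 c) (normr_ge0 c) S S.
have := scales_by_prod (m1 := leb2) (m2 := mu) (mulr_ge0 (normr_ge0 c) (normr_ge0 c))
  (normr_ge0 c) S2 S.
by rewrite (_ : `|c| * `|c| * `|c| = `|c| ^+ 3); last by ring.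
Qed.

End lebesgue_scaling.

Section weighted_measure.
Context {d : measure_display} {T : measurableType d} {R : realType}.
Variables (m : {measure set T -> \bar R}) (g : T -> \bar R).
Hypotheses (mg : measurable_fun setT g) (g0 : forall x, (0 <= g x)%E).

(** The proofs of measurability and positivity are arguments of the term, so that the measure
    structure can be attached to it. *)
Definition weighted of measurable_fun setT g & (forall x, (0 <= g x)%E) :=
  fun A : set T => (\int[m]_(x in A) g x)%E.

Local Notation nu := (weighted mg g0).

Let nu0 : nu set0 = 0%E. Proof. by rewrite /weighted integral_set0. Qed.

Let nu_ge0 A : (0 <= nu A)%E. Proof. exact: integral_ge0. Qed.

Let nu_sigma_additive : semi_sigma_additive nu.
Proof. exact: semi_sigma_additive_nng_induced. Qed.

HB.instance Definition _ := isMeasure.Build _ _ _ nu nu0 nu_ge0 nu_sigma_additive.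

End weighted_measure.

(** Tonelli on the region {0 <= s < f x}. It reduces integration in polar coordinates to the masses
    of sets of the form {s < f}. *)
Lemma layer_cake {d : measure_display} {T : measurableType d} {R : realType}
    (m : {sigma_finite_measure set T -> \bar R}) (f eta : T -> R) :
  measurable_fun setT f -> measurable_fun setT eta ->
  (forall x, 0 <= f x) -> (forall x, 0 <= eta x) ->
  (\int[m]_x (f x * eta x)%:E =
   \int[@lebesgue_measure R]_(s in `[0%R, +oo[)
     \int[m]_(x in [set x | (s < f x)%R]) (eta x)%:E)%E.
Proof.
move=> mf meta f0 eta0.
pose S := [set p : T * measurableTypeR R | (0 : R) <= p.2] `&` [set p | p.2 < f p.1].
have mS : measurable S.
  apply: measurableI.
    rewrite (_ : [set p | _] = setT `&` [set p : T * measurableTypeR R | cst (0 : R) p <= p.2]);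
      last by rewrite setTI.
    exact: measurable_fun_le.
  rewrite (_ : [set p | _] = ~` (setT `&` [set p : T * measurableTypeR R | (f \o fst) p <= snd p])).
    by apply/measurableC/measurable_fun_le => //; exact: measurableT_comp.
  by rewrite setTI; apply/seteqP; split=> p /=; rewrite ltNge => /negP.
pose h (p : T * measurableTypeR R) : \bar R := (eta p.1 * \1_S p)%:E.
have mh : measurable_fun setT h.
  apply/measurable_EFinP; apply: measurable_funM; last exact: measurable_indic.
  exact: measurableT_comp.
have h0 p : (0 <= h p)%E by rewrite lee_fin mulr_ge0.
have SE x s : ((x, s) \in S) = (0 <= s) && (s < f x).
  by apply/idP/idP; rewrite inE /S/= => /andP.
transitivity (\int[m]_x \int[@lebesgue_measure R]_s h (x, s))%E.
  apply: eq_integral => x _.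
  rewrite /h/=; under eq_integral do rewrite EFinM.
  rewrite ge0_integralZl_EFin//; last first.
    apply/measurable_EFinP.
    exact: (measurableT_comp (measurable_indic mS) (@pair1_measurable _ _ _ _ x)).
  rewrite mulrC EFinM; congr (_ * _)%E.
  rewrite (_ : (fun s => _) = (fun s => (\1_(`[0, f x[%classic : set R) s)%:E)).
    rewrite integral_indic// setIT.
    have -> : (f x)%:E = (if 0 < f x then f x - 0 else 0)%:E.
      have := f0 x; rewrite le_eqVlt => /predU1P[<-|->]; first by rewrite ltxx.
      by rewrite subr0.
    symmetry; transitivity (@lebesgue_measure R ([set` `[0, f x[] : set R)) => //.
    by rewrite lebesgue_measure_itv/= lte_fin; case: ifP => //; rewrite EFinB.
  by apply/funext => s; rewrite !indicE SE mem_setE in_itv.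
rewrite -fubini_tonelli1// fubini_tonelli2//.
rewrite [RHS]integral_mkcond; apply: eq_integral => s _.
rewrite /fubini_G /patch mem_setE in_itv/= andbT.
rewrite /h/=; case: ifPn => s0.
  rewrite [RHS]integral_mkcond; apply: eq_integral => x _.
  rewrite indicE SE s0/= /patch.
  have -> : (x \in [set x | s < f x]) = (s < f x) by apply/idP/idP; rewrite inE.
  by case: ifP; rewrite ?mulr1 ?mulr0.
by apply: integral0_eq => x _; rewrite indicE SE (negbTE s0) mulr0.
Qed.

Section polar.
Context {R : realType}.
Notation mu := (@lebesgue_measure R).

Lemma measurable_enorm : measurable_fun setT (@enorm R).
Proof.
rewrite (_ : @enorm R = fun x => (dot3 x x) `^ (2^-1)); last first.
  apply/funext => x; rewrite powR12_sqrt// /dot3.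
  by rewrite !addr_ge0// -expr2 sqr_ge0.
apply: (measurableT_comp (measurable_powR _)).
by apply: measurable_funD; [apply: measurable_funD|];
  apply: measurable_funM; do ?[exact: measurableT_comp].
Qed.

Lemma enorm_ge0 (x : E3 R) : 0 <= enorm x. Proof. exact: sqrtr_ge0. Qed.

Lemma measurable_eball (r : R) : measurable [set x : E3 R | enorm x <= r].
Proof.
rewrite (_ : [set x | _] = setT `&` (@enorm R) @^-1` `]-oo, r]%classic).
  by apply: measurable_enorm => //; exact: measurable_itv.
by rewrite setTI; apply/seteqP; split=> x /=; rewrite in_itv.
Qed.

Variables (eta : E3 R -> R) (q : R -> R).
Hypotheses (meta : measurable_fun setT eta) (mq : measurable_fun setT q).
Hypotheses (eta0 : forall x, 0 <= eta x) (q0 : forall r, 0 <= r -> 0 <= q r).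
Hypothesis cdf : forall r, 0 <= r ->
  (\int[leb3 R]_(x in [set x | (enorm x <= r)%R]) (eta x)%:E =
   \int[mu]_(s in `[0%R, r]) (q s)%:E)%E.
Hypothesis cdf_fin : forall r, 0 <= r -> (\int[mu]_(s in `[0%R, r]) (q s)%:E < +oo)%E.

Let q' := q \_ `[0, +oo[.

Let q'0 s : 0 <= q' s.
Proof.
by rewrite /q' /patch mem_setE in_itv/= andbT; case: ifP => // /q0.
Qed.

Let mq' : measurable_fun setT q'.
Proof.
by apply/(measurable_restrictT _ _).1 => //; exact: measurable_funTS.
Qed.

(** Both sides are measures in A. They agree and are finite on the rays ]-oo, r] by the hypothesis
    on balls, hence on half-open intervals by subtraction, and these are stable under intersection
    and generate the Borel sets. *)
Lemma polar_set (A : set (measurableTypeR R)) : measurable A ->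
  (\int[leb3 R]_(x in (@enorm R) @^-1` A) (eta x)%:E = \int[mu]_(s in A) (q' s)%:E)%E.
Proof.
move=> mA.
have mE1 : measurable_fun setT (EFin \o eta) by exact/measurable_EFinP.
have mE2 : measurable_fun setT (EFin \o q') by exact/measurable_EFinP.
have p1 x : (0 <= (EFin \o eta) x)%E by rewrite lee_fin.
have p2 x : (0 <= (EFin \o q') x)%E by rewrite lee_fin.
pose p : E3 R -> measurableTypeR R := @enorm R.
have mp : measurable_fun setT p by exact: measurable_enorm.
pose nu1 := pushforward (weighted (leb3 R) mE1 p1) p.
pose nu2 := weighted mu mE2 p2.
have ray r : nu1 `]-oo, r]%classic = nu2 `]-oo, r]%classic /\ (nu2 `]-oo, r]%classic < +oo)%E.
  have [r0|r0] := leP 0 r.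
    have E1 : nu1 `]-oo, r]%classic = (\int[leb3 R]_(x in [set x | (enorm x <= r)%R]) (eta x)%:E)%E.
      by rewrite /nu1 /pushforward /weighted; congr integral;
        apply/seteqP; split=> x /=; rewrite in_itv.
    have E2 : nu2 `]-oo, r]%classic = (\int[mu]_(s in `[0%R, r]) (q s)%:E)%E.
      rewrite /nu2 /weighted [LHS]integral_mkcond [RHS]integral_mkcond.
      apply: eq_integral => s _; rewrite /patch !mem_setE !in_itv/= /q' /patch mem_setE in_itv/= andbT.
      by case: (leP 0 s) => //=; case: ifP.
    by rewrite E1 E2 cdf//; split=> //; exact: cdf_fin.
  have -> : nu1 `]-oo, r]%classic = 0%E.
    rewrite /nu1 /pushforward /weighted (_ : _ @^-1` _ = set0) ?integral_set0//.
    apply/seteqP; split=> x //=; rewrite in_itv/= leNgt => /negP; apply.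
    exact: lt_le_trans (enorm_ge0 _).
  have -> : nu2 `]-oo, r]%classic = 0%E.
    apply: integral0_eq => s; rewrite /= in_itv/= => sr.
    by rewrite /q' /patch mem_setE in_itv/= andbT leNgt (le_lt_trans sr).
  by rewrite ltry.
pose n1f := (nu1 : {measure set (measurableTypeR R) -> \bar R}).
pose n1 := n1f mp.
pose n2 : {measure set (measurableTypeR R) -> \bar R} := nu2.
have z1 : nu1 set0 = 0%E by exact: (measure0 n1).
have z2 : nu2 set0 = 0%E by exact: (measure0 n2).
have oc a b : nu1 `]a, b]%classic = nu2 `]a, b]%classic /\ (nu1 `]a, b]%classic < +oo)%E.
  have [ab|ba] := ltP a b; last first.
    by rewrite set_itv_ge ?bnd_simp -?leNgt// z1 z2.
  have dec : `]-oo, b]%classic = `]-oo, a]%classic `|` `]a, b]%classic.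
    by rewrite -itv_bndbnd_setU// bnd_simp ltW.
  have dis : `]-oo, a]%classic `&` `]a, b]%classic = set0 :> set R.
    apply/seteqP; split=> x //= []; rewrite !in_itv/= => xa /andP[ax _].
    by move: (lt_le_trans ax xa); rewrite ltxx.
  have [Eb fb] := ray b; have [Ea fa] := ray a.
  have U1 : nu1 `]-oo, b]%classic = (nu1 `]-oo, a]%classic + nu1 `]a, b]%classic)%E.
    by rewrite dec; apply: (measureU n1) => //; exact: measurable_itv.
  have U2 : nu2 `]-oo, b]%classic = (nu2 `]-oo, a]%classic + nu2 `]a, b]%classic)%E.
    by rewrite dec; apply: (measureU n2) => //; exact: measurable_itv.
  have fa' : nu2 `]-oo, a]%classic \is a fin_num by rewrite ge0_fin_numE.
  split.
    have -> : nu1 `]a, b]%classic = (nu1 `]-oo, b]%classic - nu2 `]-oo, a]%classic)%E.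
      by rewrite U1 Ea [X in (X - _)%E]addeC addeK.
    by rewrite Eb U2 [X in (X - _)%E]addeC addeK.
  apply: le_lt_trans fb; rewrite -Eb; apply: (le_measure n1); rewrite ?inE; try exact: measurable_itv.
  by apply: subset_itvr; rewrite bnd_simp.
suff: n1 A = n2 A by [].
have GE : (measurable : set (set (measurableTypeR R))) = <<s @ocitv R >> by [].
apply: (@measure_unique _ R (measurableTypeR R) (@ocitv R) (fun n : nat => `](- n%:R), n%:R]%classic) GE _ _ _ n1 n2 _ _ A mA).
- exact: ocitvI.
- by move=> i; exists (- i%:R, i%:R).
- exact: bigcup_itvT.
- by move=> _ [[a b] _ <-]; have [] := oc a b.
- by move=> n; have [] := oc (- n%:R) n%:R.
Qed.

(** The layer-cake formula on both sides, compared level by level through [polar_set]. *)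
Lemma polar_ge0 (f : R -> R) : measurable_fun setT f -> (forall r, 0 <= f r) ->
  (\int[leb3 R]_x (f (enorm x) * eta x)%:E = \int[mu]_(r in `[0%R, +oo[) (f r * q r)%:E)%E.
Proof.
move=> mf f0.
have mfe : measurable_fun setT (f \o @enorm R).
  exact: (measurableT_comp mf measurable_enorm).
have L1 := @layer_cake _ _ R leb3s (f \o @enorm R) eta mfe meta (fun x => f0 _) eta0.
have L2 := @layer_cake _ _ R mu f q' mf mq' f0 q'0.
transitivity (\int[mu]_x (f x * q' x)%:E)%E; last first.
  rewrite [RHS]integral_mkcond; apply: eq_integral => r _.
  by rewrite /q' /patch mem_setE in_itv/= andbT; case: ifP; rewrite ?mulr0.
rewrite L2; apply: eq_trans L1 _; apply: eq_integral => s _.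
apply: (polar_set (A := [set x | s < f x])).
rewrite (_ : [set x | _] = setT `&` f @^-1` `]s, +oo[%classic).
  by apply: mf => //; exact: measurable_itv.
by rewrite setTI; apply/seteqP; split=> x /=; rewrite in_itv/= andbT.
Qed.

End polar.

(** Replacing y by the left end of its cell of length 1/(n+1) makes the function measurable on each
    of countably many slabs; continuity in y gives the limit. *)
Lemma measurable_caratheodory {d : measure_display} {X : measurableType d} {R : realType}
    (f : X -> R -> R) : (forall y, measurable_fun setT (f^~ y)) ->
  (forall x, continuous (f x)) ->
  measurable_fun setT (fun p : X * measurableTypeR R => f p.1 p.2).
Proof.
move=> mf cf.
pose a n (y : R) : R := (Num.floor (y * n.+1%:R))%:~R / n.+1%:R.
apply: (@measurable_fun_cvg _ _ R setT (fun n (p : X * measurableTypeR R) => f p.1 (a n p.2))).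
  move=> n _ B mB; rewrite setTI.
  pose F (k : int) : set (X * measurableTypeR R) :=
    (f^~ (k%:~R / n.+1%:R)) @^-1` B `*`
    `[k%:~R / n.+1%:R, (k + 1)%:~R / n.+1%:R[%classic.
  have n0 : (0 : R) < n.+1%:R by [].
  rewrite (_ : _ @^-1` B = \bigcup_k F k); last first.
    apply/seteqP; split=> [[x y] /= Bxy|[x y] [k _] [/= Bk]].
      exists (Num.floor (y * n.+1%:R)) => //; split=> //=.
      by rewrite in_itv/= ler_pdivrMr// ltr_pdivlMr// floor_itv.
    rewrite in_itv/= ler_pdivrMr// ltr_pdivlMr// => yk.
    by rewrite /a (floor_def yk).
  apply: countable_bigcupT_measurable => [|k]; [exact: countableP|apply: measurableX; last exact: measurable_itv].
  by rewrite -[_ @^-1` _]setTI; exact: mf.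
move=> [x y] _ /=; suff ay : a n y @[n --> \oo] --> y by exact: (cvg_comp _ _ ay (cf x y)).
apply/cvgrPdist_le => e e0; near=> n.
have n0 : (0 : R) < n.+1%:R by [].
have /andP[f1 f2] := floor_itv (y * n.+1%:R).
have ay : a n y <= y by rewrite ler_pdivrMr.
rewrite ger0_norm ?subr_ge0// lerBlDr.
have : y < a n y + n.+1%:R^-1.
  by rewrite -[X in _ + X]mul1r -mulrDl ltr_pdivlMr// -[1]/(1%:~R) -intrD.
move=> /ltW/le_trans; apply; rewrite addrC lerD2r.
apply: ltW; near: n; exact: (near_infty_natSinv_lt (PosNum e0)).
Unshelve. all: by end_near. Qed.

(** Measurability for the product sigma-algebra, gained one coordinate at a time from continuity in
    the last one. *)
Lemma continuous_measurable_E3 {R : realType} (f : E3 R -> R) :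
  continuous f -> measurable_fun setT f.
Proof.
move=> cf.
have -> : f = fun p => f (p.1, p.2) by apply/funext => -[].
have c3 (x : R * R) : continuous (fun z : R => f (x, z)).
  move=> y; suff p : (x, z) @[z --> y] --> (x, y) by exact: (cvg_comp _ _ p (cf _)).
  exact: (cvg_pair (cvg_cst x) cvg_id).
have c2 (x z : R) : continuous (fun y : R => f (x, y, z)).
  move=> y; suff p : (x, y, z) @[y --> y] --> (x, y, z) by exact: (cvg_comp _ _ p (cf _)).
  exact: (cvg_pair (cvg_pair (cvg_cst x) cvg_id) (cvg_cst z)).
have c1 (y z : R) : continuous (fun x : R => f (x, y, z)).
  move=> x; suff p : (x, y, z) @[x --> x] --> (x, y, z) by exact: (cvg_comp _ _ p (cf _)).
  exact: (cvg_pair (cvg_pair cvg_id (cvg_cst y)) (cvg_cst z)).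
apply: (@measurable_caratheodory _ _ R (fun x y => f (x, y))) => [y|x y]; last exact: c3.
rewrite [X in measurable_fun _ X](_ : _ = fun p : R * R => f (p.1, p.2, y)); last first.
  by apply/funext => -[].
apply: (@measurable_caratheodory _ _ R (fun x z => f (x, z, y))) => [z|x z]; last exact: c2.
by apply: continuous_measurable_fun => x; exact: c1.
Qed.

Lemma is_derive_under_integral {d : measure_display} {Y : measurableType d} {R : realType}
    (m : {measure set Y -> \bar R}) (B : set Y) (f df : R -> Y -> R) (G : Y -> R) (a : R) :
  measurable B -> m.-integrable B (EFin \o G) -> (forall y, 0 <= G y) ->
  (forall x, `|x - a| < 1 -> m.-integrable B (EFin \o f x)) ->
  (forall x y, `|x - a| < 1 -> B y -> is_derive x 1 (f^~ y) (df x y)) ->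
  (forall x y, `|x - a| < 1 -> B y -> `|df x y| <= G y) ->
  is_derive a 1 (fun x => \int[m]_(y in B) f x y) (\int[m]_(y in B) df a y).
Proof.
move=> mB iG G0 intf dfE dfG.
have I x : `]a - 1, a + 1[%classic x -> `|x - a| < 1.
  by rewrite /= in_itv/= ltr_distl.
have Ia : `]a - 1, a + 1[%classic a by rewrite /= in_itv/= ltrDl gtrDl oppr_lt0 ltr01.
have d1 x y : `|x - a| < 1 -> B y -> (partial1of2 f) x y = df x y.
  by move=> xa By; rewrite partial1of2E; have [_ ->] := dfE _ _ xa By.
have dd x y : `]a - 1, a + 1[%classic x -> B y -> derivable (f^~ y) x 1.
  by move=> /I xa By; have [] := dfE _ _ xa By.
have c := @cvg_differentiation_under_integral R _ Y m f B mB a (a - 1) (a + 1) Ia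
  (fun x xI => intf x (I x xI))
  dd G G0 iG.
have /c {}c : forall x y, `]a - 1, a + 1[%classic x -> B y -> `|(partial1of2 f) x y| <= G y.
  by move=> x y /I xa By; rewrite d1//; exact: dfG.
have E : \int[m]_(y in B) (partial1of2 f) a y = \int[m]_(y in B) df a y.
  by apply: eq_Rintegral => y; rewrite inE => By; rewrite d1// subrr normr0.
rewrite -E; apply: DeriveDef.
  apply/cvg_ex; exists (\int[m]_(y in B) (partial1of2 f) a y).
  by under eq_fun do rewrite scaler1.
rewrite /derive; apply/cvg_lim => //; under eq_fun do rewrite scaler1; exact: c.
Qed.

(** * Test functions *)

Section directional.
Context {R : realType} {V : normedModType R}.
Implicit Types (f : V -> R) (x u v : V).

Lemma is_derive_line f x v d (s : R) : is_derive (x + s *: v) v f d ->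
  is_derive s (1 : R) (fun s : R => f (x + s *: v)) d.
Proof.
move=> [df dE].
have E : (fun h : R => h^-1 *: (((fun s : R => f (x + s *: v)) \o shift s) (h *: (1 : R)) - f (x + s *: v)))
   = (fun h : R => h^-1 *: ((f \o shift (x + s *: v)) (h *: v) - f (x + s *: v))).
  apply/funext => h /=; congr (_ *: (f _ - _)).
  by rewrite (_ : h%:A = h) ?scalerDl 1?addrCA//; exact: mulr1.
apply: DeriveDef; first by rewrite /derivable E.
by rewrite /derive E.
Qed.

Lemma derive_line f x v : (forall x, derivable f x v) -> forall s : R,
  is_derive s (1 : R) (fun s : R => f (x + s *: v)) ('D_v f (x + s *: v)).
Proof. by move=> df s; apply: is_derive_line; exact: derivableP. Qed.

Lemma is_derive_lineV f x v d : is_derive (0 : R) (1 : R) (fun s : R => f (x + s *: v)) d ->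
  is_derive x v f d.
Proof.
move=> [df dE].
have E : (fun h : R => h^-1 *: (((fun s : R => f (x + s *: v)) \o shift (0 : R)) (h *: (1 : R)) - f (x + 0 *: v)))
   = (fun h : R => h^-1 *: ((f \o shift x) (h *: v) - f x)).
  apply/funext => h /=; rewrite scale0r (addr0 x); congr (_ *: (f _ - _)).
  by rewrite (_ : h%:A = h) ?addr0 1?[x + _]addrC//; exact: mulr1.
apply: DeriveDef; first by move: df; rewrite /derivable E.
by rewrite -dE /derive E.
Qed.

Lemma is_derive_dirZ f x v (a : R) : derivable f x v ->
  is_derive x (a *: v) f (a * 'D_v f x).
Proof.
move=> df; apply: is_derive_lineV.
have d0 : is_derive (a * 0) (1 : R) (fun s : R => f (x + s *: v)) ('D_v f x).
  by apply: is_derive_line; rewrite mulr0 scale0r addr0; exact: derivableP.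
have da : is_derive (0 : R) (1 : R) (fun s : R => a * s) a.
  by have := is_deriveZ a (is_derive_id (0 : R) (1 : R)); rewrite /GRing.scale/= mulr1.
have := @is_derive1_comp R (fun s : R => f (x + s *: v)) (fun s : R => a * s) 0 _ _ d0 da.
rewrite mulrC; congr is_derive.
by apply/funext => s /=; rewrite scalerA mulrC.
Qed.

Lemma MVT_line f x v : (forall x, derivable f x v) ->
  exists2 c : R, 0 <= c <= 1 & f (x + v) - f x = 'D_v f (x + c *: v).
Proof.
move=> df.
have dg (s : R) := derive_line x df s.
have cg : {within `[0, 1], continuous (fun s : R => f (x + s *: v))}.
  apply: derivable_within_continuous => s _; by have [] := dg s.
have [c] := @MVT R (fun s : R => f (x + s *: v)) (fun s => 'D_v f (x + s *: v)) 0 1 ltr01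
  (fun s _ => dg s) cg.
rewrite in_itv/= => /andP[c0 c1]; rewrite scale1r scale0r addr0 subr0 mulr1 => ->.
by exists c => //; rewrite !ltW.
Qed.

(** Only directional derivatives are at hand. The increment along v is taken from the moving base
    point h u + x, where the mean value theorem expresses it by the derivative along v at a point
    close to x; continuity of that derivative at x concludes. *)
Lemma is_derive_dirD f x u v : derivable f x u -> (forall x, derivable f x v) ->
  {for x, continuous ('D_v f)} -> is_derive x (u + v) f ('D_u f x + 'D_v f x).
Proof.
move=> du dv cv.
suff L : (fun h : R => h^-1 *: ((f \o shift x) (h *: (u + v)) - f x)) @ 0^' -->
    'D_u f x + 'D_v f x.
  by apply: DeriveDef; [apply/cvg_ex; eexists; exact: L|exact/cvg_lim].
have -> : (fun h : R => h^-1 *: ((f \o shift x) (h *: (u + v)) - f x)) =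
    (fun h : R => h^-1 *: ((f \o shift x) (h *: u) - f x) +
      h^-1 *: (f (h *: u + x + h *: v) - f (h *: u + x))).
  apply/funext => h /=; rewrite -scalerDr; congr (_ *: _).
  have -> : h *: (u + v) + x = h *: u + x + h *: v by rewrite scalerDr addrAC.
  by ring.
apply: cvgD; first exact: du.
apply/cvgrPdist_le => e e0.
have /cvgrPdist_le/(_ _ e0) := cv.
move=> /nbhs_ballP[del /= del0 H].
pose M : R := `|u| + `|v| + 1.
have M0 : 0 < M by rewrite ltr_wpDl// addr_ge0.
near=> h.
have h0 : h != 0 by near: h; exact: nbhs_dnbhs_neq.
have hd : `|h| * M < del.
  rewrite -ltr_pdivlMr//; near: h; apply: dnbhs0_lt.
  by rewrite divr_gt0.
have dhv y : derivable f y (h *: v) by have [] := is_derive_dirZ h (dv y).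
have [c /andP[c0 c1] ->] := MVT_line (h *: u + x) dhv.
have [_ ->] := is_derive_dirZ h (dv (h *: u + x + c *: (h *: v))).
rewrite (mulKf h0 _ : h^-1 *: (h * 'D_v f _) = _); apply: H => /=.
have E : x - (h *: u + x + c *: (h *: v)) = - (h *: u + c *: (h *: v)).
  by rewrite -addrA addrCA opprD addrA subrr add0r.
rewrite -ball_normE/= E normrN; apply: le_lt_trans hd.
apply: le_trans (ler_normD _ _) _; rewrite !normrZ /M mulrDr mulrDr.
rewrite -[leLHS]addr0; apply: lerD; last by rewrite mulr1.
by rewrite lerD2l ler_piMl// ?ger0_norm// mulr_ge0.
Unshelve. all: by end_near. Qed.

End directional.

Section test_functions.
Context {R : realType}.
Implicit Types (f phi : E3 R -> R) (x y v : E3 R).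

Definition e1 : E3 R := (1, 0, 0).
Definition e2 : E3 R := (0, 1, 0).
Definition e3 : E3 R := (0, 0, 1).

Lemma basis_decomp y : y = y.1.1 *: e1 + y.1.2 *: e2 + y.2 *: e3.
Proof.
case: y => -[a b] c /=; rewrite /e1 /e2 /e3.
congr (_, _, _); rewrite /= /GRing.scale/= ?mulr1 ?mulr0 ?addr0 ?add0r//.
Qed.

Lemma continuous_coord1 : continuous (fun x : E3 R => x.1.1).
Proof. by move=> x; apply: (cvg_comp _ _ (@cvg_fst _ _ _ _ _) (@cvg_fst _ _ _ _ _)). Qed.
Lemma continuous_coord2 : continuous (fun x : E3 R => x.1.2).
Proof. by move=> x; apply: (cvg_comp _ _ (@cvg_fst _ _ _ _ _) (@cvg_snd _ _ _ _ _)). Qed.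
Lemma continuous_coord3 : continuous (fun x : E3 R => x.2).
Proof. by move=> x; apply: cvg_snd. Qed.

Lemma continuous_dot : continuous (fun x : E3 R => dot3 x x).
Proof.
move=> x; rewrite /dot3.
apply: cvgD; [apply: cvgD|]; apply: cvgM;
  by [exact: continuous_coord1|exact: continuous_coord2|exact: continuous_coord3].
Qed.

Lemma continuous_enorm : continuous (@enorm R).
Proof.
move=> x; apply: (@continuous_comp _ _ _ (fun x : E3 R => dot3 x x) Num.sqrt).
  exact: continuous_dot.
exact: sqrt_continuous.
Qed.

Lemma smooth_D v f : smooth f -> smooth ('D_v f).
Proof.
move=> sf vs; have E : iter_deriv vs ('D_v f) = iter_deriv (rcons vs v) f.
  by elim: vs => //= w vs ->.
by rewrite E; exact: sf.
Qed.

Lemma iter_derivD vs f g : smooth f -> smooth g ->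
  iter_deriv vs (f \+ g) = iter_deriv vs f \+ iter_deriv vs g.
Proof.
move=> sf sg; elim: vs => //= v vs ->; apply/funext => x.
by rewrite deriveD//; [exact: (sf vs).2|exact: (sg vs).2].
Qed.

Lemma smoothD f g : smooth f -> smooth g -> smooth (f \+ g).
Proof.
move=> sf sg vs; rewrite iter_derivD//; split=> [x|x v].
  by apply: cvgD; [exact: (sf vs).1|exact: (sg vs).1].
by apply: derivableD; [exact: (sf vs).2|exact: (sg vs).2].
Qed.

Lemma laplacianE f x :
  laplacian f x = 'D_e1 ('D_e1 f) x + 'D_e2 ('D_e2 f) x + 'D_e3 ('D_e3 f) x.
Proof.
by rewrite /laplacian unlock /= -[RHS]addrA; congr (_ + (_ + _)); apply: addr0.
Qed.

Lemma test_function_D v phi : test_function phi -> test_function ('D_v phi).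
Proof.
move=> [sp [r pr]]; split; first exact: smooth_D.
exists r => x rx.
have /(@near_eq_derive _ _ _ phi (cst 0) x v) -> : \forall y \near x, phi y = cst 0 y.
  have H : \forall y \near x, r < enorm y by exact: (cvgr_gt _ (@continuous_enorm x) _ rx).
  by near do apply: pr.
exact: derive_cst.
Unshelve. all: by end_near. Qed.

Lemma test_functionD f g : test_function f -> test_function g -> test_function (f \+ g).
Proof.
move=> [sf [r fr]] [sg [s gs]]; split; first exact: smoothD.
by exists (Num.max r s) => x; rewrite gt_max => /andP[rx sx]; rewrite /= fr// gs// addr0.
Qed.

Lemma test_function_laplacian phi : test_function phi -> test_function (laplacian phi).
Proof.
move=> tp; have t e := test_function_D e (test_function_D e tp).
have -> : laplacian phi = 'D_e1 ('D_e1 phi) \+ 'D_e2 ('D_e2 phi) \+ 'D_e3 ('D_e3 phi).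
  by apply/funext => x; rewrite laplacianE.
exact (test_functionD (test_functionD (t e1) (t e2)) (t e3)).
Qed.

Lemma test_function_continuous phi : test_function phi -> continuous phi.
Proof. by move=> [sp _]; exact: (sp [::]).1. Qed.

Lemma test_function_derivable phi x v : test_function phi -> derivable phi x v.
Proof. by move=> [sp _]; exact: (sp [::]).2. Qed.

Lemma is_derive_coord phi x y : test_function phi ->
  is_derive x y phi (y.1.1 * 'D_e1 phi x + y.1.2 * 'D_e2 phi x + y.2 * 'D_e3 phi x).
Proof.
move=> tp; have d z v : derivable phi z v by exact: test_function_derivable.
have c v : continuous ('D_v phi).
  exact: test_function_continuous (test_function_D v tp).
have Z a v z : is_derive z (a *: v) phi (a * 'D_v phi z) by exact: is_derive_dirZ.
have dZ a v z : derivable phi z (a *: v) by have [] := Z a v z.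
have eZ a v z : 'D_(a *: v) phi z = a * 'D_v phi z by have [] := Z a v z.
have cZ a v : continuous ('D_(a *: v) phi).
  rewrite (_ : 'D_(a *: v) phi = fun z => a * 'D_v phi z); last by apply/funext => z.
  by move=> z; apply: cvgM; [exact: cvg_cst|exact: c].
have [d12 E12] := is_derive_dirD (dZ y.1.1 e1 x) (dZ y.1.2 e2) (cZ _ _ x).
have := is_derive_dirD d12 (dZ y.2 e3) (cZ _ _ x).
by rewrite E12 !eZ -basis_decomp.
Qed.

Lemma coord_le_enorm x : [/\ `|x.1.1| <= enorm x, `|x.1.2| <= enorm x & `|x.2| <= enorm x].
Proof.
by split; rewrite -sqrtr_sqr /enorm ler_sqrt ?addr_ge0 -?expr2 ?sqr_ge0// /dot3 -!expr2
  ?lerDr ?addr_ge0 ?sqr_ge0// addrAC ?lerDr ?addr_ge0 ?sqr_ge0// -addrA ?lerDl ?addr_ge0 ?sqr_ge0.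
Qed.

Definition box (r : R) : set (E3 R) := (`[- r, r] `*` `[- r, r]) `*` `[- r, r].

Lemma boxE r x : box r x <-> [/\ `|x.1.1| <= r, `|x.1.2| <= r & `|x.2| <= r].
Proof.
rewrite /box/= !in_itv/= -!ler_norml; split=> [[[-> ->] ->]//|[-> -> ->]//].
Qed.

Lemma measurable_box r :
  measurable (box r : set (measurableTypeR R * measurableTypeR R * measurableTypeR R)).
Proof.
have mI : measurable (`[- r, r]%classic : set (measurableTypeR R)) by exact: measurable_itv.
by apply: measurableX => //; exact: measurableX.
Qed.

Lemma finite_box r : (leb3 R (box r) < +oo)%E.
Proof.
have mI : measurable (`[- r, r]%classic : set (measurableTypeR R)) by exact: measurable_itv.
rewrite -[X in (X < _)%E]/((leb2 \x @lebesgue_measure R)%E _).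
rewrite product_measure1E//; last exact: measurableX.
have f1 : (@lebesgue_measure R `[(- r)%R, r]%classic < +oo)%E by exact: bounded_itv.
rewrite lte_mul_pinfty// ?ge0_fin_numE//.
  rewrite -[X in (X < _)%E]/((@lebesgue_measure R \x @lebesgue_measure R)%E _).
  by rewrite product_measure1E// lte_mul_pinfty// ge0_fin_numE.
Qed.

Lemma continuous_bounded_box f (r : R) : continuous f ->
  exists2 K, 0 <= K & forall x, box r x -> `|f x| <= K.
Proof.
move=> cf.
have cB : compact (box r) by do ?[apply: compact_setX]; exact: segment_compact.
have : compact (f @` box r).
  by apply: continuous_compact => //; exact: continuous_subspaceT.
move=> /compact_bounded[M [_ HM]].
exists (`|M| + 1) => [|x bx]; first by rewrite addr_ge0.
by apply: (HM (`|M| + 1)); [rewrite (le_lt_trans (ler_norm _))// ltrDl|exists x].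
Qed.

Lemma test_function_bounded phi : test_function phi ->
  exists2 K, 0 <= K & forall x, `|phi x| <= K.
Proof.
move=> tp; have [_ [r pr]] := tp.
have [K K0 pK] := continuous_bounded_box r (test_function_continuous tp).
exists K => // x; have [/pr ->|xr] := ltP r (enorm x); first by rewrite normr0.
apply: pK; apply/boxE; have [x1 x2 x3] := coord_le_enorm x.
by split; apply: le_trans xr.
Qed.

Lemma enormZ (a : R) x : enorm (a *: x) = `|a| * enorm x.
Proof.
rewrite /enorm (_ : dot3 (a *: x) (a *: x) = a ^+ 2 * dot3 x x).
  by rewrite sqrtrM ?sqr_ge0// sqrtr_sqr.
by case: x => -[b c] d; rewrite /dot3/= /GRing.scale/=; ring.
Qed.

Lemma dilE (a : R) x : dil a x = a *: x.
Proof. by []. Qed.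


Lemma finite_eball (r : R) : (leb3 R [set x | (enorm x <= r)%R] < +oo)%E.
Proof.
apply: le_lt_trans (finite_box r); apply: le_measure; rewrite ?inE.
- exact: measurable_eball.
- exact: measurable_box.
- move=> x /= xr; have [x1 x2 x3] := coord_le_enorm x; apply/boxE.
  by split; apply: le_trans xr.
Qed.

End test_functions.

(** * Signed densities *)

Lemma is_derive_continuous {R : realType} (Q : R -> R) (x d : R) :
  is_derive x (1 : R) Q d -> {for x, continuous Q}.
Proof.
move=> [dQ _]; apply: differentiable_continuous; exact/derivable1_diffP.
Qed.

Lemma integral_derive {R : realType} (Q q : R -> R) (a b : R) :
  (forall s, is_derive s (1 : R) Q (q s)) -> continuous q -> a <= b ->
  (\int[@lebesgue_measure R]_(s in `[a, b]) (q s)%:E = (Q b - Q a)%:E)%E.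
Proof.
move=> dQ cq; rewrite le_eqVlt => /predU1P[<-|ab].
  by rewrite set_itv1 integral_set1 subrr.
have cQ s : {for s, continuous Q} by exact: is_derive_continuous (dQ s).
rewrite (@continuous_FTC2 R q Q a b)//.
- exact: continuous_subspaceT.
- split.
  + by move=> x _; have [] := dQ x.
  + by apply: cvg_at_right_filter; exact: cQ.
  + by apply: cvg_at_left_filter; exact: cQ.
- by move=> x _; rewrite derive1E; have [_ ->] := dQ x.
Qed.

Lemma nondecreasing_derive_ge0 {R : realType} (H : R -> R) (r d : R) :
  is_derive r (1 : R) H d -> (forall h, 0 < h -> H r <= H (r + h)) -> 0 <= d.
Proof.
move=> [dH <-] Hr; rewrite /derive.
have L : h^-1 *: ((H \o shift r) (h *: (1 : R)) - H r) @[h --> 0^'+] --> 'D_1 H r.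
  by apply: cvg_dnbhs_at_right; exact: dH.
rewrite -/(derive H r 1) -(cvg_lim (@Rhausdorff R) L)//; apply: limr_ge; first by apply/cvg_ex; exists ('D_1 H r).
near=> h.
have h0 : 0 < h by near: h; exact: nbhs_right_gt.
rewrite (_ : h%:A = h); last exact: mulr1.
by apply: mulr_ge0; rewrite ?invr_ge0 ?(ltW h0)//= subr_ge0 addrC Hr.
Unshelve. all: by end_near. Qed.

Section ball.
Context {R : realType}.
Notation mu := (@lebesgue_measure R).
Definition eball (r : R) := [set x : E3 R | enorm x <= r].
Definition ball_vol : R := fine (leb3 R (eball 1)).

Lemma ball_vol_ge0 : 0 <= ball_vol. Proof. exact: fine_ge0. Qed.

(** Dilation reduces the ball to the unit ball. For r = 0 the dilation by 2 fixes the ball, so its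
    finite measure equals 8 times itself. *)
Lemma leb3_eball r : 0 <= r -> leb3 R (eball r) = (ball_vol * r ^+ 3)%:E.
Proof.
have fb s : leb3 R (eball s) \is a fin_num by rewrite ge0_fin_numE// finite_eball.
rewrite le_eqVlt => /predU1P[<-|r0]; last first.
  have [mf ->] := scales_by_dil (lt0r_neq0 r0); last exact: measurable_eball.
  rewrite gtr0_norm// (_ : dil r @^-1` eball r = eball 1).
    by rewrite -(fineK (fb 1)) -EFinM mulrC.
  apply/seteqP; split=> x /=; rewrite /eball/= dilE enormZ gtr0_norm//;
    by rewrite -{2}[r]mulr1 ler_pM2l.
rewrite expr0n mulr0.
have n20 : (2 : R) != 0 by [].
have [mf E] := scales_by_dil n20.
have := E (eball 0) (measurable_eball 0).
rewrite (_ : dil 2 @^-1` eball 0 = eball 0); last first.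
  by apply/seteqP; split=> x /=; rewrite /eball/= dilE enormZ pmulr_rle0// normr_gt0.
rewrite -(fineK (fb 0)) -EFinM => /(congr1 fine)/= E0; congr EFin.
by move: E0; rewrite ger0_norm//; lra.
Qed.

Lemma polar_cst_cdf (K r : R) : 0 <= r ->
  (\int[leb3 R]_(x in [set x | (enorm x <= r)%R]) K%:E =
   \int[mu]_(s in `[0%R, r]) (3 * ball_vol * K * s ^+ 2)%:E)%E.
Proof.
move=> r0; rewrite integral_cst; last exact: measurable_eball.
rewrite -[X in (_ * X)%E]/(leb3 R (eball r)) leb3_eball// -EFinM.
have dQ (s : R) : is_derive s (1 : R) (fun s => ball_vol * K * s ^+ 3) (3 * ball_vol * K * s ^+ 2).
  have D := is_deriveZ (ball_vol * K) (is_deriveX 3 (is_derive_id s (1 : R))).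
  by apply: (is_derive_eq D); rewrite /GRing.scale/=; ring.
have cq : continuous (fun s : R => 3 * ball_vol * K * s ^+ 2).
  by move=> s; apply: cvgM; [exact: cvg_cst|exact: exprn_continuous].
by rewrite (integral_derive dQ cq)//; congr EFin; ring.
Qed.

(** The image of Lebesgue measure under |x| has a density on the line, hence gives no mass to a
    single radius. *)
Lemma leb3_sphere r : 0 <= r -> leb3 R [set x | enorm x = r] = 0%E.
Proof.
move=> r0.
have m1 : measurable_fun setT (fun _ : E3 R => 1 : R) by exact: measurable_cst.
have mq : measurable_fun setT (fun s : R => 3 * ball_vol * 1 * s ^+ 2).
  by apply: measurable_funM => //; exact: exprn_measurable.
have q0 s : 0 <= s -> 0 <= 3 * ball_vol * 1 * s ^+ 2.
  by move=> _; rewrite mulr_ge0 ?sqr_ge0// mulr1 mulr_ge0// ball_vol_ge0.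
have fin s : 0 <= s -> (\int[mu]_(r in `[0%R, s]) (3 * ball_vol * 1 * r ^+ 2)%:E < +oo)%E.
  move=> s0; rewrite -polar_cst_cdf// integral_cst; last exact: measurable_eball.
  by rewrite mul1e finite_eball.
have := @polar_set R (fun=> 1) _ m1 mq (fun=> ler01) q0 (@polar_cst_cdf 1) fin [set r] (measurable_set1 _).
rewrite integral_set1 integral_cst ?mul1e; last first.
  by rewrite -[_ @^-1` _]setTI; exact: measurable_enorm.
by [].
Qed.

Lemma polar_ge0_Rintegral (eta : E3 R -> R) (q f : R -> R) :
  measurable_fun setT eta -> measurable_fun setT q ->
  (forall x, 0 <= eta x) -> (forall r, 0 <= r -> 0 <= q r) ->
  (forall r, 0 <= r -> (\int[leb3 R]_(x in [set x | (enorm x <= r)%R]) (eta x)%:E =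
   \int[mu]_(s in `[0%R, r]) (q s)%:E)%E) ->
  (forall r, 0 <= r -> (\int[mu]_(s in `[0%R, r]) (q s)%:E < +oo)%E) ->
  measurable_fun setT f -> mu.-integrable `[0, +oo[ (EFin \o (fun r => f r * q r)) ->
  (leb3 R).-integrable setT (EFin \o (fun x => f (enorm x) * eta x)) /\
  \int[leb3 R]_x (f (enorm x) * eta x) = \int[mu]_(r in `[0, +oo[) (f r * q r).
Proof.
move=> meta mq eta0 q0 cdf fin mf intf.
have mfe : measurable_fun setT (fun x : E3 R => f (enorm x) * eta x).
  by apply: measurable_funM => //; exact: (measurableT_comp mf measurable_enorm).
have P (g : R -> R) : measurable_fun setT g -> (forall r, 0 <= g r) ->
  (\int[leb3 R]_x (g (enorm x) * eta x)%:E = \int[mu]_(r in `[0%R, +oo[) (g r * q r)%:E)%E.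
  by move=> mg g0; exact: polar_ge0.
split.
  apply/integrableP; split; first exact/measurable_EFinP.
  have := P (fun r => `|f r|) (measurableT_comp (@normr_measurable _ setT) mf) (fun=> normr_ge0 _).
  under eq_integral do rewrite -[X in _ * X]ger0_norm// -normrM.
  move=> ->; have /integrableP[_] := intf; congr (_ < _)%E.
  apply: eq_integral => r; rewrite inE/= in_itv/= andbT => r0.
  by rewrite normrM [X in _ * X]ger0_norm// q0.
rewrite /Rintegral [in LHS]integralE [in RHS]integralE; congr fine; congr (_ - _)%E.
  transitivity (\int[leb3 R]_x ((fun r => Num.max (f r) 0) (enorm x) * eta x)%:E)%E.
    apply: eq_integral => x _; rewrite funeposE -EFin_max; congr EFin.
    by rewrite maxr_pMl// mul0r.
  rewrite (P (fun r => Num.max (f r) 0)) => [||r]; last by rewrite le_max lexx orbT.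
    apply: eq_integral => r; rewrite inE/= in_itv/= andbT => r0.
    by rewrite funeposE -EFin_max; congr EFin; rewrite maxr_pMl ?mul0r ?q0.
  exact: measurable_maxr.
transitivity (\int[leb3 R]_x ((fun r => Num.max (- f r) 0) (enorm x) * eta x)%:E)%E.
  apply: eq_integral => x _; rewrite funenegE -EFinN -EFin_max; congr EFin.
  by rewrite maxr_pMl// mul0r mulNr.
rewrite (P (fun r => Num.max (- f r) 0)) => [||r]; last by rewrite le_max lexx orbT.
  apply: eq_integral => r; rewrite inE/= in_itv/= andbT => r0.
  by rewrite funenegE -EFinN -EFin_max; congr EFin; rewrite maxr_pMl ?mul0r ?mulNr ?q0.
by apply: measurable_maxr => //; exact: measurableT_comp.
Qed.

End ball.

Section signed_polar.
Context {R : realType}.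
Notation mu := (@lebesgue_measure R).
Variables (eta : E3 R -> R) (Q q : R -> R) (K : R).
Hypotheses (meta : measurable_fun setT eta) (K0 : 0 <= K) (etaK : forall x, `|eta x| <= K).
Hypotheses (dQ : forall r, is_derive r (1 : R) Q (q r)) (cq : continuous q) (Q0 : Q 0 = 0).
Hypothesis cdf : forall r, 0 <= r -> \int[leb3 R]_(x in eball r) eta x = Q r.

Lemma integrable_eball (g : E3 R -> R) (M r : R) : measurable_fun setT g ->
  (forall x, `|g x| <= M) -> (leb3 R).-integrable (eball r) (EFin \o g).
Proof.
move=> mg gM; apply: (@integrable_bounded _ _ _ (leb3 R) _ _ M) => //.
- exact: measurable_eball.
- exact: finite_eball.
- exact: measurable_funTS.
Qed.

Let H (r : R) := Q r + ball_vol * K * r ^+ 3.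

Let HE r : 0 <= r -> H r = \int[leb3 R]_(x in eball r) (eta x + K).
Proof.
move=> r0; rewrite RintegralD//; last 3 first.
- exact: measurable_eball.
- exact: (@integrable_eball _ K).
- exact: (@integrable_eball _ `|K|).
rewrite cdf// Rintegral_cst; last exact: measurable_eball.
by rewrite -[X in K * fine X]/(leb3 R (eball r)) leb3_eball//= /H; congr (_ + _); ring.
Qed.

Let dH r : is_derive r (1 : R) H (q r + 3 * ball_vol * K * r ^+ 2).
Proof.
have D := is_deriveD (dQ r) (is_deriveZ (ball_vol * K) (is_deriveX 3 (is_derive_id r (1 : R)))).
by apply: (is_derive_eq D); rewrite /GRing.scale/=; ring.
Qed.

Let finE s : (\int[leb3 R]_(x in eball s) (eta x + K)%:E)%E \is a fin_num.
Proof.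
have mE : measurable_fun setT (fun x => eta x + K) by exact: measurable_funD.
have EK x : `|eta x + K| <= K + K by rewrite (le_trans (ler_normD _ _))// lerD// ger0_norm.
have I := integrable_eball s mE EK.
by move: (integrable_fin_num (mu := leb3 R) (measurable_eball s) I).
Qed.

(** The left-out positivity needed for polar coordinates: this is the derivative of the integral of
    eta + K over the ball of radius r, which is nondecreasing in r. *)
Lemma density_lower_bound r : 0 <= r -> 0 <= q r + 3 * ball_vol * K * r ^+ 2.
Proof.
move=> r0; apply: (nondecreasing_derive_ge0 (dH r)) => h h0.
rewrite !HE ?addr_ge0 ?(ltW h0)//.
have E0 x : (0 <= (eta x + K)%:E)%E.
  by rewrite lee_fin; have := etaK x; rewrite ler_norml; lra.
have mE : measurable_fun setT (fun x => eta x + K) by exact: measurable_funD.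
apply: fine_le.
- exact: finE.
- exact: finE.
- apply: ge0_subset_integral => //.
  + exact: measurable_eball.
  + exact: measurable_eball.
  + by apply/measurable_EFinP; exact: measurable_funTS.
  + by move=> x /= /le_trans; apply; rewrite lerDl ltW.
Qed.

(* [eta + K] and [K] are nonnegative, with densities [q + 3 c K r^2] and [3 c K r^2]. *)
Lemma polar_signed_shift (f : R -> R) : measurable_fun setT f ->
  mu.-integrable `[0, +oo[ (EFin \o (fun r => f r * r ^+ 2)) ->
  mu.-integrable `[0, +oo[ (EFin \o (fun r => f r * q r)) ->
  (leb3 R).-integrable setT (EFin \o (fun x => f (enorm x) * eta x)) /\
  \int[leb3 R]_x (f (enorm x) * eta x) = \int[mu]_(r in `[0, +oo[) (f r * q r).
Proof.
move=> mf i2 iq.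
pose qK := 3 * ball_vol * K.
have iK : mu.-integrable `[0, +oo[ (EFin \o (fun r => f r * (qK * r ^+ 2))).
  have := integrable_itvZ qK i2; congr (_.-integrable _ (EFin \o _)).
  by apply/funext => r /=; ring.
have mqK : measurable_fun setT (fun r : R => qK * r ^+ 2).
  by apply: measurable_funM => //; exact: exprn_measurable.
have qK0 : 0 <= qK by rewrite /qK; apply: mulr_ge0 => //; apply: mulr_ge0 => //; exact: ball_vol_ge0.
have qK20 (r : R) : 0 <= r -> 0 <= qK * r ^+ 2.
  by move=> _; apply: mulr_ge0 => //; exact: sqr_ge0.
have mq : measurable_fun setT q by exact: continuous_measurable_fun.
have finK r : 0 <= r -> (\int[mu]_(s in `[0%R, r]) (qK * s ^+ 2)%:E < +oo)%E.
  move=> r0; rewrite -polar_cst_cdf// integral_cst; last exact: measurable_eball.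
  by rewrite lte_mul_pinfty ?lee_fin// finite_eball.
have [I1 E1] := @polar_ge0_Rintegral R (fun=> K) _ f (measurable_cst _) mqK (fun=> K0)
  qK20 (@polar_cst_cdf R K) finK mf iK.
have dH' r := dH r; have cdq : continuous (fun r => q r + qK * r ^+ 2).
  by move=> r; apply: cvgD; [exact: cq|apply: cvgM; [exact: cvg_cst|exact: exprn_continuous]].
have ball_int r : 0 <= r -> (\int[leb3 R]_(x in eball r) (eta x + K)%:E =
    \int[mu]_(s in `[0%R, r]) (q s + qK * s ^+ 2)%:E)%E.
  move=> r0; rewrite (integral_derive dH' cdq r0).
  rewrite {2}/H expr0n/= mulr0 Q0 addr0 subr0 HE// fineK//; exact: finE.
have finH r : 0 <= r -> (\int[mu]_(s in `[0%R, r]) (q s + qK * s ^+ 2)%:E < +oo)%E.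
  by move=> r0; rewrite (integral_derive dH' cdq r0) ltry.
have iD : mu.-integrable `[0, +oo[ (EFin \o (fun r => f r * (q r + qK * r ^+ 2))).
  have := integrable_itvD iq iK; congr (_.-integrable _ (EFin \o _)).
  by apply/funext => r /=; ring.
have etaK0 x : 0 <= eta x + K.
  by have := etaK x; rewrite ler_norml; lra.
have [I2 E2] := @polar_ge0_Rintegral R (fun x => eta x + K) _ f
  (measurable_funD meta (measurable_cst _)) (measurable_funD mq mqK) etaK0
  density_lower_bound ball_int finH mf iD.
have fE : (fun x : E3 R => f (enorm x) * eta x) =
    (fun x => f (enorm x) * (eta x + K) - f (enorm x) * K).
  by apply/funext => x; ring.
have qE : (fun r : R => f r * q r) = (fun r => f r * (q r + qK * r ^+ 2) - f r * (qK * r ^+ 2)).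
  by apply/funext => r; ring.
rewrite fE qE; split; first exact: (integrable_subr measurableT I2 I1).
by rewrite RintegralB// E1 E2 RintegralB.
Qed.

End signed_polar.

(** * Spherical means *)

Section divergence.
Context {R : realType}.
Notation mu := (@lebesgue_measure R).
Implicit Types (F G : E3 R -> R) (x y v : E3 R).

Lemma eball_box r : @eball R r `<=` box r.
Proof.
move=> x xr; have [x1 x2 x3] := coord_le_enorm x; apply/boxE.
by split; apply: le_trans xr.
Qed.

Lemma box_shift (M r : R) (y v : E3 R) : (forall i, i \in [:: v.1.1; v.1.2; v.2] -> `|i| <= M) ->
  box r (y + v) -> box (r + M) y.
Proof.
move=> vM /boxE[y1 y2 y3]; apply/boxE.
have T (a b : R) : `|a + b| <= r -> `|b| <= M -> `|a| <= r + M.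
  by move=> h1 h2; have := lerB_normD a b; lra.
by split; [apply: T y1 _|apply: T y2 _|apply: T y3 _]; apply: vM; rewrite !inE eqxx ?orbT.
Qed.

Lemma scales_by_translation3 v : scales_by (leb3 R) (fun x : E3 R => x + v) 1.
Proof.
have S c := @scales_by_translation R c.
have S2 := scales_by_prod ler01 ler01 (S v.1.1) (S v.1.2).
have S2' : scales_by leb2 _ _ := S2.
have := scales_by_prod (m1 := leb2) (m2 := mu) (mulr_ge0 ler01 ler01) ler01 S2' (S v.2).
by rewrite !mulr1; congr scales_by.
Qed.

Lemma integrable_boxed G (M r : R) : measurable_fun setT G ->
  (forall x, `|G x| <= M) -> (forall x, ~ box r x -> G x = 0) ->
  (leb3 R).-integrable setT (EFin \o G).
Proof.
move=> mG GM G0.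
have : (leb3 R).-integrable (box r) (EFin \o G).
  apply: (@integrable_bounded _ _ _ (leb3 R) _ _ M) => //.
  - exact: measurable_box.
  - exact: finite_box.
  - exact: measurable_funTS.
move=> I; have {I} := (integrable_mkcond (mu := leb3 R) _ (measurable_box r)).1 I; congr (_.-integrable _ _).
apply/funext => x; rewrite /patch; case: ifPn => // /negP.
by rewrite inE => /G0/= ->.
Qed.

Lemma Rintegral_translate_sub G (M r : R) v : measurable_fun setT G ->
  (forall x, `|G x| <= M) -> (forall x, ~ box r x -> G x = 0) ->
  \int[leb3 R]_x (G (x + v) - G x) = 0.
Proof.
move=> mG GM G0; have S := scales_by_translation3 v.
pose L := `|v.1.1| + `|v.1.2| + `|v.2|.
rewrite RintegralB//; last 2 first.
- have mS : measurable_fun setT (fun x => G (x + v)).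
    by have [mS _] := S; exact: (measurableT_comp mG mS).
  apply: (@integrable_boxed (fun x => G (x + v)) M (r + L)) => // x nb.
  apply: G0 => /box_shift h; apply: nb; apply: h => i.
  have [h1 h2 h3] : [/\ 0 <= `|v.1.1|, 0 <= `|v.1.2| & 0 <= `|v.2|] by [].
  by rewrite !inE => /or3P[] /eqP->; rewrite /L; lra.
- exact: (integrable_boxed mG GM G0).
by have := scales_by_Rintegral ler01 S mG; rewrite mul1r => <-; rewrite subrr.
Qed.

(* Minus a potential of the field [y]: it vanishes on the unit sphere. *)
Definition wball y : R := (1 - dot3 y y) / 2.

Lemma enorm_dot y : enorm y ^+ 2 = dot3 y y.
Proof. by rewrite sqr_sqrtr// /dot3 !addr_ge0// -expr2 sqr_ge0. Qed.

Lemma wball_gt0 y : (0 < wball y) = (enorm y < 1).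
Proof.
rewrite /wball -enorm_dot pmulr_lgt0// subr_gt0.
by rewrite -[X in _ < X](expr1n R 2) ltr_pXn2r ?nnegrE ?enorm_ge0.
Qed.

Lemma wball_shift y v (h : R) :
  wball (y + h *: v) = wball y - h * dot3 y v - h ^+ 2 * dot3 v v / 2.
Proof. by rewrite /wball /dot3/= /GRing.scale/=; field. Qed.

Lemma is_derive_wball y v : is_derive y v wball (- dot3 y v).
Proof.
apply: is_derive_lineV.
rewrite (_ : (fun s : R => _) = fun s : R => wball y + (- dot3 y v) * s + (- (dot3 v v / 2)) * s ^+ 2).
  have D := is_deriveD (is_deriveD (is_derive_cst (wball y) (0 : R) (1 : R))
    (is_deriveZ (- dot3 y v) (is_derive_id (0 : R) (1 : R))))
    (is_deriveZ (- (dot3 v v / 2)) (is_deriveX 2 (is_derive_id (0 : R) (1 : R)))).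
  by apply: (is_derive_eq D); rewrite /GRing.scale/=; ring.
by apply/funext => s; rewrite wball_shift; field.
Qed.

Lemma continuous_wball : continuous wball.
Proof.
move=> y; apply: cvgM; last exact: cvg_cst.
by apply: cvgB; [exact: cvg_cst|exact: continuous_dot].
Qed.

End divergence.

Section ball_divergence.
Context {R : realType}.
Implicit Types (F G : E3 R -> R) (x y v : E3 R).

Lemma maxr0_dist (a b : R) : `|Num.max a 0 - Num.max b 0| <= `|a - b|.
Proof.
have [a0|a0] := leP a 0; have [b0|b0] := leP b 0.
- by rewrite subrr normr0.
- by rewrite sub0r normrN gtr0_norm// -(opprB b a) normrN ger0_norm; lra.
- by rewrite subr0 gtr0_norm// ger0_norm; lra.
- by [].
Qed.

Lemma continuous_integrable_eball F r : continuous F ->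
  (leb3 R).-integrable (eball r) (EFin \o F).
Proof.
move=> cF; have [K K0 FK] := continuous_bounded_box r cF.
apply: (@integrable_bounded _ _ _ (leb3 R) _ _ K) => //.
- exact: measurable_eball.
- exact: finite_eball.
- by apply: measurable_funTS; exact: continuous_measurable_E3.
- by move=> x /eball_box; exact: FK.
Qed.

Variables (F : E3 R -> R) (v : E3 R).
Hypotheses (cF : continuous F) (dF : forall x, derivable F x v) (cDF : continuous ('D_v F)).

Let G y := Num.max (wball y) 0 * F y.
Let g y := if 0 < wball y then wball y * 'D_v F y - dot3 y v * F y else 0.
Let L := `|v.1.1| + `|v.1.2| + `|v.2|.

Let L0 : 0 <= L. Proof. by rewrite /L !addr_ge0. Qed.

Let vL i : i \in [:: v.1.1; v.1.2; v.2] -> `|i| <= L.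
Proof.
have [h1 h2 h3] : [/\ 0 <= `|v.1.1|, 0 <= `|v.1.2| & 0 <= `|v.2|] by [].
by rewrite !inE => /or3P[] /eqP->; rewrite /L; lra.
Qed.

Let G0 y : ~ box 1 y -> G y = 0.
Proof.
move=> nb; rewrite /G; have [w0|w0] := leP (wball y) 0; first by rewrite mul0r.
by case: nb; apply: eball_box; move: w0; rewrite wball_gt0 => /ltW.
Qed.

Let cG : continuous G.
Proof.
move=> y; apply: cvgM; last exact: cF.
have := @continuous_wball R y => cw.
apply: (@continuous_comp _ _ _ (@wball R) (fun t => Num.max t 0)) => //.
by apply: (@continuous_max _ _ id (cst 0)); [exact: cvg_id|exact: cvg_cst].
Qed.

Let G_bounded : exists2 M, 0 <= M & forall x, `|G x| <= M.
Proof.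
have [M M0 GM] := continuous_bounded_box 1 cG.
exists M => // x; have [/GM//|nb] := pselect (box 1 x).
by rewrite G0// normr0.
Qed.

Let dG y : enorm y != 1 -> is_derive y v G (g y).
Proof.
move=> y1; rewrite /g; have [w0|w0] := ltP 0 (wball y).
  have H : \forall z \near y, wball z * F z = G z.
    have : \forall z \near y, 0 < wball z by exact: (cvgr_gt _ (@continuous_wball R y) _ w0).
    by apply: filterS => z wz; rewrite /G max_l// ltW.
  apply: (near_eq_is_derive H).
  have Fd : is_derive y v F ('D_v F y) by exact: derivableP.
  apply: (is_derive_eq (is_deriveM (is_derive_wball y v) Fd)).
  by rewrite /GRing.scale/=; ring.
have w1 : wball y < 0.
  rewrite lt_neqAle w0 andbT; apply: contra y1 => /eqP wy.
  have : enorm y ^+ 2 = 1 by rewrite enorm_dot; move: wy; rewrite /wball; lra.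
  by move=> /eqP; rewrite sqrf_eq1 => /orP[//|/eqP e]; have := enorm_ge0 y; rewrite e; lra.
have H : \forall z \near y, cst 0 z = G z.
  have : \forall z \near y, wball z < 0 by exact: (cvgr_lt _ (@continuous_wball R y) _ w1).
  by apply: filterS => z wz; rewrite /G max_r ?mul0r// ltW.
by apply: (near_eq_is_derive H); exact: is_derive_cst.
Qed.

Lemma quotient_cvg (f : E3 R -> R) y d : is_derive y v f d ->
  n.+1%:R * (f (y + n.+1%:R^-1 *: v) - f y) @[n --> \oo] --> d.
Proof.
move=> [df <-].
have /cvgr_dnbhsP L1 : (fun h : R => h^-1 *: ((f \o shift y) (h *: v) - f y)) @ 0^' --> 'D_v f y by exact: df.
have := L1 (fun n => n.+1%:R^-1) (conj (fun n => _) (@cvg_harmonic R)).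
rewrite (_ : (fun n : nat => _) = (fun n => n.+1%:R * (f (y + n.+1%:R^-1 *: v) - f y))).
  by apply=> n; rewrite invr_eq0.
by apply/funext => n /=; rewrite invrK [_ *: v + y]addrC.
Qed.

Let shift_bound n i : i \in [:: (n.+1%:R^-1 *: v).1.1; (n.+1%:R^-1 *: v).1.2; (n.+1%:R^-1 *: v).2] -> `|i| <= L.
Proof.
have n1 : `|n.+1%:R^-1 : R| <= 1 by rewrite ger0_norm// invf_le1// ler1n.
have H j : j \in [:: v.1.1; v.1.2; v.2] -> `|n.+1%:R^-1 * j| <= L.
  by move=> /vL; apply: le_trans; rewrite normrM ler_piMl.
by rewrite !inE => /or3P[] /eqP->; apply: H; rewrite !inE eqxx ?orbT.
Qed.

Let dot_bound y : box (1 + L) y -> `|dot3 y v| <= (1 + L) * L.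
Proof.
move=> /boxE[y1 y2 y3]; rewrite /dot3 /L !mulrDr.
apply: le_trans (ler_normD _ _) _; apply: lerD; last by rewrite normrM ler_wpM2r.
by apply: le_trans (ler_normD _ _) _; apply: lerD; rewrite normrM ler_wpM2r.
Qed.

(** The majorant for dominated convergence. Inside a box, F has a bounded derivative along v and the
    cut-off max(wball, 0) is Lipschitz; outside the box of half-side 1 + L both values of G
    vanish. *)
Let quotient_bound : exists2 C, 0 <= C & forall n y,
  `|n.+1%:R * (G (y + n.+1%:R^-1 *: v) - G y)| <= C.
Proof.
have [KF KF0 FK] := continuous_bounded_box (1 + L) cF.
have [KD KD0 DK] := continuous_bounded_box (1 + L + L) cDF.
have V0 : 0 <= dot3 v v by rewrite -enorm_dot sqr_ge0.
have LL : 0 <= (1 + L) * L by rewrite mulr_ge0// addr_ge0.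
pose KV := (1 + L) * L + dot3 v v.
have KV0 : 0 <= KV by rewrite addr_ge0.
exists (KD + KV * KF) => [|n y]; first by rewrite addr_ge0// mulr_ge0.
set h : R := n.+1%:R^-1; have h0 : 0 < h by rewrite invr_gt0.
have h1 : h <= 1 by rewrite invf_le1// ler1n.
have [by_|nb] := pselect (box (1 + L) y); last first.
  rewrite !G0 ?subrr ?mulr0 ?normr0 ?addr_ge0//; first exact: mulr_ge0.
    move=> b1; apply: nb; apply/boxE; move/boxE: b1 => [b1 b2 b3].
    by split; [apply: le_trans b1 _|apply: le_trans b2 _|apply: le_trans b3 _]; rewrite lerDl.
  by move=> /(box_shift (@shift_bound n)).
have nh : n.+1%:R = h^-1 by rewrite invrK.
rewrite normrM nh ger0_norm ?invr_ge0 ?(ltW h0)// ler_pdivrMl//.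
have -> : G (y + h *: v) - G y =
    Num.max (wball (y + h *: v)) 0 * (F (y + h *: v) - F y) +
    (Num.max (wball (y + h *: v)) 0 - Num.max (wball y) 0) * F y by rewrite /G; ring.
apply: le_trans (ler_normD _ _) _; rewrite !normrM mulrDr; apply: lerD.
  have W1 (z : E3 R) : `|Num.max (wball z) 0| <= 1.
    have d0 : 0 <= dot3 z z by rewrite -enorm_dot sqr_ge0.
    have le1 : wball z <= 1 by rewrite /wball; lra.
    by case: (leP (wball z) 0) => w0; [rewrite normr0|rewrite gtr0_norm].
  apply: (@le_trans _ _ (1 * `|F (y + h *: v) - F y|)); first by apply: ler_wpM2r => //; exact: W1.
  rewrite mul1r.
  have Z z : is_derive z (h *: v) F (h * 'D_v F z) by exact: is_derive_dirZ.
  have dFh z : derivable F z (h *: v) by have [] := Z z.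
  have [c /andP[c0 c1] ->] := MVT_line y dFh.
  have [_ ->] := Z (y + c *: (h *: v)).
  rewrite normrM gtr0_norm// ler_wpM2l ?(ltW h0)//; apply: DK.
  move/boxE: by_ => [b1 b2 b3]; apply/boxE.
  have T (a b : R) : `|a| <= 1 + L -> `|b| <= L -> `|a + c * (h * b)| <= 1 + L + L.
    move=> a1 b1'; apply: le_trans (ler_normD _ _) _; apply: lerD => //.
    apply: le_trans b1'; rewrite !normrM mulrA ler_piMl// mulr_ile1//.
    - by rewrite ger0_norm.
    - by rewrite gtr0_norm.
  by split; apply: T => //; apply: vL; rewrite !inE eqxx ?orbT.
rewrite mulrA; apply: ler_pM => //; last exact: FK.
apply: le_trans (maxr0_dist _ _) _.
rewrite wball_shift (_ : _ - wball y = - (h * (dot3 y v + h * (dot3 v v / 2)))); last by field.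
rewrite normrN normrM gtr0_norm// ler_wpM2l ?(ltW h0)//.
apply: le_trans (ler_normD _ _) _; apply: lerD; first exact: dot_bound.
rewrite ger0_norm; last by rewrite mulr_ge0 ?divr_ge0// ltW.
apply: (@le_trans _ _ (1 * (dot3 v v / 2))); last by lra.
by rewrite ler_wpM2r// divr_ge0.
Qed.

Let mS : measurable [set x : E3 R | enorm x = 1].
Proof.
rewrite (_ : [set x | _] = setT `&` (@enorm R) @^-1` [set 1]); last by rewrite setTI.
exact: measurable_enorm.
Qed.

(* The derivative along [v] of the Lipschitz field [max(wball, 0) F] has integral
   zero by translation invariance; it is discontinuous only on the null unit sphere. *)
Lemma ball_divergence :
  \int[leb3 R]_(y in eball 1) (wball y * 'D_v F y - dot3 y v * F y) = 0.
Proof.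
have [C C0 HC] := quotient_bound; have [M M0 GM] := G_bounded.
have mG : measurable_fun setT G by exact: continuous_measurable_E3.
have mGs n : measurable_fun setT (fun y => G (y + n.+1%:R^-1 *: v)).
  have [ms _] := scales_by_translation3 (n.+1%:R^-1 *: v).
  exact: (measurableT_comp mG ms).
pose Q n y := n.+1%:R * (G (y + n.+1%:R^-1 *: v) - G y).
have mQ n : measurable_fun setT (Q n).
  by apply: measurable_funM => //; exact: measurable_funB.
have Q0 n y : ~ box (1 + L) y -> Q n y = 0.
  move=> nb; rewrite /Q !G0 ?subrr ?mulr0//.
    move=> b1; apply: nb; apply/boxE; move/boxE: b1 => [b1 b2 b3].
    by split; [apply: le_trans b1 _|apply: le_trans b2 _|apply: le_trans b3 _]; rewrite lerDl.
  by move=> /(box_shift (@shift_bound n)).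
have IQ n : \int[leb3 R]_y Q n y = 0.
  rewrite /Q RintegralZl//; last first.
    apply: (@integrable_boxed _ _ (C / n.+1%:R) (1 + L)) => //.
    - exact: measurable_funB.
    - by move=> x; rewrite ler_pdivlMr// mulrC -[X in X * _]ger0_norm// -normrM HC.
    - by move=> x /(Q0 n)/eqP; rewrite mulf_eq0 pnatr_eq0/= => /eqP.
  by rewrite (Rintegral_translate_sub _ mG GM G0) mulr0.
have iQ n : (leb3 R).-integrable setT (EFin \o Q n).
  by apply: (@integrable_boxed _ (Q n) C (1 + L)) => //; [move=> y; exact: HC|exact: Q0].
have S0 : leb3 R [set x | enorm x = 1] = 0%E by exact: leb3_sphere.
pose S := [set x : E3 R | enorm x = 1].
have IQS n : \int[leb3 R]_(y in setT `\` S) Q n y = 0.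
  rewrite -(IQ n) /Rintegral; congr fine; apply/esym/negligible_integral => //.
  exact: iQ.
pose dom y := C * \1_(box (1 + L)) y.
have idom : (leb3 R).-integrable setT (EFin \o dom).
  apply: (@integrable_boxed _ dom C (1 + L)).
  - by apply: measurable_funM => //; apply: measurable_indic; exact: measurable_box.
  - by move=> x; rewrite /dom indicE normrM ger0_norm// ler_piMr//; case: (_ \in _); rewrite ?normr1 ?normr0.
  - by move=> x nb; rewrite /dom indicE memNset// mulr0.
have mD : measurable (setT `\` S : set (measurableTypeR R * measurableTypeR R * measurableTypeR R)).
  exact: measurableD.
have Qdom n y : (0 <= n)%N -> (setT `\` S) y -> `|Q n y| <= dom y.
  move=> _ _; rewrite /dom indicE; have [by_|nb] := pselect (box (1 + L) y).
    by rewrite mem_set// mulr1 HC.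
  by rewrite Q0// normr0 memNset// mulr0.
have Qg y : (setT `\` S) y -> Q n y @[n --> \oo] --> g y.
  by move=> [_ /eqP yS]; apply: quotient_cvg; exact: dG.
have [_ cvgQ] := @Rintegral_dominated_cvg _ _ R (leb3 R) (setT `\` S) Q g dom 0 mD
  (fun n => measurable_funTS (mQ n)) Qg
  (integrableS measurableT mD (@subsetT _ _) idom) Qdom.
have g0 : \int[leb3 R]_(y in setT `\` S) g y = 0.
  apply/esym; apply: (cvg_unique _ _ cvgQ) => //.
  have -> : (fun n => \int[leb3 R]_(x in setT `\` S) Q n x) = cst 0.
    by apply/funext => n; exact: IQS.
  exact: cvg_cst.
pose E y := wball y * 'D_v F y - dot3 y v * F y.
have cE : continuous E.
  have cdot : continuous (fun y => dot3 y v).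
    move=> y; apply: cvgD; [apply: cvgD|]; apply: cvgM; try exact: cvg_cst.
    - exact: continuous_coord1.
    - exact: continuous_coord2.
    - exact: continuous_coord3.
  move=> y; apply: cvgB; apply: cvgM; [exact: continuous_wball|exact: cDF|exact: cdot|exact: cF].
have iE := continuous_integrable_eball 1 cE.
have iE' := (integrable_mkcond (mu := leb3 R) _ (measurable_eball 1)).1 iE.
rewrite -g0 /Rintegral; congr fine; rewrite [LHS]integral_mkcond.
rewrite (negligible_integral (mu := leb3 R) (N := S) mS measurableT iE' S0).
apply: eq_integral => y; rewrite inE => -[_ /eqP y1].
rewrite /patch /g wball_gt0 lt_neqAle y1/=.
by have [y1'|y1'] := leP (enorm y) 1; [rewrite mem_set|rewrite memNset//=; apply/negP; rewrite -ltNge].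
Qed.

End ball_divergence.

Section ball_means.
Context {R : realType}.
Implicit Types (phi W : E3 R -> R) (x y v : E3 R) (s : R).

(** Integrals over the unit ball, not divided by its volume. The dilation factor s ranges over all
    reals, which makes parity in s meaningful. *)
Definition ball_mean phi s : R := \int[leb3 R]_(y in eball 1) phi (s *: y).
Definition wball_mean phi s : R := \int[leb3 R]_(y in eball 1) (wball y * phi (s *: y)).

Lemma continuous_scale phi s : continuous phi -> continuous (fun y => phi (s *: y)).
Proof. by move=> cp y; apply: continuous_comp; [exact: scaler_continuous|exact: cp]. Qed.

Lemma is_derive_scale phi s y v : test_function phi ->
  is_derive y v (fun y => phi (s *: y)) (s * 'D_v phi (s *: y)).
Proof.
move=> tp; apply: is_derive_lineV.
have dp z : derivable phi z v by exact: test_function_derivable.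
have Z z : is_derive z (s *: v) phi (s * 'D_v phi z) by exact: is_derive_dirZ.
have dZ z : derivable phi z (s *: v) by have [] := Z z.
have eZ z : 'D_(s *: v) phi z = s * 'D_v phi z by have [] := Z z.
have := derive_line (s *: y) dZ 0.
rewrite eZ scale0r addr0 => D.
rewrite (_ : (fun t : R => _) = (fun t : R => phi (s *: y + t *: (s *: v))))//.
by apply/funext => t; rewrite scalerDr !scalerA mulrC.
Qed.

Lemma derive_euler phi s y : test_function phi ->
  'D_y phi (s *: y) = y.1.1 * 'D_e1 phi (s *: y) + y.1.2 * 'D_e2 phi (s *: y)
     + y.2 * 'D_e3 phi (s *: y).
Proof. by move=> tp; have [] := is_derive_coord (s *: y) y tp. Qed.

Lemma is_derive_ball_integral W phi s : continuous W -> test_function phi ->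
  is_derive s (1 : R) (fun s => \int[leb3 R]_(y in eball 1) (W y * phi (s *: y)))
    (\int[leb3 R]_(y in eball 1) (W y * 'D_y phi (s *: y))).
Proof.
move=> cW tp.
have [KW KW0 WK] := continuous_bounded_box 1 cW.
have [K1 K10 D1] := test_function_bounded (test_function_D e1 tp).
have [K2 K20 D2] := test_function_bounded (test_function_D e2 tp).
have [K3 K30 D3] := test_function_bounded (test_function_D e3 tp).
have cp t : continuous (fun y => phi (t *: y)).
  exact/continuous_scale/test_function_continuous.
apply: (@is_derive_under_integral _ _ R (leb3 R) (eball 1)
  (fun s y => W y * phi (s *: y)) (fun s y => W y * 'D_y phi (s *: y))
  (fun=> KW * (K1 + K2 + K3)) s).
- exact: measurable_eball.
- by apply: continuous_integrable_eball => y; exact: cvg_cst.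
- by move=> _; rewrite mulr_ge0// !addr_ge0.
- move=> t _; apply: continuous_integrable_eball => y.
  by apply: cvgM; [exact: cW|exact: cp].
- move=> t y _ _.
  have dy z : derivable phi z y by exact: test_function_derivable.
  have D := is_deriveZ (W y) (derive_line 0 dy t).
  move: D; rewrite add0r; congr is_derive.
  by apply/funext => u /=; rewrite add0r.
- move=> t y _ y1; rewrite derive_euler// normrM.
  have [c1 c2 c3] := coord_le_enorm y.
  have T (a b K : R) : `|a| <= enorm y -> `|b| <= K -> `|a * b| <= K.
    move=> ha hb; rewrite normrM; apply: le_trans hb; rewrite ler_piMl//.
    exact: le_trans ha y1.
  apply: ler_pM => //; first exact: WK (eball_box y1).
  apply: le_trans (ler_normD _ _) _; apply: lerD; last exact: T.
  by apply: le_trans (ler_normD _ _) _; apply: lerD; exact: T.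
Qed.

Lemma dot3_e1 y : dot3 y e1 = y.1.1. Proof. by rewrite /dot3/=; ring. Qed.
Lemma dot3_e2 y : dot3 y e2 = y.1.2. Proof. by rewrite /dot3/=; ring. Qed.
Lemma dot3_e3 y : dot3 y e3 = y.2. Proof. by rewrite /dot3/=; ring. Qed.

Lemma divergence_test phi s v : test_function phi ->
  \int[leb3 R]_(y in eball 1) (wball y * (s * 'D_v phi (s *: y)) - dot3 y v * phi (s *: y)) = 0.
Proof.
move=> tp; have E y : 'D_v (fun y => phi (s *: y)) y = s * 'D_v phi (s *: y).
  by have [] := is_derive_scale s y v tp.
rewrite -(@ball_divergence R (fun y => phi (s *: y)) v).
- by apply: eq_Rintegral => y _; rewrite E.
- exact/continuous_scale/test_function_continuous.
- by move=> y; have [] := is_derive_scale s y v tp.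
- have cD : continuous (fun y => 'D_v phi (s *: y)).
    apply: (@continuous_scale ('D_v phi) s); exact/test_function_continuous/test_function_D.
  rewrite (_ : 'D_v _ = fun y => s * 'D_v phi (s *: y)); last exact/funext.
  move=> y; apply: cvgM; first exact: cvg_cst.
  exact: cD.
Qed.

Lemma continuous_dotv v : continuous (fun y => dot3 y v).
Proof.
move=> y; apply: cvgD; [apply: cvgD|]; apply: cvgM; try exact: cvg_cst.
- exact: continuous_coord1.
- exact: continuous_coord2.
- exact: continuous_coord3.
Qed.

Lemma is_derive_dotv y v : is_derive y v (fun y => dot3 y v) (dot3 v v).
Proof.
apply: is_derive_lineV.
rewrite (_ : (fun s : R => _) = fun s : R => dot3 y v + dot3 v v * s).
  have D := is_deriveD (is_derive_cst (dot3 y v) (0 : R) (1 : R))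
    (is_deriveZ (dot3 v v) (is_derive_id (0 : R) (1 : R))).
  by apply: (is_derive_eq D); rewrite /GRing.scale/=; ring.
by apply/funext => s; rewrite /dot3/= /GRing.scale/=; ring.
Qed.

Lemma divergence_test_dot phi s v : test_function phi ->
  \int[leb3 R]_(y in eball 1) (wball y * (dot3 v v * phi (s *: y) +
    dot3 y v * (s * 'D_v phi (s *: y))) - dot3 y v * (dot3 y v * phi (s *: y))) = 0.
Proof.
move=> tp.
have D y : is_derive y v (fun y => dot3 y v * phi (s *: y))
    (dot3 v v * phi (s *: y) + dot3 y v * (s * 'D_v phi (s *: y))).
  have D := is_deriveM (is_derive_dotv y v) (is_derive_scale s y v tp).
  by apply: (is_derive_eq D); rewrite /GRing.scale/=; ring.
have cp : continuous (fun y => phi (s *: y)).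
  exact/continuous_scale/test_function_continuous.
have cD : continuous (fun y => 'D_v phi (s *: y)).
  apply: (@continuous_scale ('D_v phi) s); exact/test_function_continuous/test_function_D.
have cd := @continuous_dotv v.
have E y : 'D_v (fun y => dot3 y v * phi (s *: y)) y =
    dot3 v v * phi (s *: y) + dot3 y v * (s * 'D_v phi (s *: y)) by have [] := D y.
rewrite -(@ball_divergence R (fun y => dot3 y v * phi (s *: y)) v).
- by apply: eq_Rintegral => y _; rewrite E.
- by move=> y; apply: cvgM; [exact: cd|exact: cp].
- by move=> y; have [] := D y.
- rewrite (_ : 'D_v _ = fun y => dot3 v v * phi (s *: y) + dot3 y v * (s * 'D_v phi (s *: y)));
    last exact/funext.
  move=> y; apply: cvgD; apply: cvgM; [exact: cvg_cst|exact: cp|exact: cd|].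
  by apply: cvgM; [exact: cvg_cst|exact: cD].
Qed.

End ball_means.

Section spherical_profile.
Context {R : realType}.
Implicit Types (phi F : E3 R -> R) (x y v : E3 R) (s r : R).

Lemma measurable_eball3 r :
  measurable (eball r : set (measurableTypeR R * measurableTypeR R * measurableTypeR R)).
Proof. exact: measurable_eball. Qed.

Let iB F : continuous F -> (leb3 R).-integrable (eball 1) (EFin \o F).
Proof. exact: continuous_integrable_eball. Qed.

Lemma derive_euler_dot phi s y : test_function phi ->
  'D_y phi (s *: y) = dot3 y e1 * 'D_e1 phi (s *: y) + dot3 y e2 * 'D_e2 phi (s *: y)
     + dot3 y e3 * 'D_e3 phi (s *: y).
Proof.
move=> tp; apply: etrans (derive_euler s y tp) _.
by congr (_ * _ + _ * _ + _ * _); [exact/esym/dot3_e1|exact/esym/dot3_e2|exact/esym/dot3_e3].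
Qed.

Lemma continuous_test_scale phi s : test_function phi -> continuous (fun y => phi (s *: y)).
Proof. by move=> tp; apply: continuous_scale; exact: test_function_continuous. Qed.

Lemma continuous_test_D phi s v : test_function phi -> continuous (fun y => 'D_v phi (s *: y)).
Proof. by move=> tp; apply: (@continuous_test_scale ('D_v phi)); exact: test_function_D. Qed.

Lemma continuous_wball_test phi s : test_function phi ->
  continuous (fun y => wball y * phi (s *: y)).
Proof. by move=> tp y; apply: cvgM; [exact: continuous_wball|exact: continuous_test_scale]. Qed.

Lemma continuous_div_test phi s v : test_function phi ->
  continuous (fun y => wball y * (s * 'D_v phi (s *: y)) - dot3 y v * phi (s *: y)).
Proof.
move=> tp y; apply: cvgB; apply: cvgM.
- exact: continuous_wball.
- by apply: cvgM; [exact: cvg_cst|exact: continuous_test_D].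
- exact: continuous_dotv.
- exact: continuous_test_scale.
Qed.

Lemma continuous_div_test_dot phi s v : test_function phi ->
  continuous (fun y => wball y * (dot3 v v * phi (s *: y) +
    dot3 y v * (s * 'D_v phi (s *: y))) - dot3 y v * (dot3 y v * phi (s *: y))).
Proof.
move=> tp y; apply: cvgB; apply: cvgM.
- exact: continuous_wball.
- apply: cvgD; apply: cvgM; [exact: cvg_cst|exact: continuous_test_scale|exact: continuous_dotv|].
  by apply: cvgM; [exact: cvg_cst|exact: continuous_test_D].
- exact: continuous_dotv.
- by apply: cvgM; [exact: continuous_dotv|exact: continuous_test_scale].
Qed.

Lemma Rintegral_zero3 (A1 A2 A3 : E3 R -> R) : continuous A1 -> continuous A2 -> continuous A3 ->
  \int[leb3 R]_(y in eball 1) A1 y = 0 -> \int[leb3 R]_(y in eball 1) A2 y = 0 ->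
  \int[leb3 R]_(y in eball 1) A3 y = 0 ->
  \int[leb3 R]_(y in eball 1) (A1 y + A2 y + A3 y) = 0.
Proof.
move=> c1 c2 c3 z1 z2 z3.
have mB := measurable_eball3 1.
have i12 : (leb3 R).-integrable (eball 1) (EFin \o (fun y => A1 y + A2 y)).
  by apply: iB => y; apply: cvgD; [exact: c1|exact: c2].
rewrite (RintegralD mB i12 (iB c3)) (RintegralD mB (iB c1) (iB c2)).
by rewrite z1 z2 z3 !addr0.
Qed.

(** The derivative is the integral of y . grad phi(s y). As - y is the gradient of [wball], which
    vanishes on the unit sphere, an integration by parts for each coordinate derivative of phi
    produces the Laplacian with weight [wball]. *)
Lemma is_derive_ball_mean phi s : test_function phi ->
  is_derive s (1 : R) (ball_mean phi) (s * wball_mean (laplacian phi) s).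
Proof.
move=> tp.
have c1 : continuous (fun _ : E3 R => 1 : R) by move=> y; exact: cvg_cst.
have := is_derive_ball_integral s c1 tp.
rewrite (_ : (fun s => _) = ball_mean phi); last first.
  by apply/funext => t; apply: eq_Rintegral => y _; rewrite mul1r.
move=> D; apply: (is_derive_eq D).
have tD v : test_function ('D_v phi) := test_function_D v tp.
have Z := Rintegral_zero3
  (@continuous_div_test _ s e1 (tD e1)) (@continuous_div_test _ s e2 (tD e2))
  (@continuous_div_test _ s e3 (tD e3))
  (divergence_test s e1 (tD e1)) (divergence_test s e2 (tD e2)) (divergence_test s e3 (tD e3)).
have tL := test_function_laplacian tp.
have mB := measurable_eball3 1.
have iw := iB (@continuous_wball_test _ s tL).
have iws := integrable_mull s mB iw.
transitivity (\int[leb3 R]_(y in eball 1) (s * (wball y * laplacian phi (s *: y))) - 0); last first.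
  by rewrite subr0 RintegralZl.
rewrite -Z -RintegralB//; last first.
  apply: iB => y; apply: cvgD; [apply: cvgD|].
  - exact: (@continuous_div_test _ s e1 (tD e1)).
  - exact: (@continuous_div_test _ s e2 (tD e2)).
  - exact: (@continuous_div_test _ s e3 (tD e3)).
have alg (w b1 b2 b3 d1 d2 d3 l1 l2 l3 : R) : 1 * (b1 * d1 + b2 * d2 + b3 * d3) =
    s * (w * (l1 + l2 + l3)) -
    (w * (s * l1) - b1 * d1 + (w * (s * l2) - b2 * d2) + (w * (s * l3) - b3 * d3)) by ring.
apply: eq_Rintegral => y _.
rewrite (derive_euler_dot s y tp) (laplacianE phi (s *: y)); exact: alg.
Qed.

(** The divergence theorem for the fields (y . e) phi(s y) along e, summed over the basis, turns s
    times the derivative into the integral of (|y|^2 - 3 wball) phi(s y), and |y|^2 = 1 - 2 wball.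
    The identity keeps the factor s so that it also makes sense at s = 0. *)
Lemma is_derive_wball_mean phi s : test_function phi ->
  exists2 d, is_derive s (1 : R) (wball_mean phi) d &
    s * d = ball_mean phi s - 5 * wball_mean phi s.
Proof.
move=> tp; have cw := @continuous_wball R.
exists (\int[leb3 R]_(y in eball 1) (wball y * 'D_y phi (s *: y))).
  exact: is_derive_ball_integral.
have Z := Rintegral_zero3
  (@continuous_div_test_dot _ s e1 tp) (@continuous_div_test_dot _ s e2 tp)
  (@continuous_div_test_dot _ s e3 tp)
  (divergence_test_dot s e1 tp) (divergence_test_dot s e2 tp) (divergence_test_dot s e3 tp).
have mB := measurable_eball3 1.
have cE : continuous (fun y => 'D_y phi (s *: y)).
  rewrite (_ : (fun y => _) = fun y => dot3 y e1 * 'D_e1 phi (s *: y) +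
    dot3 y e2 * 'D_e2 phi (s *: y) + dot3 y e3 * 'D_e3 phi (s *: y)).
    move=> y; apply: cvgD; [apply: cvgD|]; apply: cvgM; try exact: continuous_dotv;
      exact: continuous_test_D.
  by apply/funext => y; exact: derive_euler_dot.
have i1 := iB (@continuous_test_scale _ s tp).
have iw := iB (@continuous_wball_test _ s tp).
have id : (leb3 R).-integrable (eball 1) (EFin \o (fun y => wball y * 'D_y phi (s *: y))).
  by apply: iB => y; apply: cvgM; [exact: cw|exact: cE].
have n1 : [/\ dot3 e1 e1 = 1 :> R, dot3 e2 e2 = 1 :> R & dot3 e3 e3 = 1 :> R].
  by rewrite /dot3/= !mulr0 !mul1r !addr0 add0r.
have alg (w b1 b2 b3 d1 d2 d3 f : R) : b1 ^+ 2 + b2 ^+ 2 + b3 ^+ 2 = 1 - 2 * w ->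
    s * (w * (b1 * d1 + b2 * d2 + b3 * d3)) - (f - 5 * (w * f)) =
    w * (dot3 e1 e1 * f + b1 * (s * d1)) - b1 * (b1 * f) +
    (w * (dot3 e2 e2 * f + b2 * (s * d2)) - b2 * (b2 * f)) +
    (w * (dot3 e3 e3 * f + b3 * (s * d3)) - b3 * (b3 * f)).
  case: n1 => -> -> -> h; have -> : b3 * (b3 * f) = (1 - 2 * w - b1 ^+ 2 - b2 ^+ 2) * f.
    by rewrite -h; ring.
  by ring.
have E : \int[leb3 R]_(y in eball 1) (s * (wball y * 'D_y phi (s *: y)) -
    (phi (s *: y) - 5 * (wball y * phi (s *: y)))) = 0.
  rewrite -Z; apply: eq_Rintegral => y _; rewrite (derive_euler_dot s y tp).
  apply: alg; rewrite /wball (_ : dot3 y y = dot3 y e1 ^+ 2 + dot3 y e2 ^+ 2 + dot3 y e3 ^+ 2).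
    by field.
  by rewrite (dot3_e1 y) (dot3_e2 y) (dot3_e3 y).
have i5 := integrable_mull 5 mB iw.
have is_ := integrable_mull s mB id.
move: E; rewrite (RintegralB mB is_ (integrable_subr mB i1 i5)).
rewrite (RintegralB mB i1 i5) (RintegralZl s mB id) (RintegralZl 5 mB iw).
by move=> /eqP; rewrite subr_eq0 => /eqP.
Qed.

(* [psi phi r] is [r] times the integral of [phi (r w)] over the unit sphere,
   expressed through integrals over the unit ball; it is odd in [r]. *)
Definition psi phi s : R := 3 * s * ball_mean phi s + s ^+ 3 * wball_mean (laplacian phi) s.
Definition psi' phi s : R := 3 * ball_mean phi s + s ^+ 2 * wball_mean (laplacian phi) s
  + s ^+ 2 * ball_mean (laplacian phi) s.

Lemma is_derive_psi phi s : test_function phi -> is_derive s (1 : R) (psi phi) (psi' phi s).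
Proof.
move=> tp; have tL := test_function_laplacian tp.
have [d D dE] := is_derive_wball_mean s tL.
have := is_deriveD (is_deriveM (is_deriveZ 3 (is_derive_id s (1 : R))) (is_derive_ball_mean s tp))
  (is_deriveM (is_deriveX 3 (is_derive_id s (1 : R))) D).
move=> H; apply: (is_derive_eq H); rewrite /GRing.scale/= /psi'.
have -> : s ^+ 3 * d = s ^+ 2 * (s * d) by ring.
by rewrite dE (_ : 3 *: s = 3 * s)//; ring.
Qed.

Let is_derive_psi'_aux (b g bL : R -> R) (gLL d s : R) :
  is_derive s (1 : R) b (s * g s) -> is_derive s (1 : R) g d ->
  s * d = bL s - 5 * g s -> is_derive s (1 : R) bL (s * gLL) ->
  is_derive s (1 : R) (fun s => 3 * b s + s ^+ 2 * g s + s ^+ 2 * bL s)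
    (3 * s * bL s + s ^+ 3 * gLL).
Proof.
move=> db dg dE dbL.
have H := is_deriveD (is_deriveD (is_deriveZ 3 db)
  (is_deriveM (is_deriveX 2 (is_derive_id s (1 : R))) dg))
  (is_deriveM (is_deriveX 2 (is_derive_id s (1 : R))) dbL).
apply: (is_derive_eq H); rewrite /GRing.scale/=.
rewrite -[(id ^+ 2) s]/(s ^+ 2); have -> : s ^+ 2 * d = s * (s * d) by ring.
by rewrite dE; ring.
Qed.

Lemma is_derive_psi' phi s : test_function phi ->
  is_derive s (1 : R) (psi' phi) (psi (laplacian phi) s).
Proof.
move=> tp; have tL := test_function_laplacian tp.
have [d D dE] := is_derive_wball_mean s tL.
exact: (is_derive_psi'_aux (is_derive_ball_mean s tp) D dE (is_derive_ball_mean s tL)).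
Qed.

End spherical_profile.

Section polar_test.
Context {R : realType}.
Notation mu := (@lebesgue_measure R).
Implicit Types (phi F : E3 R -> R) (x y v : E3 R) (s r A : R) (f : R -> R).

Lemma Rintegral_eball_dil F (c r : R) : continuous F -> c != 0 ->
  \int[leb3 R]_(x in eball (`|c| * r)) F x = `|c| ^+ 3 * \int[leb3 R]_(y in eball r) F (c *: y).
Proof.
move=> cF c0; rewrite Rintegral_mkcond [in RHS]Rintegral_mkcond.
have mF : measurable_fun setT (F \_ (eball (`|c| * r))).
  apply/(measurable_restrictT _ _).1; first exact: measurable_eball.
  by apply: measurable_funTS; exact: continuous_measurable_E3.
rewrite (scales_by_Rintegral (exprn_ge0 3 (normr_ge0 c)) (scales_by_dil c0) mF).
congr (_ * _); apply: eq_Rintegral => y _; rewrite dilE /patch.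
have -> : (c *: y \in eball (`|c| * r)) = (y \in eball r).
  apply/idP/idP; rewrite !inE /eball/= enormZ => h; last by rewrite ler_wpM2l.
  by move: h; rewrite ler_pM2l// normr_gt0.
by [].
Qed.

Lemma Rintegral_eball F r : continuous F -> 0 <= r ->
  \int[leb3 R]_(x in eball r) F x = r ^+ 3 * \int[leb3 R]_(y in eball 1) F (r *: y).
Proof.
move=> cF; rewrite le_eqVlt => /predU1P[<-|r0].
  rewrite expr0n/= mul0r /Rintegral null_set_integral//.
  - exact: measurable_eball.
  - apply/measurable_EFinP; apply: measurable_funTS; exact: continuous_measurable_E3.
  - by have := leb3_eball (lexx (0 : R)); rewrite expr0n mulr0.
have := Rintegral_eball_dil 1 cF (lt0r_neq0 r0).
by rewrite gtr0_norm// mulr1.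
Qed.

Lemma ball_meanN phi s : test_function phi -> ball_mean phi (- s) = ball_mean phi s.
Proof.
move=> tp; have N1 : (-1 : R) != 0 by rewrite oppr_eq0 oner_eq0.
have := Rintegral_eball_dil 1 (@continuous_test_scale R phi s tp) N1.
rewrite normrN1 mulr1 expr1n mul1r /ball_mean => ->.
by apply: eq_Rintegral => y _; rewrite scalerA mulrN1.
Qed.

Lemma wball_meanN phi s : test_function phi -> wball_mean phi (- s) = wball_mean phi s.
Proof.
move=> tp; have N1 : (-1 : R) != 0 by rewrite oppr_eq0 oner_eq0.
have := Rintegral_eball_dil 1 (@continuous_wball_test R phi s tp) N1.
rewrite normrN1 mulr1 expr1n mul1r /wball_mean => ->.
apply: eq_Rintegral => y _; rewrite scalerA mulrN1 /wball -!enorm_dot enormZ normrN1 mul1r//.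
Qed.

Lemma psiN phi s : test_function phi -> psi phi (- s) = - psi phi s.
Proof.
move=> tp; rewrite /psi (ball_meanN s tp) (wball_meanN s (test_function_laplacian tp)).
move: (wball_mean _ _) => g; ring.
Qed.

Lemma psi'N phi s : test_function phi -> psi' phi (- s) = psi' phi s.
Proof.
move=> tp; have tL := test_function_laplacian tp.
by rewrite /psi' (ball_meanN s tp) (wball_meanN s tL) (ball_meanN s tL) sqrrN.
Qed.

Lemma continuous_psi phi : test_function phi -> continuous (psi phi).
Proof. by move=> tp s; apply: is_derive_continuous; exact: is_derive_psi. Qed.

Lemma continuous_psi' phi : test_function phi -> continuous (psi' phi).
Proof. by move=> tp s; apply: is_derive_continuous; exact: is_derive_psi'. Qed.

Let radial_primitive_aux (b g bL : R -> R) (d r : R) :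
  is_derive r (1 : R) b (r * g r) -> is_derive r (1 : R) g d -> r * d = bL r - 5 * g r ->
  is_derive r (1 : R) (fun r => r ^+ 3 * b r) (r ^+ 2 * (3 * b r + r ^+ 2 * g r)) /\
  is_derive r (1 : R) (fun r => r ^+ 3 * b r + r ^+ 5 * g r)
    (r ^+ 2 * (3 * b r + r ^+ 2 * g r + r ^+ 2 * bL r)).
Proof.
move=> db dg dE.
have D1 := is_deriveM (is_deriveX 3 (is_derive_id r (1 : R))) db.
have D1' : is_derive r (1 : R) (fun r => r ^+ 3 * b r) (r ^+ 2 * (3 * b r + r ^+ 2 * g r)).
  apply: (is_derive_eq D1); rewrite /GRing.scale/= -[(id ^+ 3) r]/(r ^+ 3); ring.
split=> //; have D2 := is_deriveM (is_deriveX 5 (is_derive_id r (1 : R))) dg.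
apply: (is_derive_eq (is_deriveD D1' D2)); rewrite /GRing.scale/= -[(id ^+ 5) r]/(r ^+ 5).
have -> : r ^+ 5 * d = r ^+ 4 * (r * d) by ring.
by rewrite dE; ring.
Qed.

Definition psi_over_r phi r : R := 3 * ball_mean phi r + r ^+ 2 * wball_mean (laplacian phi) r.

Lemma psi_over_rE phi r : psi phi r = r * psi_over_r phi r.
Proof. by rewrite /psi /psi_over_r; move: (wball_mean _ _) => g; ring. Qed.

(** By [ball_mean_cdf] and [euler_cdf] the two primitives are, for r >= 0, the integrals over the
    ball of radius r of phi and of x . grad phi + phi. Hence r psi and r^2 psi' are the radial
    densities of these two functions. *)
Lemma radial_primitives phi r : test_function phi ->
  is_derive r (1 : R) (fun r => r ^+ 3 * ball_mean phi r) (r ^+ 2 * psi_over_r phi r) /\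
  is_derive r (1 : R) (fun r => r ^+ 3 * ball_mean phi r + r ^+ 5 * wball_mean (laplacian phi) r)
    (r ^+ 2 * psi' phi r).
Proof.
move=> tp; have [d D dE] := is_derive_wball_mean r (test_function_laplacian tp).
exact: (radial_primitive_aux (is_derive_ball_mean r tp) D dE).
Qed.

Lemma continuous_psi_over_r phi : test_function phi -> continuous (psi_over_r phi).
Proof.
move=> tp s; have [d D _] := is_derive_wball_mean s (test_function_laplacian tp).
apply: cvgD; apply: cvgM; [exact: cvg_cst| |exact: exprn_continuous|].
- exact: is_derive_continuous (is_derive_ball_mean s tp).
- exact: is_derive_continuous D.
Qed.

Lemma ball_mean_cdf phi r : test_function phi -> 0 <= r ->
  \int[leb3 R]_(x in eball r) phi x = r ^+ 3 * ball_mean phi r.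
Proof. by move=> tp r0; rewrite Rintegral_eball//; exact: test_function_continuous. Qed.

Lemma continuous_euler_scale phi s : test_function phi -> continuous (fun y => 'D_y phi (s *: y)).
Proof.
move=> tp; rewrite (_ : (fun y => _) = fun y => dot3 y e1 * 'D_e1 phi (s *: y) +
    dot3 y e2 * 'D_e2 phi (s *: y) + dot3 y e3 * 'D_e3 phi (s *: y)).
  by move=> y; apply: cvgD; [apply: cvgD|]; apply: cvgM; [exact: continuous_dotv|exact: continuous_test_D
    |exact: continuous_dotv|exact: continuous_test_D|exact: continuous_dotv|exact: continuous_test_D].
by apply/funext => y; exact: derive_euler_dot.
Qed.

Lemma continuous_euler phi : test_function phi -> continuous (fun x => 'D_x phi x).
Proof.
move=> tp; have := @continuous_euler_scale phi 1 tp.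
have -> // : (fun y => 'D_y phi (1 *: y)) = (fun y => 'D_y phi y).
by apply/funext => y; rewrite scale1r.
Qed.

Lemma euler_cdf phi r : test_function phi -> 0 <= r ->
  \int[leb3 R]_(x in eball r) ('D_x phi x + phi x) =
  r ^+ 3 * ball_mean phi r + r ^+ 5 * wball_mean (laplacian phi) r.
Proof.
move=> tp r0; have cE := @continuous_euler phi tp.
have cp := test_function_continuous tp.
rewrite Rintegral_eball//; last by move=> x; apply: cvgD; [exact: cE|exact: cp].
have c1 : continuous (fun _ : E3 R => 1 : R) by move=> y; exact: cvg_cst.
have D1 := is_derive_ball_integral r c1 tp.
have D2 := is_derive_ball_mean r tp.
have Dr : \int[leb3 R]_(y in eball 1) (1 * 'D_y phi (r *: y)) = r * wball_mean (laplacian phi) r.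
  have [_ <-] := D1; have [_ <-] := D2; congr ('D_1 _ r).
  by apply/funext => t; apply: eq_Rintegral => y _; rewrite mul1r.
have dE (y : E3 R) : 'D_(r *: y) phi (r *: y) = r * 'D_y phi (r *: y).
  have dy : derivable phi (r *: y) y by exact: test_function_derivable.
  by have [] := is_derive_dirZ r dy.
have mB := @measurable_eball3 R 1.
have i1 := continuous_integrable_eball 1 (@continuous_test_scale R phi r tp).
have i2 : (leb3 R).-integrable (eball 1) (EFin \o (fun y => 1 * 'D_y phi (r *: y))).
  apply: continuous_integrable_eball => y; apply: cvgM; first exact: cvg_cst.
  exact: continuous_euler_scale.
have i3 := integrable_mull r mB i2.
transitivity (r ^+ 3 * (\int[leb3 R]_(y in eball 1) (r * (1 * 'D_y phi (r *: y)) + phi (r *: y)))).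
  by congr (_ * _); apply: eq_Rintegral => y _; rewrite dE mul1r.
rewrite (RintegralD mB i3 i1) (RintegralZl r mB i2) Dr -/(ball_mean phi r).
by move: (wball_mean _ _) (ball_mean _ _) => g b; ring.
Qed.

End polar_test.

Section polar_formula.
Context {R : realType}.
Notation mu := (@lebesgue_measure R).
Implicit Types (phi F eta : E3 R -> R) (x y v : E3 R) (s r A : R) (f : R -> R).

Definition supported A F : Prop := forall x, A < enorm x -> F x = 0.

Lemma supported_le A B F : A <= B -> supported A F -> supported B F.
Proof. by move=> AB FA x /(le_lt_trans AB)/FA. Qed.

Lemma test_function_supported phi : test_function phi ->
  exists A, [/\ 0 <= A, supported A phi, supported A (laplacian phi) &
    supported A (fun x => 'D_x phi x)].
Proof.
move=> tp.
have [_ [A0 s0]] := tp; have [_ [AL sL]] := test_function_laplacian tp.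
have [_ [A1 s1]] := test_function_D e1 tp.
have [_ [A2 s2]] := test_function_D e2 tp.
have [_ [A3 s3]] := test_function_D e3 tp.
pose A := `|A0| + `|AL| + `|A1| + `|A2| + `|A3|.
have le B : B \in [:: A0; AL; A1; A2; A3] -> B <= A.
  have [? ? ? ? ?] := And5 (normr_ge0 A0) (normr_ge0 AL) (normr_ge0 A1) (normr_ge0 A2) (normr_ge0 A3).
  rewrite !inE => /or4P[/eqP->|/eqP->|/eqP->|/orP[/eqP->|/eqP->]]; apply: le_trans (ler_norm _) _;
    rewrite /A; lra.
have in5 i : (i < 5)%N -> nth 0 [:: A0; AL; A1; A2; A3] i <= A.
  by move=> i5; apply: le; exact: mem_nth.
exists A; split.
- by rewrite /A !addr_ge0.
- exact: supported_le (in5 0 isT) s0.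
- exact: supported_le (in5 1 isT) sL.
- move=> x Ax; have := derive_euler_dot 1 x tp; rewrite scale1r => ->.
  have -> : 'D_e1 phi x = 0 by exact: (supported_le (in5 2 isT) s1).
  have -> : 'D_e2 phi x = 0 by exact: (supported_le (in5 3 isT) s2).
  have -> : 'D_e3 phi x = 0 by exact: (supported_le (in5 4 isT) s3).
  by rewrite !mulr0 !addr0.
Qed.

(** Beyond A the integral of phi over the ball of radius r is constant, so its derivative r psi
    vanishes there; negative s follow by parity. *)
Lemma psi_supported phi A : test_function phi -> 0 <= A -> supported A phi ->
  forall s, A < `|s| -> psi phi s = 0 /\ psi' phi s = 0.
Proof.
move=> tp A0 sp.
have Qc r : A < r -> r ^+ 3 * ball_mean phi r = \int[leb3 R]_(x in eball A) phi x.
  move=> Ar; rewrite -ball_mean_cdf// ?(le_trans A0 (ltW Ar))//.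
  rewrite Rintegral_mkcond [RHS]Rintegral_mkcond; apply: eq_Rintegral => x _.
  rewrite /patch; have [xA|xA] := leP (enorm x) A.
    by rewrite !mem_set// /eball/= ?(le_trans xA)// ltW.
  by rewrite sp//; case: ifP; case: ifP.
have pos s : A < s -> psi phi s = 0.
  move=> As; have s0 : 0 < s by exact: le_lt_trans As.
  have [D _] := radial_primitives s tp.
  have C : is_derive s (1 : R) (fun r => r ^+ 3 * ball_mean phi r) 0.
    have H : \forall r \near s, cst (\int[leb3 R]_(x in eball A) phi x) r = r ^+ 3 * ball_mean phi r.
      by near=> r; rewrite Qc//; near: r; exact: lt_nbhsr.
    by apply: (near_eq_is_derive H); exact: is_derive_cst.
  have : s ^+ 2 * psi_over_r phi s = 0 by have [_ <-] := D; have [_ <-] := C.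
  move=> /eqP; rewrite mulf_eq0 sqrf_eq0 gt_eqF//= => /eqP.
  by rewrite psi_over_rE => ->; rewrite mulr0.
have pos' s : A < s -> psi' phi s = 0.
  move=> As; have D := is_derive_psi s tp.
  have C : is_derive s (1 : R) (psi phi) 0.
    have H : \forall r \near s, cst 0 r = psi phi r.
      by near=> r; rewrite pos//; near: r; exact: lt_nbhsr.
    by apply: (near_eq_is_derive H); exact: is_derive_cst.
  by have [_ <-] := D; have [_ <-] := C.
move=> s As; have [s0|s0] := leP 0 s.
  by rewrite ger0_norm// in As; split; [exact: pos|exact: pos'].
rewrite ltr0_norm// in As.
rewrite -[s]opprK (psiN _ tp) (psi'N _ tp) pos// pos'//.
by rewrite oppr0.
Unshelve. all: by end_near. Qed.

(** Since eta vanishes beyond A, f may be replaced by its restriction to [0, A]; on this segment k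
    is bounded, so integrability against r^2 gives integrability against r^2 k. *)
Lemma polar_general eta (Q k : R -> R) A : continuous eta -> 0 <= A -> supported A eta ->
  (forall r, is_derive r (1 : R) Q (r ^+ 2 * k r)) -> continuous k -> Q 0 = 0 ->
  (forall r, 0 <= r -> \int[leb3 R]_(x in eball r) eta x = Q r) ->
  forall f, measurable_fun setT f ->
  mu.-integrable `[0, A] (EFin \o (fun r => f r * r ^+ 2)) ->
  (leb3 R).-integrable setT (EFin \o (fun x => f (enorm x) * eta x)) /\
  \int[leb3 R]_x (f (enorm x) * eta x) = \int[mu]_(r in `[0, A]) (f r * r ^+ 2 * k r).
Proof.
move=> ce A0 se dQ ck Q0 cdf f mf i2.
have [K K0 eK'] := continuous_bounded_box A ce.
have eK x : `|eta x| <= K.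
  have [xA|xA] := leP (enorm x) A; first exact: eK' (eball_box xA).
  by rewrite se// normr0.
pose g := f \_ `[0, A].
have mg : measurable_fun setT g.
  apply/(measurable_restrictT _ _).1; first exact: measurable_itv.
  exact: measurable_funTS.
have gE : (fun x : E3 R => f (enorm x) * eta x) = (fun x => g (enorm x) * eta x).
  apply/funext => x; rewrite /g /patch mem_setE in_itv/= enorm_ge0/=.
  by case: (leP (enorm x) A) => // /se ->; rewrite !mulr0.
have ck2 : continuous (fun r => r ^+ 2 * k r).
  by move=> r; apply: cvgM; [exact: exprn_continuous|exact: ck].
have patchE (h : R -> R) : (fun r => g r * h r) \_ `[0, +oo[ = (fun r => f r * h r) \_ `[0, A].
  apply/funext => r; rewrite /g /patch !mem_setE !in_itv/= andbT.
  by case: (leP 0 r) => //= r0; case: ifP; rewrite ?mul0r.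
have ext (h : R -> R) : mu.-integrable `[0, A] (EFin \o (fun r => f r * h r)) ->
    mu.-integrable `[0, +oo[ (EFin \o (fun r => g r * h r)).
  have mA : measurable (`[0, A]%classic : set (measurableTypeR R)) by exact: measurable_itv.
  have mO : measurable (`[0, +oo[%classic : set (measurableTypeR R)) by exact: measurable_itv.
  move=> /(integrable_mkcond (mu := mu) _ mA).1 I.
  apply/(integrable_mkcond (mu := mu) _ mO).2; move: I; congr (_.-integrable _ _).
  have := congr1 (fun h' : R -> R => EFin \o h') (esym (patchE h)).
  by move=> E; apply/funext => r; have := congr1 (@^~ r) E; rewrite /patch/=; do 2?case: ifP.
have iq : mu.-integrable `[0, A] (EFin \o (fun r => f r * (r ^+ 2 * k r))).
  have [Kk kK] : exists M, forall r, r \in `[0, A] -> `|k r| <= M.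
    have : compact (k @` `[0, A]).
      apply: continuous_compact; first exact: continuous_subspaceT.
      exact: segment_compact.
    move=> /compact_bounded[M [_ HM]]; exists (`|M| + 1) => r rA.
    by apply: (HM (`|M| + 1)); [rewrite (le_lt_trans (ler_norm _))// ltrDl|exists r].
  have mk : measurable_fun `[0, A] k.
    by apply: measurable_funTS; exact: continuous_measurable_fun.
  have := integrable_itv_mulr_bounded i2 mk kK; congr (_.-integrable _ (EFin \o _)).
  by apply/funext => r /=; rewrite mulrA.
have [I E] := polar_signed_shift (continuous_measurable_E3 ce) K0 eK dQ ck2 Q0 cdf mg
  (ext _ i2) (ext _ iq).
rewrite gE E; split=> //.
rewrite Rintegral_mkcond patchE -Rintegral_mkcond.
by apply: eq_Rintegral => r _; rewrite mulrA.
Qed.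

Lemma polar_test phi A f : test_function phi -> 0 <= A -> supported A phi ->
  measurable_fun setT f -> mu.-integrable `[0, A] (EFin \o (fun r => f r * r ^+ 2)) ->
  (leb3 R).-integrable setT (EFin \o (fun x => f (enorm x) * phi x)) /\
  \int[leb3 R]_x (f (enorm x) * phi x) = \int[mu]_(r in `[0, A]) (f r * r * psi phi r).
Proof.
move=> tp A0 sp mf i2.
have dQ r := (radial_primitives r tp).1.
have Q0 : 0 ^+ 3 * ball_mean phi 0 = 0 :> R by rewrite expr0n mul0r.
have [I ->] := polar_general (test_function_continuous tp) A0 sp dQ
  (@continuous_psi_over_r R phi tp) Q0 (fun r => @ball_mean_cdf R phi r tp) mf i2.
by split=> //; apply: eq_Rintegral => r _; rewrite psi_over_rE; ring.
Qed.

Lemma polar_euler phi A f : test_function phi -> 0 <= A -> supported A phi ->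
  supported A (fun x => 'D_x phi x) ->
  measurable_fun setT f -> mu.-integrable `[0, A] (EFin \o (fun r => f r * r ^+ 2)) ->
  (leb3 R).-integrable setT (EFin \o (fun x => f (enorm x) * ('D_x phi x + phi x))) /\
  \int[leb3 R]_x (f (enorm x) * ('D_x phi x + phi x)) =
  \int[mu]_(r in `[0, A]) (f r * r ^+ 2 * psi' phi r).
Proof.
move=> tp A0 sp sE mf i2.
have dQ r := (radial_primitives r tp).2.
have Q0 : 0 ^+ 3 * ball_mean phi 0 + 0 ^+ 5 * wball_mean (laplacian phi) 0 = 0 :> R.
  by rewrite !expr0n !mul0r addr0.
have ce : continuous (fun x => 'D_x phi x + phi x).
  by move=> x; apply: cvgD; [exact: continuous_euler|exact: test_function_continuous].
have se : supported A (fun x => 'D_x phi x + phi x) by move=> x Ax; rewrite sE// sp// addr0.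
exact: (polar_general ce A0 se dQ (@continuous_psi' R phi tp) Q0
  (fun r => @euler_cdf R phi r tp) mf i2).
Qed.

(** The factor 3 [ball_vol] plays the part of the area of the unit sphere. *)
Lemma polar_ge0_one f : measurable_fun setT f -> (forall r, 0 <= f r) ->
  (\int[leb3 R]_x (f (enorm x))%:E =
   \int[mu]_(r in `[0%R, +oo[) (f r * (3 * ball_vol * r ^+ 2))%:E)%E.
Proof.
move=> mf f0.
have m1 : measurable_fun setT (fun _ : E3 R => 1 : R) by exact: measurable_cst.
have mq : measurable_fun setT (fun s : R => 3 * ball_vol * 1 * s ^+ 2).
  by apply: measurable_funM => //; exact: exprn_measurable.
have q0 s : 0 <= s -> 0 <= 3 * ball_vol * 1 * s ^+ 2.
  by move=> _; rewrite mulr_ge0 ?sqr_ge0// mulr1 mulr_ge0// ball_vol_ge0.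
have fin s : 0 <= s -> (\int[mu]_(r in `[0%R, s]) (3 * ball_vol * 1 * r ^+ 2)%:E < +oo)%E.
  move=> s0; rewrite -polar_cst_cdf// integral_cst; last exact: measurable_eball.
  by rewrite mul1e finite_eball.
have := @polar_ge0 R (fun=> 1) _ m1 mq (fun=> ler01) q0 (@polar_cst_cdf R 1) fin f mf f0.
under eq_integral do rewrite mulr1.
by move=> ->; apply: eq_integral => r _; rewrite mulr1.
Qed.

End polar_formula.

(** * Spherical waves *)

Section affine_change.
Context {R : realType}.
Notation mu := (@lebesgue_measure R).

Lemma scales_by_reflection : scales_by mu (fun x : measurableTypeR R => - x) 1.
Proof.
have N1 : (-1 : R) != 0 by rewrite oppr_eq0 oner_eq0.
have := scales_by_dilation N1; rewrite normrN1.
by rewrite (_ : (fun x => _) = (fun x : measurableTypeR R => - x))//; apply/funext => x; rewrite mulN1r.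
Qed.

Lemma integrable_scales_by1 {d : measure_display} {T : measurableType d}
    (m : {measure set T -> \bar R}) (f : T -> T) (g : T -> R) : scales_by m f 1 ->
  m.-integrable setT (EFin \o g) -> m.-integrable setT (EFin \o (fun x => g (f x))).
Proof.
move=> S ig; have mg := integrable_measurable_fun ig; have [mf _] := S.
apply/integrableP; split.
  by apply/measurable_EFinP; exact: (measurableT_comp mg mf).
have /integrableP[_] := ig.
rewrite (scales_by_ge0_integral ler01 S)//; first by rewrite mul1e.
by apply: measurableT_comp => //; exact/measurable_EFinP.
Qed.

Lemma Rintegral_scales_by1 {d : measure_display} {T : measurableType d}
    (m : {measure set T -> \bar R}) (f : T -> T) (g : T -> R) : scales_by m f 1 ->
  measurable_fun setT g -> \int[m]_x g x = \int[m]_x g (f x).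
Proof. by move=> S mg; rewrite (scales_by_Rintegral ler01 S mg) mul1r. Qed.

End affine_change.

Section radial_signal.
Context {R : realType}.
Notation mu := (@lebesgue_measure R).
Variable h : R -> R.
Hypotheses (mh : measurable_fun setT h)
  (ih : forall A, mu.-integrable `[0, A] (EFin \o h)).

Definition cutoff (B : R) : R -> R := h \_ `[0, B].

Lemma integrable_cutoff B : mu.-integrable setT (EFin \o cutoff B).
Proof.
have mB : measurable (`[0, B]%classic : set (measurableTypeR R)) by exact: measurable_itv.
have := (integrable_mkcond (mu := mu) _ mB).1 (ih B); congr (_.-integrable _ _).
by apply/funext => r; rewrite /cutoff /patch/=; case: ifP.
Qed.

Lemma measurable_cutoff B : measurable_fun setT (cutoff B).
Proof. exact: integrable_measurable_fun (integrable_cutoff B). Qed.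

(** The wave tested against a function, in the frame that moves with the signal: all the dependence
    on t is carried by the smooth chi, so the pairing can be differentiated although h is merely
    integrable. *)
Definition pairing B (chi : R -> R) (t : R) : R := \int[mu]_r (cutoff B r * chi (r + t)).

Lemma integrable_pairing B chi K t : continuous chi -> (forall s, `|chi s| <= K) ->
  mu.-integrable setT (EFin \o (fun r => cutoff B r * chi (r + t))).
Proof.
move=> cc cK; apply: (@integrable_dominated _ _ _ mu setT _ (fun r => K * `|cutoff B r|)) => //.
- apply: measurable_funM; first exact: measurable_cutoff.
  apply: (measurableT_comp (continuous_measurable_fun cc)).
  by have [] := @scales_by_translation R t.
- by move=> r _; rewrite normrM mulrC ler_wpM2r.
- by apply: (integrable_mull K) => //; apply: integrable_normr => //; exact: integrable_cutoff.
Qed.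

Lemma is_derive_pairing B chi chi' K K' t : (forall s, is_derive s (1 : R) chi (chi' s)) ->
  (forall s, `|chi s| <= K) -> (forall s, `|chi' s| <= K') ->
  is_derive t (1 : R) (pairing B chi) (pairing B chi' t).
Proof.
move=> dc cK cK'; have K'0 : 0 <= K' by exact: le_trans (cK' 0).
have cc s : {for s, continuous chi} by exact: is_derive_continuous (dc s).
apply: (@is_derive_under_integral _ _ R mu setT (fun t r => cutoff B r * chi (r + t))
  (fun t r => cutoff B r * chi' (r + t)) (fun r => K' * `|cutoff B r|)) => //.
- by apply: (integrable_mull K') => //; apply: integrable_normr => //; exact: integrable_cutoff.
- by move=> r; rewrite mulr_ge0.
- by move=> s _; exact: (@integrable_pairing B chi K).
- move=> s r _ _.
  have ds : is_derive s (1 : R) (fun s => r + s) 1.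
    have := is_deriveD (is_derive_cst r s (1 : R)) (is_derive_id s (1 : R)).
    by rewrite add0r.
  have := is_deriveZ (cutoff B r) (@is_derive1_comp R chi (fun s => r + s) s _ _ (dc (r + s)) ds).
  by move=> D; apply: (is_derive_eq D); rewrite /GRing.scale/= mulr1.
- by move=> s r _ _; rewrite normrM mulrC ler_wpM2r.
Qed.

Lemma pairing_indep A B B' chi t : (forall s, A < `|s| -> chi s = 0) ->
  A + `|t| <= B -> A + `|t| <= B' -> pairing B chi t = pairing B' chi t.
Proof.
move=> sc AB AB'; apply: eq_Rintegral => r _; rewrite /cutoff /patch !mem_setE !in_itv/=.
have [r0|//] := leP 0 r.
have [rA|rA] := leP r (A + `|t|).
  by rewrite (le_trans rA AB) (le_trans rA AB').
rewrite sc ?mulr0//.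
have := lerB_normD r t; rewrite (ger0_norm r0); lra.
Qed.

Definition ext0 (r : R) : R := if 0 <= r then h r else 0.

Lemma cutoff_ext0 B r : r <= B -> cutoff B r = ext0 r.
Proof. by move=> rB; rewrite /cutoff /patch mem_setE in_itv/= rB andbT. Qed.

Lemma measurable_ext0 : measurable_fun setT ext0.
Proof.
rewrite (_ : ext0 = h \_ `[0, +oo[).
  apply/(measurable_restrictT _ _).1; first exact: measurable_itv.
  exact: measurable_funTS.
by apply/funext => r; rewrite /ext0 /patch mem_setE in_itv/= andbT.
Qed.

(* [signal t r / r] is the spherical wave whose trace at time 0 is [h r / r] and
   which moves outwards; the second term is its reflection at the origin. *)
Definition signal (t r : R) : R := ext0 (r - t) - ext0 (- r - t).

Lemma measurable_signal t : measurable_fun setT (signal t).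
Proof.
have m1 : measurable_fun setT (fun r : R => r - t) by have [] := @scales_by_translation R (- t).
apply: measurable_funB; apply: (measurableT_comp measurable_ext0) => //.
by apply: (measurableT_comp m1); have [] := @scales_by_reflection R.
Qed.

Lemma integrable_signal t A : mu.-integrable `[0, A] (EFin \o signal t).
Proof.
have S1 := @scales_by_translation R (- t).
pose B := A + `|t|.
have i1 := integrable_scales_by1 S1 (integrable_cutoff B).
have i2 := integrable_scales_by1 (@scales_by_reflection R) i1.
have mA : measurable (`[0, A]%classic : set (measurableTypeR R)) by exact: measurable_itv.
have := integrableS measurableT mA (@subsetT _ _) (integrable_subr measurableT i1 i2).
apply: eq_integrable => //.
move=> r; rewrite inE/= in_itv/= => /andP[r0 rA]; rewrite /signal; congr EFin.
have T : - t <= `|t| by rewrite -normrN ler_norm.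
by rewrite !cutoff_ext0//; rewrite /B; lra.
Qed.

(** As chi is odd, the reflected term on [0, A] is the direct term on [-A, 0], and the two add up to
    an integral over the line; the shift r - t then moves t onto chi. The cut-off A + |t| contains
    every argument that occurs. *)
Lemma signal_pairing chi A K t : continuous chi -> (forall s, `|chi s| <= K) -> chi 0 = 0 ->
  (forall s, chi (- s) = - chi s) -> (forall s, A < `|s| -> chi s = 0) ->
  \int[mu]_(r in `[0, A]) (signal t r * chi r) = pairing (A + `|t|) chi t.
Proof.
move=> cc cK c0 cN cA.
pose B := A + `|t|.
have S1 := @scales_by_translation R (- t).
pose k r := cutoff B (r - t) * chi r.
have ik : mu.-integrable setT (EFin \o k).
  have := integrable_scales_by1 S1 (@integrable_pairing B chi K t cc cK).
  by congr (_.-integrable _ (EFin \o _)); apply/funext => r; rewrite /k subrK.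
have mk := integrable_measurable_fun ik.
have -> : pairing B chi t = \int[mu]_r k r.
  rewrite /pairing (Rintegral_scales_by1 S1); last first.
    exact: integrable_measurable_fun (@integrable_pairing B chi K t cc cK).
  by apply: eq_Rintegral => r _; rewrite /k subrK.
pose I : R -> R := \1_(`[0, A]%classic : set R).
have mI : measurable_fun setT I by apply: measurable_indic; exact: measurable_itv.
have I1 r : `|I r| <= 1 by rewrite /I indicE; case: (_ \in _); rewrite ?normr1 ?normr0.
pose k1 r := k r * I r. pose k2 r := k r * I (- r).
have dom g (b : R -> R) : mu.-integrable setT (EFin \o g) -> measurable_fun setT b ->
    (forall r, `|b r| <= 1) -> mu.-integrable setT (EFin \o (fun r => g r * b r)).
  move=> ig mb b1; apply: (@integrable_dominated _ _ _ mu setT _ (fun r => `|g r|)) => //.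
  - apply: measurable_funM => //; exact: integrable_measurable_fun ig.
  - by move=> r _; rewrite normrM ler_piMr.
  - exact: integrable_normr.
have ik1 : mu.-integrable setT (EFin \o k1) by exact: dom.
have ik2 : mu.-integrable setT (EFin \o k2).
  by apply: dom => //; apply: (measurableT_comp mI); have [] := @scales_by_reflection R.
have -> : \int[mu]_r k r = \int[mu]_r (k1 r + k2 r).
  apply: eq_Rintegral => r _; rewrite /k1 /k2 -mulrDr /k /I !indicE !mem_setE !in_itv/= oppr_ge0.
  have [rA|rA] := ltP A `|r|; first by rewrite cA// mulr0 mul0r.
  move: rA; rewrite ler_norml => /andP[rA1 rA2].
  have [r0|r0|r0] := ltgtP r 0.
  - by rewrite lerNl rA1/= add0r mulr1.
  - by rewrite rA2/= addr0 mulr1.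
  - by rewrite r0 c0 mulr0 mul0r.
rewrite RintegralD// [in X in _ + X](Rintegral_scales_by1 (@scales_by_reflection R)); last first.
  exact: integrable_measurable_fun ik2.
rewrite -RintegralD//; last exact: integrable_scales_by1 (@scales_by_reflection R) ik2.
rewrite Rintegral_mkcond; apply: eq_Rintegral => r _.
rewrite /k1 /k2 opprK /I !indicE /patch mem_setE in_itv/=.
case: ifP => [/andP[r0 rA]|_]; last by rewrite !mulr0 addr0.
have T : - t <= `|t| by rewrite -normrN ler_norm.
rewrite !mulr1 /k cN /signal !cutoff_ext0; first by ring.
- by rewrite /B; lra.
- by rewrite /B; lra.
Qed.

End radial_signal.

Lemma measurable_invr {R : realType} : measurable_fun setT (@GRing.inv R).
Proof.
rewrite (_ : @GRing.inv R = fun r => r * (r ^+ 2) `^ (-1)).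
  apply: measurable_funM => //.
  exact: (measurableT_comp (measurable_powR (-1)) (exprn_measurable 2)).
apply/funext => r; rewrite powR_inv1 ?sqr_ge0//.
have [->|r0] := eqVneq r 0; first by rewrite invr0 mul0r.
by field.
Qed.

Lemma continuous_supported_bounded {R : realType} (k : R -> R) A : continuous k ->
  (forall s, A < `|s| -> k s = 0) -> exists K, forall s, `|k s| <= K.
Proof.
move=> ck sk.
have : compact (k @` `[- A, A]).
  apply: continuous_compact; first exact: continuous_subspaceT.
  exact: segment_compact.
move=> /compact_bounded[M [_ HM]]; exists (`|M| + 1) => s.
have [sA|sA] := ltP A `|s|; first by rewrite sk// normr0 addr_ge0.
apply: (HM (`|M| + 1)); first by rewrite (le_lt_trans (ler_norm _))// ltrDl.
by exists s => //=; rewrite in_itv/= -ler_norml.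
Qed.

Section spherical_wave.
Context {R : realType}.
Notation mu := (@lebesgue_measure R).

Lemma locally_integrable_radial (f : R -> R) : measurable_fun setT f ->
  (forall A, mu.-integrable `[0, A] (EFin \o (fun r => f r * r ^+ 2))) ->
  locally_integrable3 (fun x => f (enorm x)).
Proof.
move=> mf i2 A.
pose g (r : R) := `|f r| * \1_(`[0, A]%classic : set R) r.
have mI : measurable_fun setT (\1_(`[0, A]%classic : set R) : R -> R).
  by apply: measurable_indic; exact: measurable_itv.
have mg : measurable_fun setT g.
  by apply: measurable_funM => //; exact: measurableT_comp.
have g0 r : 0 <= g r by rewrite mulr_ge0.
apply/integrableP; split.
  apply/measurable_EFinP/measurable_funTS.
  exact: (measurableT_comp mf measurable_enorm).
rewrite integral_mkcond.
apply: (@le_lt_trans _ _ (\int[leb3 R]_x (g (enorm x))%:E)%E).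
  rewrite le_eqVlt; apply/orP; left; apply/eqP; apply: eq_integral => x _.
  have xI : (enorm x \in `[0, A]%classic) = (enorm x <= A) by rewrite mem_setE in_itv/= enorm_ge0.
  rewrite /patch /g indicE xI.
  have [xA|xA] := leP (enorm x) A; first by rewrite mem_set// mulr1.
  by rewrite memNset ?mulr0//=; apply/negP; rewrite -ltNge.
rewrite polar_ge0_one//.
have iK := integrable_itvZ (3 * ball_vol) (i2 A).
have /integrableP[_] := iK; apply: le_lt_trans.
rewrite [leLHS]integral_mkcond [leRHS]integral_mkcond.
rewrite le_eqVlt; apply/orP; left; apply/eqP; apply: eq_integral => r _.
rewrite /patch /g indicE !mem_setE !in_itv/= andbT.
have [r0|//] := leP 0 r; have [rA|rA] /= := leP r A; last by rewrite mulr0 mul0r.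
have c0 : 0 <= 3 * ball_vol * r ^+ 2 by rewrite mulr_ge0 ?sqr_ge0// mulr_ge0// ball_vol_ge0.
rewrite mulr1 (_ : 3 * ball_vol * (f r * r ^+ 2) = f r * (3 * ball_vol * r ^+ 2)); last by ring.
by rewrite normrM (ger0_norm c0).
Qed.

Variable h : R -> R.
Hypotheses (mh : measurable_fun setT h)
  (ih : forall A, mu.-integrable `[0, A] (EFin \o h)).

Definition spherical_wave (t : R) (x : E3 R) : R := signal h t (enorm x) / enorm x.

Let f t (r : R) := signal h t r / r.

Let mf t : measurable_fun setT (f t).
Proof.
apply: measurable_funM; first exact: measurable_signal.
exact: measurable_invr.
Qed.

Let if2 t A : mu.-integrable `[0, A] (EFin \o (fun r => f t r * r ^+ 2)).
Proof.
have bd r : r \in `[0, A] -> `|id r| <= `|A|.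
  by rewrite in_itv/= => /andP[r0 rA]; rewrite !ger0_norm// (le_trans r0).
have := integrable_itv_mulr_bounded (integrable_signal ih t A) (@measurable_id _ _ _) bd.
have -> // : (fun r => signal h t r * id r) = (fun r => f t r * r ^+ 2).
apply/funext => r; rewrite /f /=; have [->|r0] := eqVneq r 0; first by rewrite expr0n !mulr0.
by field.
Qed.

Lemma spherical_wave_locally_integrable t : locally_integrable3 (spherical_wave t).
Proof. by apply: (@locally_integrable_radial (f t)) => // A; exact: if2. Qed.

Lemma spherical_wave_test phi A t : test_function phi -> 0 <= A -> supported A phi ->
  \int[leb3 R]_x (spherical_wave t x * phi x) = pairing h (A + `|t|) (psi phi) t.
Proof.
move=> tp A0 sp.
have [_ ->] := polar_test tp A0 sp (mf t) (if2 t A).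
have psi0 : psi phi 0 = 0 by rewrite /psi expr0n mulr0 !mul0r addr0.
have s s' := psi_supported tp A0 sp s'.
have cp := @continuous_psi R phi tp.
have ps r : A < `|r| -> psi phi r = 0 by move=> /s[].
have [K pK] := continuous_supported_bounded cp ps.
rewrite -(@signal_pairing R h ih (psi phi) A K)//; last by move=> r; exact: psiN.
apply: eq_Rintegral => r _; rewrite /f; have [->|r0] := eqVneq r 0; first by rewrite psi0 !mulr0.
by rewrite divfK.
Qed.

(** Tested against phi, the wave is the pairing of h with psi phi. Two derivatives in t replace psi
    phi by its second derivative, which is psi of the Laplacian, and that pairing is the wave tested
    against the Laplacian. The initial velocity is the pairing with psi' phi at t = 0. *)
Lemma free_wave_spherical (u0 : E3 R -> R) (u1 : distribution3) :
  (forall phi, test_function phi ->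
    \int[leb3 R]_x (h (enorm x) / enorm x * phi x) = \int[leb3 R]_x (u0 x * phi x)) ->
  (forall phi, test_function phi -> exists A0, forall A, A0 <= A ->
    u1 phi = \int[mu]_(r in `[0, A]) (h r * psi' phi r)) ->
  free_wave u0 u1 spherical_wave.
Proof.
move=> H0 H1; split; first exact: spherical_wave_locally_integrable.
move=> phi tp; have [A [A0 sp sL _]] := test_function_supported tp.
have tL := test_function_laplacian tp.
have s s' := psi_supported tp A0 sp s'.
have ps r : A < `|r| -> psi phi r = 0 by move=> /s[].
have ps' r : A < `|r| -> psi' phi r = 0 by move=> /s[].
have pL r : A < `|r| -> psi (laplacian phi) r = 0 by move=> /(psi_supported tL A0 sL)[].
have [K pK] := continuous_supported_bounded (@continuous_psi R phi tp) ps.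
have [K' pK'] := continuous_supported_bounded (@continuous_psi' R phi tp) ps'.
have [K'' pK''] := continuous_supported_bounded (@continuous_psi R _ tL) pL.
set m := fun t : R => \int[leb3 R]_x (spherical_wave t x * phi x).
(* The margin 1 lets a single cut-off serve for all t near t0, so that derivatives are taken with
   the cut-off fixed. *)
have near1 (t0 : R) : \forall t \near t0, A + `|t| <= A + `|t0| + 1.
  near=> t; rewrite -addrA lerD2l.
  have : `|t - t0| <= 1 by rewrite distrC; near: t; exact: near_dist_le.
  by have := lerB_normD t (- t0); rewrite normrN; lra.
have dm (t0 B : R) : A + `|t0| + 1 <= B -> is_derive t0 (1 : R) m (pairing h B (psi' phi) t0).
  move=> hB; have D := is_derive_pairing ih B t0
    (fun s => is_derive_psi s tp) pK pK'.
  apply: (near_eq_is_derive _ D); near=> t.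
  have AB : A + `|t| <= B by apply: le_trans hB; near: t; exact: near1.
  transitivity (pairing h (A + `|t|) (psi phi) t); first exact (pairing_indep h ps AB (lexx _)).
  exact (esym (spherical_wave_test t tp A0 sp)).
have dm1 t0 : derive1 m t0 = pairing h (A + `|t0| + 1) (psi' phi) t0.
  by rewrite derive1E; have [_ ->] := dm t0 _ (lexx _).
have ddm t0 : is_derive t0 (1 : R) (derive1 m) (pairing h (A + `|t0| + 1) (psi (laplacian phi)) t0).
  have D := is_derive_pairing ih (A + `|t0| + 1) t0
    (fun s => is_derive_psi' s tp) pK' pK''.
  apply: (near_eq_is_derive _ D); near=> t.
  have AB : A + `|t| <= A + `|t0| + 1 by near: t; exact: near1.
  have AB' : A + `|t| <= A + `|t| + 1 by rewrite lerDl.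
  transitivity (pairing h (A + `|t| + 1) (psi' phi) t); first exact (pairing_indep h ps' AB AB').
  exact (esym (dm1 t)).
split.
- rewrite -H0//; apply: eq_Rintegral => x _; congr (_ * _).
  rewrite /spherical_wave /signal /ext0 !subr0 enorm_ge0 oppr_ge0.
  (* At time 0 the reflected term can be nonzero only at x = 0, where division by 0 makes both sides
     vanish. *)
  have := enorm_ge0 x; rewrite le_eqVlt => /predU1P[<-|x0]; first by rewrite invr0 !mulr0.
  by rewrite leNgt x0 subr0.
- have [B0 HB] := H1 phi tp.
  pose B := Num.max B0 (A + 1).
  have BB0 : B0 <= B by rewrite /B le_max lexx.
  rewrite (HB B BB0).
  have hB : A + `|0 : R| + 1 <= B by rewrite normr0 addr0 /B le_max lexx orbT.
  rewrite derive1E; have [_ ->] := dm 0 B hB.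
  apply: etrans (esym (Rintegral_mkcond _ _ _)).
  apply: eq_Rintegral => r _; rewrite addr0.
  move: (psi' phi) => k; rewrite /cutoff /patch; case: ifP => _ //.
  exact: mul0r.
- move=> t; split.
  + by have [] := dm t _ (lexx _).
  + by have [] := ddm t.
  + rewrite (derive1E (derive1 m)); have [_ ->] := ddm t.
    transitivity (pairing h (A + `|t|) (psi (laplacian phi)) t).
      by apply: (pairing_indep h pL); [rewrite lerDl|exact: lexx].
    exact (esym (spherical_wave_test t tL A0 sL)).
Unshelve. all: by end_near. Qed.

End spherical_wave.

(** * The solution *)

Section radial_norms.
Context {R : realType}.
Notation mu := (@lebesgue_measure R).

(** The unit ball contains a cube of side 1, as three times 1/4 is less than 1. *)
Lemma ball_vol_gt0 : 0 < @ball_vol R.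
Proof.
have I1 : @lebesgue_measure R `[(- 2^-1)%R, 2^-1%R]%classic = 1%E.
  rewrite lebesgue_measure_itv/= lte_fin ifT; last by lra.
  by rewrite -EFinB; congr EFin; lra.
have mI : measurable (`[(- 2^-1)%R, 2^-1%R]%classic : set (measurableTypeR R)).
  exact: measurable_itv.
have B1 : leb3 R (box 2^-1) = 1%E.
  rewrite -[LHS]/((leb2 \x mu)%E _) product_measure1E//; last exact: measurableX.
  rewrite -[X in (X * _)%E]/((mu \x mu)%E _) product_measure1E//.
  by rewrite [X in (X * X * X)%E]I1 !mule1.
have sub : box 2^-1 `<=` @eball R 1.
  move=> x /boxE[x1 x2 x3]; rewrite /eball/=.
  rewrite -[X in _ <= X](@sqrtr1 R) /enorm ler_sqrt// /dot3.
  have S (a : R) : `|a| <= 2^-1 -> a * a <= 4^-1.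
    by rewrite ler_norml => /andP[h1 h2]; nra.
  by have := S _ x1; have := S _ x2; have := S _ x3; lra.
have : (1 <= leb3 R (eball 1))%E.
  rewrite -B1; apply: le_measure; rewrite ?inE//.
  - exact: measurable_box.
  - exact: measurable_eball.
by rewrite leb3_eball// expr1n mulr1 lee_fin; apply: lt_le_trans.
Qed.

Variable N : R.
Hypothesis N0 : 0 < N.

(* At [x = 0], [t = 0] the junk value of the division gives 0. *)
Definition delayed_over_r (v : R -> R) (t : R) (x : E3 R) : R :=
  if t <= enorm x then v (enorm x - t) / enorm x else 0.

(** With r = b + t, the integrand |v / r|^(N+2) r^2 is r^-N |v|^(N+2); the factor N + 2 undoes the
    normalization of [pot]. Thus the energy of the transported problem is the norm of u up to a
    constant independent of t. *)
Lemma radial_norm (v : R -> R) t : measurable_fun setT v -> 0 <= t ->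
  (\int[leb3 R]_x (`|delayed_over_r v t x| `^ (N + 2))%:E =
   (3 * ball_vol * (N + 2))%:E *
     \int[mu]_(b in `[0%R, +oo[) (wt N (b + t) * pot N (v b))%:E)%E.
Proof.
move=> mv t0.
pose f r := `|if t <= r then v (r - t) / r else 0| `^ (N + 2).
have mt : measurable_fun setT (fun r : R => r - t) by have [] := @scales_by_translation R (- t).
have mq : measurable_fun setT (fun r : R => v (r - t) / r).
  by apply: measurable_funM; [exact: (measurableT_comp mv mt)|exact: measurable_invr].
have mf : measurable_fun setT f.
  apply: (measurableT_comp (measurable_powR (N + 2))); apply: (@measurableT_comp _ _ _ _ _ _ (@Num.norm _ R)) => //.
  apply: measurable_fun_ifT => //.
  exact: measurable_fun_ler.
have f0 r : 0 <= f r by exact: powR_ge0.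
rewrite (polar_ge0_one mf f0).
have k0 : 0 <= 3 * @ball_vol R * (N + 2).
  by apply: mulr_ge0; [rewrite mulr_ge0// ltW// ball_vol_gt0|rewrite addr_ge0// ltW].
pose g b := (wt N (b + t) * pot N (v b))%:E.
have g0 b : (0 <= g b)%E by rewrite lee_fin mulr_ge0 ?wt_ge0 ?pot_ge0.
have mg : measurable_fun setT g.
  apply/measurable_EFinP; apply: measurable_funM.
    apply: (measurableT_comp (measurable_wt N)).
    by have [] := @scales_by_translation R t.
  apply: (measurableT_comp _ mv).
  by apply: continuous_measurable_fun; exact: pot_continuous.
rewrite -ge0_integralZl_EFin//; last 2 first.
- by move=> b _; exact: g0.
- exact: (measurable_funTS mg).
have mG : measurable_fun setT
    (((fun r : R => (f r * (3 * ball_vol * r ^+ 2))%:E) \_ `[0, +oo[)).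
  apply/(measurable_restrictT _ _).1; first exact: measurable_itv.
  apply: measurable_funTS; apply/measurable_EFinP; apply: measurable_funM => //.
  by apply: measurable_funM => //; exact: exprn_measurable.
rewrite [LHS]integral_mkcond.
rewrite (scales_by_ge0_integral ler01 (@scales_by_translation R t) mG); last first.
  move=> r; rewrite /patch; case: ifP => // _; rewrite lee_fin mulr_ge0//.
  by rewrite mulr_ge0 ?sqr_ge0// mulr_ge0// ltW// ball_vol_gt0.
rewrite mul1e [RHS]integral_mkcond; apply: eq_integral => b _.
rewrite /patch !mem_setE !in_itv/= !andbT /f.
have [b0|b0] := leP 0 b; last first.
  case: ifP => // bt; rewrite ifF; last by apply/negbTE; rewrite -ltNge; lra.
  by rewrite normr0 powR0 ?mul0r// gt_eqF// addr_gt0.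
rewrite ifT; last by lra.
rewrite ifT; last by lra.
rewrite addrK /g -EFinM; congr EFin; rewrite /wt /pot.
have N2 : N + 2 != 0 by rewrite gt_eqF// addr_gt0.
have : 0 <= b + t by lra.
rewrite le_eqVlt => /predU1P[<-|r0].
  by rewrite expr0n mulr0 mulr0 powR0 ?gt_eqF// invr0 mul0r mulr0.
set r := b + t in r0 *.
rewrite normrM powRM// normrV ?unitfE ?gt_eqF// (gtr0_norm r0).
rewrite -(powR_inv1 (ltW r0)) -powRrM mulN1r.
have -> : r `^ (- (N + 2)) = (r `^ N)^-1 * (r ^+ 2)^-1.
  by rewrite powRN -(powR_mulrn 2 (ltW r0)) -invfM -powRD// (gt_eqF r0) implybT.
by field; rewrite N2 gt_eqF ?powR_gt0//= gt_eqF.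
Qed.

End radial_norms.

(** * Radial and outgoing initial data *)

Section initial_data.
Context {R : realType}.
Notation mu := (@lebesgue_measure R).
Variables (N : R) (u0 : E3 R -> R).
Hypotheses (N0 : 0 < N) (mu0 : measurable_fun setT u0) (ru0 : radial u0).
Hypothesis fin0 : (\int[leb3 R]_x (`|u0 x| `^ (N + 2))%:E < +oo)%E.

Definition radial_data (r : R) : R := r * profile u0 r.

Lemma radial_profile (F : E3 R -> R) x : radial F -> F x = profile F (enorm x).
Proof.
move=> rF; apply: rF; rewrite [RHS]/enorm /dot3/= !mulr0 !addr0 -expr2 sqrtr_sqr.
by rewrite ger0_norm// enorm_ge0.
Qed.

Lemma measurable_profile (F : E3 R -> R) : measurable_fun setT F -> measurable_fun setT (profile F).
Proof.
move=> mF; apply: (measurableT_comp mF).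
apply/measurable_fun_pairP; split; last exact: measurable_cst.
by apply/measurable_fun_pairP; split; [exact: measurable_id|exact: measurable_cst].
Qed.

Let v0 := radial_data.

Lemma measurable_radial_data : measurable_fun setT v0.
Proof. by apply: measurable_funM => //; exact: measurable_profile. Qed.

Lemma radial_data0 : v0 0 = 0. Proof. by rewrite /v0 /radial_data mul0r. Qed.

Lemma radial_dataE x : enorm x != 0 -> u0 x = v0 (enorm x) / enorm x.
Proof.
by move=> x0; rewrite (radial_profile x ru0) /v0 /radial_data mulrAC divff// mul1r.
Qed.

Lemma ae_radial_data (P : E3 R -> Prop) :
  (forall x, u0 x = v0 (enorm x) / enorm x -> P x) -> {ae leb3 R, forall x, P x}.
Proof.
move=> HP; exists [set x | enorm x = 0]; split.
- rewrite (_ : [set x | _] = setT `&` (@enorm R) @^-1` [set 0]); last by rewrite setTI.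
  exact: measurable_enorm.
- exact: leb3_sphere.
- by move=> x /= nx; apply/eqP; apply: contra_notT nx => /radial_dataE /HP.
Qed.

Lemma delayed_over_r0 v x : delayed_over_r v 0 x = v (enorm x) / enorm x :> R.
Proof. by rewrite /delayed_over_r enorm_ge0 subr0. Qed.

Lemma measurable_radial_data_over_r :
  measurable_fun setT (fun x : E3 R => v0 (enorm x) / enorm x).
Proof.
apply: measurable_funM; first exact: (measurableT_comp measurable_radial_data measurable_enorm).
exact: (measurableT_comp measurable_invr measurable_enorm).
Qed.

Lemma radial_data_norm :
  (\int[leb3 R]_x (`|u0 x| `^ (N + 2))%:E = (3 * ball_vol * (N + 2))%:E *
     \int[mu]_(b in `[0%R, +oo[) (wt N b * pot N (v0 b))%:E)%E.
Proof.
have := radial_norm N0 measurable_radial_data (lexx 0).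
under [in RHS]eq_integral do rewrite addr0.
move=> <-; apply: ae_eq_integral => //.
- apply/measurable_EFinP; apply: (measurableT_comp (measurable_powR (N + 2))).
  exact: measurableT_comp.
- apply/measurable_EFinP; apply: (measurableT_comp (measurable_powR (N + 2))).
  apply: measurableT_comp => //; rewrite (_ : delayed_over_r _ _ = fun x => v0 (enorm x) / enorm x).
    exact: measurable_radial_data_over_r.
  by apply/funext => x; rewrite delayed_over_r0.
- apply: ae_radial_data => x ux _.
  by rewrite delayed_over_r0 -ux.
Qed.

Lemma integrable_radial_energy :
  mu.-integrable `[0, +oo[ (EFin \o (fun b => wt N b * pot N (v0 b))).
Proof.
have g0 b : 0 <= wt N b * pot N (v0 b) by apply: mulr_ge0; [exact: wt_ge0|exact: pot_ge0].
apply/integrableP; split.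
  apply/measurable_EFinP; apply: measurable_funTS; apply: measurable_funM.
    exact: measurable_wt.
  apply: (measurableT_comp _ measurable_radial_data).
  by apply: continuous_measurable_fun; exact: pot_continuous.
under eq_integral do rewrite /= ger0_norm//.
have k0 : 0 < 3 * @ball_vol R * (N + 2).
  by rewrite mulr_gt0 ?addr_gt0// mulr_gt0// ball_vol_gt0.
have := fin0; rewrite radial_data_norm.
move: (\int[_]_(_ in _) _)%E => -[r _|//|//]; first by rewrite ltry.
by rewrite gt0_muley ?lte_fin.
Qed.

(** The threshold for a = |v0 b| is b^(N/(N+1)): above it a^(N+1) >= b^N, so a <= a^(N+2) / b^N, a
    multiple of the energy density; below it a is bounded on [0, A]. *)
Lemma integrable_radial_data A : mu.-integrable `[0, A] (EFin \o v0).
Proof.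
pose D (b : R) := (N + 2) * (wt N b * pot N (v0 b)) + (1 + `|A|) `^ (N / (N + 1)).
apply: (@integrable_dominated _ _ _ mu `[0, A] _ D).
- exact: measurable_itv.
- apply: measurable_funTS; exact: measurable_radial_data.
- move=> b /=; rewrite in_itv/= => /andP[b0 bA].
  have C0 : 0 <= (1 + `|A|) `^ (N / (N + 1)) by exact: powR_ge0.
  have g0 b' : 0 <= wt N b' * pot N (v0 b') by apply: mulr_ge0; [exact: wt_ge0|exact: pot_ge0].
  have N2 : 0 < N + 2 by rewrite addr_gt0.
  move: b0; rewrite le_eqVlt => /predU1P[<-|b0].
    by rewrite radial_data0 normr0 /D addr_ge0// mulr_ge0// ltW.
  rewrite /D; set a := `|v0 b|.
  have [ab|ba] := leP a (b `^ (N / (N + 1))).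
    apply: (le_trans ab); apply: (@le_trans _ _ ((1 + `|A|) `^ (N / (N + 1)))).
      apply: ge0_ler_powR; rewrite ?nnegrE ?addr_ge0 ?(ltW b0)//.
        by rewrite divr_ge0// ltW// addr_gt0.
      by rewrite (le_trans bA)// (le_trans (ler_norm _))// lerDr.
    by rewrite lerDr mulr_ge0// ltW.
  have a0 : 0 < a by rewrite (le_lt_trans _ ba)// powR_ge0.
  apply: (@le_trans _ _ ((N + 2) * (wt N b * pot N (v0 b)))); last by rewrite lerDl.
  have -> : (N + 2) * (wt N b * pot N (v0 b)) = a `^ (N + 2) / b `^ N.
    by rewrite /wt /pot -/a; field; rewrite !gt_eqF// powR_gt0.
  rewrite ler_pdivlMr ?powR_gt0//.
  have -> : a `^ (N + 2) = a * a `^ (N + 1).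
    rewrite (_ : N + 2 = 1 + (N + 1)); last by ring.
    have h : (1 + (N + 1) == 0) ==> (a != 0) by rewrite (gt_eqF a0) implybT.
    by rewrite (powRD h) powRr1 ?(ltW a0).
  rewrite ler_pM2l//.
  have -> : b `^ N = (b `^ (N / (N + 1))) `^ (N + 1).
    by rewrite -powRrM divfK// gt_eqF// addr_gt0.
  by apply: ge0_ler_powR; rewrite ?nnegrE ?powR_ge0 ?(ltW ba) ?(ltW a0)// addr_ge0// ltW.
- apply: integrable_itvD; last exact: integrable_itv_cst.
  apply: integrable_itvZ; apply: integrable_itvS integrable_radial_energy.
  by apply: subset_itvl; rewrite bnd_simp.
Qed.

Lemma radial_data_pairing phi : test_function phi ->
  \int[leb3 R]_x (v0 (enorm x) / enorm x * phi x) = \int[leb3 R]_x (u0 x * phi x).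
Proof.
move=> tp; have mphi := continuous_measurable_E3 (test_function_continuous tp).
congr fine; apply: ae_eq_integral => //.
- apply/measurable_EFinP; apply: measurable_funM => //.
  exact: measurable_radial_data_over_r.
- by apply/measurable_EFinP; exact: measurable_funM.
- by apply: ae_radial_data => x ux _; rewrite -ux.
Qed.

(** The condition reads u1 = - (u0)_r - u0/r. Transposed onto phi, this is the integral of (u0/r) (x
    . grad phi + phi): one of the two terms 2 phi / r cancels against u0/r. Since u0/r is v0/r^2,
    [polar_euler] gives the pairing of v0 with psi' phi. *)
Lemma outgoing_pairing (u1 : distribution3) :
  (forall phi, test_function phi -> Pminus1 u0 u1 phi = 0) ->
  forall phi, test_function phi -> exists A0, forall A, A0 <= A ->
    u1 phi = \int[mu]_(r in `[0, A]) (v0 r * psi' phi r).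
Proof.
move=> Hout phi tp.
have [A0 [A00 s0 _ sE0]] := test_function_supported tp.
exists A0 => A A0A; have A0' : 0 <= A by exact: le_trans A0A.
have sp := supported_le A0A s0; have sE := supported_le A0A sE0.
pose f r := v0 r / r ^+ 2.
have mf : measurable_fun setT f.
  apply: measurable_funM; first exact: measurable_radial_data.
  exact: (measurableT_comp measurable_invr (exprn_measurable 2)).
have f2 r : f r * r ^+ 2 = v0 r.
  rewrite /f; have [->|r0] := eqVneq r 0; first by rewrite radial_data0 !mul0r.
  by rewrite divfK// expf_eq0.
have if2 : mu.-integrable `[0, A] (EFin \o (fun r => f r * r ^+ 2)).
  by rewrite (_ : (fun r => _) = v0); [exact: integrable_radial_data|exact/funext].
have fu x : f (enorm x) = u0 x / enorm x.
  rewrite /f /v0 /radial_data -radial_profile//.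
  have [->|x0] := eqVneq (enorm x) 0; first by rewrite mul0r mul0r invr0 mulr0.
  by field.
have [I1 E1] := polar_euler tp A0' sp sE mf if2.
have [I2 _] := polar_test tp A0' sp mf if2.
have := Hout phi tp; rewrite /Pminus1 /dist_radial_deriv /dist_over_r /dist_of.
have dE x : radial_deriv phi x = (enorm x)^-1 * 'D_x phi x.
  have dx : derivable phi x x by exact: test_function_derivable.
  by have [] := is_derive_dirZ (enorm x)^-1 dx.
have S : \int[leb3 R]_x (u0 x * (radial_deriv phi x + 2 * phi x / enorm x)) =
    \int[leb3 R]_x (f (enorm x) * ('D_x phi x + phi x)) + \int[leb3 R]_x (f (enorm x) * phi x).
  rewrite -RintegralD//; apply: eq_Rintegral => x _; rewrite dE fu.
  move: ('D_x phi x) => d; ring.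
have S2 : \int[leb3 R]_x (u0 x / enorm x * phi x) = \int[leb3 R]_x (f (enorm x) * phi x).
  by apply: eq_Rintegral => x _; rewrite fu.
rewrite S S2 E1 => /eqP; rewrite mulf_eq0 invr_eq0 pnatr_eq0 orbF => /eqP H.
have -> : \int[mu]_(r in `[0, A]) (v0 r * psi' phi r) =
    \int[mu]_(r in `[0, A]) (f r * r ^+ 2 * psi' phi r).
  by apply: eq_Rintegral => r _; rewrite f2.
by move: H; lra.
Qed.

End initial_data.

(** * The wave generated by an outgoing source *)

Section source_wave.
Context {R : realType}.
Notation mu := (@lebesgue_measure R).
Variable F : E3 R -> R.
Hypotheses (rF : radial F) (mpF : measurable_fun setT (profile F)).
Hypothesis ig : forall A, mu.-integrable `[0, A] (EFin \o (fun rho => rho * profile F rho)).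

(** This is r times the first component of P_+(0, F). *)
Definition source_data (r : R) : R :=
  - (1 / 2) * \int[mu]_(rho in `[0, r]) (rho * profile F rho).

Let mg : measurable_fun setT (fun rho : R => rho * profile F rho).
Proof. exact: measurable_funM. Qed.

Lemma measurable_source_data : measurable_fun setT source_data.
Proof. by apply: measurable_funM => //; exact: measurable_primitive. Qed.

Lemma integrable_source_data A : mu.-integrable `[0, A] (EFin \o source_data).
Proof.
apply: (@integrable_itv_bounded R 0 A
  (\int[mu]_(rho in `[0, A]) `|rho * profile F rho|)).
  exact: measurable_funTS measurable_source_data.
move=> r; rewrite in_itv/= => /andP[r0 rA].
have ir : mu.-integrable `[0, r] (EFin \o (fun rho => rho * profile F rho)) by exact: ig.
have S : \int[mu]_(rho in `[0, r]) `|rho * profile F rho| <=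
    \int[mu]_(rho in `[0, A]) `|rho * profile F rho|.
  rewrite [leRHS](@Rintegral_split R (fun rho => `|rho * profile F rho|) r A) ?r0//.
    by rewrite lerDl; exact: Rintegral_ge0.
  exact: integrable_itv_norm (ig A).
rewrite /source_data normrM.
apply: (@le_trans _ _ `|\int[mu]_(rho in `[0, r]) (rho * profile F rho)|).
  by rewrite ler_piMl// normrN ger0_norm; lra.
apply: le_trans S; apply: le_trans (le_normr_Rintegral _ ir) _ => //.
Qed.

(** The second component of P_+(0, F) is F/2, whose pairing with phi is half the integral of rho F
    psi. Exchanging the triangle in the pairing of [source_data] with psi' gives the same: the
    integral of psi' over [rho, A] is - psi(rho), because psi vanishes at A. *)
Lemma source_pairing phi : test_function phi -> exists A0, forall A, A0 <= A ->
  Pplus1 (cst 0) (dist_of F) phi = \int[mu]_(r in `[0, A]) (source_data r * psi' phi r).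
Proof.
move=> tp; have [A0 [A00 s0 _ _]] := test_function_supported tp.
(* [psi phi] is known to vanish only strictly beyond the support radius; the margin makes psi phi A
   = 0. *)
exists (A0 + 1) => A A0A; have A0A' : A0 < A by lra.
have AA : 0 <= A by lra.
have sp := supported_le (ltW A0A') s0.
have z0 (x : E3 R) : 0 * (radial_deriv phi x + 2 * phi x / enorm x) = 0 by rewrite mul0r.
have E1 : dist_radial_deriv (cst 0) phi = 0.
  rewrite /dist_radial_deriv; under eq_Rintegral do rewrite mul0r.
  by rewrite /Rintegral integral0 oppr0.
have E2 : dist_over_r (cst 0) phi = 0.
  rewrite /dist_over_r /dist_of; under eq_Rintegral do rewrite !mul0r.
  by rewrite /Rintegral integral0.
rewrite /Pplus1 E1 E2 subr0 oppr0 add0r.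
have if2 : mu.-integrable `[0, A] (EFin \o (fun r => profile F r * r ^+ 2)).
  have bd r : r \in `[0, A] -> `|id r| <= `|A|.
    by rewrite in_itv/= => /andP[r0 rA]; rewrite !ger0_norm// (le_trans r0).
  have := integrable_itv_mulr_bounded (ig A) (@measurable_id _ _ _) bd.
  have -> // : (fun r => r * profile F r * id r) = (fun r => profile F r * r ^+ 2).
  by apply/funext => r /=; ring.
have [_ E] := polar_test tp AA sp mpF if2.
have -> : dist_of F phi = \int[mu]_(r in `[0, A]) (profile F r * r * psi phi r).
  by rewrite -E /dist_of; apply: eq_Rintegral => x _; rewrite (radial_profile x rF).
have psiA : psi phi A = 0.
  by have [] := psi_supported tp A00 s0 (s := A) _; rewrite // ger0_norm.
have cp' := @continuous_psi' R phi tp.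
have s1 s' := psi_supported tp A00 s0 s'.
have [K' pK'] := continuous_supported_bounded cp' (fun r rA => (s1 r rA).2).
have [K pK] := continuous_supported_bounded (@continuous_psi R phi tp) (fun r rA => (s1 r rA).1).
have ip' : mu.-integrable `[0, A] (EFin \o psi' phi).
  apply: continuous_compact_integrable; first exact: segment_compact.
  exact: continuous_subspaceT.
have Tri := Rintegral_triangle ip' (ig A).
have cs : \int[mu]_(r in `[0, A]) (source_data r * psi' phi r) =
    - (1 / 2) * \int[mu]_(x in `[0, A]) (psi' phi x * \int[mu]_(y in `[0, x]) (y * profile F y)).
  rewrite -RintegralZl//.
    by apply: eq_Rintegral => r _; rewrite /source_data mulrAC mulrA.
  have mp' : measurable_fun `[0, A] (psi' phi).
    exact: measurable_funTS (continuous_measurable_fun cp').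
  have := integrable_itvZ (-2) (integrable_itv_mulr_bounded (integrable_source_data A) mp'
    (fun s _ => pK' s)).
  congr (_.-integrable _ (EFin \o _)); apply/funext => r; rewrite /source_data.
  by move: (\int[_]_(_ in _) _) (psi' phi r) => z k; field.
rewrite cs Tri.
have inner y : y \in `[0, A] -> \int[mu]_(x in `[y, A]) psi' phi x = - psi phi y.
  rewrite in_itv/= => /andP[y0 yA].
  rewrite /Rintegral (integral_derive (fun s => is_derive_psi s tp) cp' yA)/=.
  by rewrite psiA sub0r.
transitivity (- (1 / 2) * \int[mu]_(y in `[0, A]) (- (profile F y * y * psi phi y))).
  have iz : mu.-integrable `[0, A] (EFin \o (fun r => profile F r * r * psi phi r)).
    have mps : measurable_fun `[0, A] (psi phi).
      exact: measurable_funTS (continuous_measurable_fun (@continuous_psi R phi tp)).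
    have := integrable_itv_mulr_bounded (ig A) mps (fun s _ => pK s).
    congr (_.-integrable _ (EFin \o _)); apply/funext => r.
    by rewrite [r * _]mulrC.
  rewrite (_ : (fun y => - _) = (fun y => -1 * (profile F y * y * psi phi y))).
    by rewrite RintegralZl//; field.
  by apply/funext => y; rewrite mulN1r.
congr (_ * _); apply: eq_Rintegral => y; rewrite inE/= => yA.
by rewrite inner// mulrN; congr (- (_ * _)); rewrite mulrC.
Qed.

Lemma source_free_wave : free_wave (Pplus0 (cst 0) (radial_avg F))
  (Pplus1 (cst 0) (dist_of F)) (spherical_wave source_data).
Proof.
apply: free_wave_spherical => //.
- exact: measurable_source_data.
- exact: integrable_source_data.
- move=> phi tp; apply: eq_Rintegral => x _; congr (_ * _).
  rewrite /Pplus0 /radial_avg /source_data /=.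
  by move: (\int[_]_(_ in _) _) (enorm x)^-1 => z i; field.
- exact: source_pairing.
Qed.

End source_wave.

(** * From the transported equation to the integral equation on space *)

Section global_solution.
Context {R : realType}.
Notation mu := (@lebesgue_measure R).
Variables (N : R) (V : R -> R -> R).
Hypothesis N0 : 0 < N.
Hypothesis mV : measurable_fun setT (fun p : measurableTypeR R * measurableTypeR R => V p.1 p.2).
Hypothesis iV : forall s a, 0 < s ->
  mu.-integrable `[0, a] (EFin \o (fun b => wt N (b + s) * nl N (V s b))).

Definition flux (s a : R) : R := \int[mu]_(b in `[0, a]) (wt N (b + s) * nl N (V s b)).

(* [V t a] is [r u(t, r)] at [r = a + t]. *)
Definition evolved (t : R) : E3 R -> R := delayed_over_r (V t) t.

Lemma flux_neg s a : a < 0 -> flux s a = 0.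
Proof.
move=> a0; rewrite /flux (_ : [set` `[0, a]] = set0) ?Rintegral_set0//.
by rewrite set_itv_ge// bnd_simp -ltNge.
Qed.

Lemma radial_evolved t : radial (evolved t).
Proof. by move=> x y xy; rewrite /evolved /delayed_over_r xy. Qed.

Let mVt t : measurable_fun setT (V t).
Proof.
exact: (measurableT_comp mV (@pair1_measurable _ _ (measurableTypeR R) (measurableTypeR R) t)).
Qed.

Let mVcomp {d : measure_display} {X : measurableType d} (f g : X -> measurableTypeR R) :
  measurable_fun setT f -> measurable_fun setT g -> measurable_fun setT (fun x => V (f x) (g x)).
Proof.
move=> mf mg.
have mfg : measurable_fun setT (fun x => (f x, g x)) by apply/measurable_fun_pairP.
exact: (measurableT_comp mV mfg).
Qed.

Lemma measurable_evolved_uncurry :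
  measurable_fun setT (fun p : measurableTypeR R * E3 R => evolved p.1 p.2).
Proof.
have m2 : measurable_fun setT (fun p : measurableTypeR R * E3 R => enorm p.2).
  exact: (measurableT_comp measurable_enorm measurable_snd).
have m1 : measurable_fun setT (fun p : measurableTypeR R * E3 R => p.1 : R) by exact: measurable_fst.
apply: measurable_fun_ifT => //; first exact: measurable_fun_ler.
apply: measurable_funM; last exact: (measurableT_comp measurable_invr m2).
by apply: mVcomp => //; exact: measurable_funB.
Qed.

Lemma measurable_evolved t : measurable_fun setT (evolved t).
Proof. exact: (measurableT_comp measurable_evolved_uncurry (@pair1_measurable _ _ _ _ t)). Qed.

Let F s := nonlinearity N (evolved s).

Let mF s : measurable_fun setT (F s).
Proof.
apply: (measurableT_comp (f := nl N) _ (measurable_evolved s)).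
by apply: continuous_measurable_fun; exact: nl_continuous.
Qed.

Let rF s : radial (F s).
Proof. by move=> x y xy; rewrite /F /nonlinearity (radial_evolved s xy). Qed.

Let k s b := wt N (b + s) * nl N (V s b).

(** With u = V / rho, rho |u|^N u becomes rho^-N |V|^N V, and the argument rho - s of V places the
    weight at b + s = rho. Inside the cone rho < s the source is zero. *)
Let profile_F s rho : 0 < s -> 0 <= rho ->
  rho * profile (F s) rho = if s <= rho then k s (rho - s) else 0.
Proof.
move=> s0 r0; rewrite /profile /F /nonlinearity -/(nl N _) /evolved /delayed_over_r.
have -> : enorm (rho, 0, 0) = rho.
  by rewrite /enorm /dot3/= !mulr0 !addr0 -expr2 sqrtr_sqr ger0_norm.
case: ifP => [sr|_]; last by rewrite /nl mulr0 mulr0.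
have rp : 0 < rho by exact: lt_le_trans sr.
rewrite /k subrK /wt /nl normrM normrV ?unitfE ?gt_eqF// (gtr0_norm rp).
rewrite powRM// ?invr_ge0 ?(ltW rp)// -(powR_inv1 (ltW rp)) -powRrM mulN1r powRN.
rewrite powR_inv1 ?(ltW rp)//.
by field; rewrite !gt_eqF// powR_gt0.
Qed.

Let cut s A rho : 0 < s -> 0 <= rho <= A ->
  rho * profile (F s) rho = cutoff (k s) (A - s) (rho - s).
Proof.
move=> s0 /andP[r0 rA]; rewrite profile_F// /cutoff /patch mem_setE in_itv/=.
by rewrite subr_ge0 lerD2r rA andbT.
Qed.

Lemma integrable_source s A : 0 < s ->
  mu.-integrable `[0, A] (EFin \o (fun rho => rho * profile (F s) rho)).
Proof.
move=> s0; have mA : measurable (`[0, A]%classic : set (measurableTypeR R)) by exact: measurable_itv.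
have i1 := integrable_scales_by1 (@scales_by_translation R (- s))
  (integrable_cutoff (fun a => iV a s0) (A - s)).
have := integrableS measurableT mA (@subsetT _ _) i1.
apply: eq_integrable => //.
by move=> r; rewrite inE/= in_itv/= => rA; rewrite (cut s0 rA).
Qed.

Lemma source_data_flux s r : 0 < s -> source_data (F s) r = - (1 / 2) * flux s (r - s).
Proof.
move=> s0; rewrite /source_data; congr (_ * _).
have mc : measurable_fun setT (cutoff (k s) (r - s)).
  by apply: measurable_cutoff => a; exact: iV.
rewrite /flux [RHS]Rintegral_mkcond -/(k s) -/(cutoff (k s) (r - s)).
rewrite (Rintegral_scales_by1 (@scales_by_translation R (- s)) mc).
rewrite Rintegral_mkcond; apply: eq_Rintegral => b _.
rewrite /patch mem_setE in_itv/=; case: ifP => [/cut->//|].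
rewrite /cutoff /patch mem_setE in_itv/= subr_ge0 lerD2r => nb.
case: ifP => // /andP[sb br]; move: nb; rewrite br andbT => /negbT.
by rewrite -ltNge => b0; have := lt_trans b0 s0; rewrite ltNge sb.
Qed.

(** The contribution at time t of the source emitted at time s. Travelling outwards for the time t -
    s, the signal is read at r - t whatever s is, which turns the Duhamel integral at x into one in
    time at the fixed characteristic a = |x| - t. *)
Definition flux_over_r (t s : R) (x : E3 R) : R :=
  if t <= enorm x then - (1 / 2) * flux s (enorm x - t) / enorm x else 0.

(* At the null time s = 0 no source integrability is available; the value there is
   chosen to make [source_wave_eq] uniform in s. *)
Definition source_wave (s t : R) : E3 R -> R :=
  if 0 < s then spherical_wave (source_data (F s)) t else flux_over_r (s + t) s.

(** The data of the source emitted at time s vanish for radii below s. At time t - s later the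
    direct term is therefore supported in r >= t, and the reflected term, which would be read at a
    negative radius, is zero. *)
Lemma source_wave_eq s t x : 0 <= s <= t -> source_wave s (t - s) x = flux_over_r t s x.
Proof.
move=> /andP[s0 st]; rewrite /source_wave; case: ifP => [sp|/negbT]; last first.
  by rewrite -leNgt => s0'; rewrite addrC subrK.
rewrite /spherical_wave /flux_over_r /signal /ext0 !source_data_flux//.
set r := enorm x; have r0 : 0 <= r by exact: enorm_ge0.
have -> : (if 0 <= - r - (t - s) then - (1 / 2) * flux s (- r - (t - s) - s) else 0) = 0.
  case: ifP => // _; rewrite flux_neg ?mulr0//; lra.
rewrite subr0 (_ : r - (t - s) - s = r - t); last by ring.
have [tr|rt] := leP t r; first by rewrite ifT//; lra.
by case: ifP => _; rewrite ?mul0r// flux_neg ?mulr0 ?mul0r// subr_lt0.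
Qed.

Lemma source_wave_free s : 0 < s ->
  free_wave (Pplus0 (cst 0) (radial_avg (F s))) (Pplus1 (cst 0) (dist_of (F s))) (source_wave s).
Proof.
move=> s0; rewrite /source_wave s0; apply: source_free_wave.
- exact: rF.
- exact: measurable_profile.
- by move=> A; exact: integrable_source.
Qed.

Lemma measurable_flux_over_r t :
  measurable_fun setT (fun p : measurableTypeR R * E3 R => flux_over_r t p.1 p.2).
Proof.
have m2 : measurable_fun setT (fun p : measurableTypeR R * E3 R => enorm p.2).
  exact: (measurableT_comp measurable_enorm measurable_snd).
apply: measurable_fun_ifT => //; first exact: measurable_fun_ler.
apply: measurable_funM; last exact: (measurableT_comp measurable_invr m2).
apply: measurable_funM => //.
pose g (q : (measurableTypeR R * E3 R) * measurableTypeR R) : R :=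
  wt N (q.2 + q.1.1) * nl N (V q.1.1 q.2).
have ms : measurable_fun setT (fun q : (measurableTypeR R * E3 R) * measurableTypeR R => q.1.1 : R).
  exact: (measurableT_comp measurable_fst measurable_fst).
have mb : measurable_fun setT (fun q : (measurableTypeR R * E3 R) * measurableTypeR R => q.2 : R).
  exact: measurable_snd.
have mg : measurable_fun setT g.
  apply: measurable_funM.
    by apply: (measurableT_comp (measurable_wt N)); exact: measurable_funD.
  apply: (measurableT_comp (f := nl N)).
    by apply: continuous_measurable_fun; exact: nl_continuous.
  exact: mVcomp.
apply: (measurable_Rintegral_upto mg (A := fun p : measurableTypeR R * E3 R => enorm p.2 - t)).
exact: measurable_funB.
Qed.

Variables (u0 : E3 R -> R) (u1 : @distribution3 R).
Let v0 := radial_data u0.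
Hypothesis wave0 : free_wave u0 u1 (spherical_wave v0).
Hypothesis VE : forall t a, 0 <= t -> 0 <= a ->
  mu.-integrable `[0, t] (EFin \o flux^~ a) /\
  V t a = v0 a - 1 / 2 * \int[mu]_(s in `[0, t]) flux s a.

Lemma evolved_solution : solution N `[0, +oo[ u0 u1 evolved.
Proof.
split.
- by move=> t _; exact: radial_evolved.
- exact: measurable_funTS measurable_evolved_uncurry.
exists (spherical_wave v0), source_wave; split.
- exact: wave0.
- exists [set 0]; split; [exact: measurable_set1|exact: lebesgue_measure_set1|].
  move=> s /= ns; apply: contrapT => s0; apply: ns; rewrite in_itv/= andbT => s0'.
  have sp : 0 < s by rewrite lt_neqAle s0' andbT eq_sym; apply/eqP.
  by split; [move=> r; exact: integrable_source|exact: source_wave_free].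
move=> t; rewrite /= in_itv/= andbT => t0; split.
  apply: (eq_measurable_fun (fun p : R * E3 R => flux_over_r t p.1 p.2)).
    move=> [s x]; rewrite inE/= in_itv/= => -[st _].
    by rewrite source_wave_eq.
  exact: measurable_funTS (measurable_flux_over_r t).
(* No x is excepted: the equation for V holds at every a >= 0, and at x = 0 every term is divided by
   0, hence 0. *)
exists set0; split; [exact: measurable0|exact: measure0|].
move=> x /= nP; exfalso; apply: nP.
have eqW : {in `[0, t]%classic, (fun s => flux_over_r t s x) =1 (fun s => source_wave s (t - s) x)}.
  by move=> s; rewrite inE/= in_itv/= => st; rewrite source_wave_eq.
have [iG VtE] : mu.-integrable `[0, t] (EFin \o (fun s => flux_over_r t s x)) /\
    evolved t x = spherical_wave v0 t x + \int[mu]_(s in `[0, t]) flux_over_r t s x.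
  rewrite /evolved /delayed_over_r /flux_over_r /spherical_wave /signal /ext0.
  set r := enorm x; have r0 : 0 <= r by exact: enorm_ge0.
  (* The reflected part of the free wave can enter only for r = t = 0, where v0 vanishes. *)
  have -> : (if 0 <= - r - t then v0 (- r - t) else 0) = 0.
    case: ifP => // rt; have -> : - r - t = 0 by lra.
    exact: radial_data0.
  rewrite subr0 subr_ge0; case: ifP => tr; last first.
    by rewrite mul0r add0r Rintegral_cst// mul0r; split=> //; exact: integrable_itv_cst.
  have rt0 : 0 <= r - t by rewrite subr_ge0.
  have [iG ->] := VE t0 rt0.
  have E : (fun s => - (1 / 2) * flux s (r - t) / r) = (fun s => - (1 / 2) / r * flux s (r - t)).
    by apply/funext => s; rewrite mulrAC.
  rewrite E; split; first exact: integrable_itvZ.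
  rewrite RintegralZl//; move: (\int[_]_(_ in _) _) (r^-1) => z i; ring.
split.
  apply: eq_integrable iG => // s st; congr EFin; exact: eqW.
by rewrite VtE; congr (_ + _); apply: eq_Rintegral => s st; exact: eqW.
Qed.

End global_solution.

Section final_norms.
Context {R : realType}.
Notation mu := (@lebesgue_measure R).

Lemma norm_LqE (q : R) (f : E3 R -> R) :
  norm_Lq q f = ((\int[leb3 R]_x (`|f x| `^ q)%:E) `^ q^-1)%E.
Proof.
by rewrite /norm_Lq unlock; congr (_ `^ _)%E; apply: eq_integral => x _; rewrite /= poweR_EFin.
Qed.

Lemma cvg_powR0 (T : Type) (G : set_system T) {FG : Filter G} (f : T -> R) (p : R) : 0 < p ->
  (\forall t \near G, 0 <= f t) -> f t @[t --> G] --> (0 : R) ->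
  f t `^ p^-1 @[t --> G] --> (0 : R).
Proof.
move=> p0 f0 fc; apply/cvgrPdist_le => e e0.
have ep : 0 < e `^ p by exact: powR_gt0.
have /cvgrPdist_le/(_ _ ep) fe' := fc.
near=> t; rewrite sub0r normrN ger0_norm ?powR_ge0//.
have ft0 : 0 <= f t by near: t.
have fe : f t <= e `^ p.
  have : `|0 - f t| <= e `^ p by near: t.
  by rewrite sub0r normrN ger0_norm.
apply: (@le_trans _ _ ((e `^ p) `^ p^-1)).
  by apply: ge0_ler_powR; rewrite ?nnegrE ?invr_ge0 ?(ltW p0) ?(ltW ep).
by rewrite -powRrM divff ?gt_eqF// powRr1// ltW.
Unshelve. all: by end_near. Qed.

Lemma ess_sup_le (f : R -> \bar R) (y : \bar R) : (forall t, (f t <= y)%E) ->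
  (ess_sup mu f <= y)%E.
Proof.
move=> fy; apply: ereal_inf_lbound => /=.
exists set0; split; [exact: measurable0|exact: measure0|].
by move=> x /=; apply; exact: fy.
Qed.

End final_norms.
Theorem corollary1p3 (R : realType) (N : R) (u0 : E3 R -> R)
    (u1 : @distribution3 R) :
  2 < N ->
  let s_c := 3 / 2 - 2 / N in
  homog_sobolev s_c (dist_of u0) ->
  u0 \in Lfun (leb3 R) (N + 2)%:E ->
  homog_sobolev (s_c - 1) u1 ->
  radial u0 ->
  radial_dist u1 ->
  outgoing u0 u1 ->
  exists u : R -> E3 R -> R,
    [/\ solution N `[0, +oo[ u0 u1 u,
        (norm_LinfLq (N + 2) u <= norm_Lq (N + 2) u0)%E &
        4 < N -> norm_Lq (N + 2) (u t) @[t --> +oo] --> 0%E].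
Proof.
move=> N2 s_c _ Lu0 _ ru0 _ [_ out].
have N0 : 0 < N by lra.
have N1 : 1 < N by lra.
have p0 : 0 < N + 2 by lra.
have p0' : 0 <= (N + 2)^-1 by rewrite invr_ge0 ltW.
have mu0 : measurable_fun setT u0 by have /andP[/set_mem] := Lu0.
have fin0 : (\int[leb3 R]_x (`|u0 x| `^ (N + 2))%:E < +oo)%E.
  have /andP[_ /set_mem] := Lu0; rewrite /finite_norm /= -/(norm_Lq _ _) norm_LqE.
  by apply: lty_poweRy; rewrite gt_eqF// invr_gt0.
have mv0 := measurable_radial_data mu0.
have intE := integrable_radial_energy N0 mu0 ru0 fin0.
have [V [mV iV VE Ele Edecay]] := radial_evolution N1 mv0 (radial_data0 u0) intE.
have K0 : 0 <= 3 * @ball_vol R * (N + 2).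
  by rewrite mulr_ge0 ?(ltW p0)// mulr_ge0// ball_vol_ge0.
have mVt t : measurable_fun setT (V t).
  exact: (measurableT_comp mV (@pair1_measurable _ _ (measurableTypeR R) (measurableTypeR R) t)).
have normE t : 0 <= t -> norm_Lq (N + 2) (evolved V t) =
    (((3 * ball_vol * (N + 2))%:E *
      \int[@lebesgue_measure R]_(b in `[0%R, +oo[) (wt N (b + t) * pot N (V t b))%:E)
       `^ (N + 2)^-1)%E.
  by move=> t0; rewrite norm_LqE (radial_norm N0 (mVt t) t0).
have E0 t : (0 <= \int[@lebesgue_measure R]_(b in `[0%R, +oo[)
    (wt N (b + t) * pot N (V t b))%:E)%E.
  by apply: integral_ge0 => b _; rewrite lee_fin; apply: mulr_ge0; [exact: wt_ge0|exact: pot_ge0].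
(* The L^(N+2) norm is a nondecreasing function of the energy, so bounds on the energy transfer to
   the norm, in extended reals. *)
have mono (x y : \bar R) : (0 <= x)%E -> (x <= y)%E ->
    (((3 * ball_vol * (N + 2))%:E * x) `^ (N + 2)^-1 <=
     ((3 * ball_vol * (N + 2))%:E * y) `^ (N + 2)^-1)%E.
  move=> x0 xy; have y0 : (0 <= y)%E by exact: le_trans xy.
  apply: (gt0_ler_poweR p0').
  - by rewrite in_itv/= leey andbT mule_ge0 ?lee_fin.
  - by rewrite in_itv/= leey andbT mule_ge0 ?lee_fin.
  - by apply: lee_wpmul2l; rewrite ?lee_fin.
exists (evolved V); split.
- apply: (evolved_solution N0 mV iV) => //.
  apply: free_wave_spherical => //.
  + by move=> A; exact: (integrable_radial_data N0 mu0 ru0 fin0).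
  + by move=> phi; exact: radial_data_pairing.
  + exact: (outgoing_pairing N0 mu0 ru0 fin0).
- apply: ess_sup_le => t; rewrite /patch mem_setE in_itv/= andbT.
  (* For t < 0 the extension by 0 is compared with a nonnegative norm. *)
  case: ifP => [t0|_]; last by rewrite norm_LqE poweR_ge0.
  rewrite normE// norm_LqE (radial_data_norm N0 mu0 ru0).
  by apply: mono; [exact: E0|exact: Ele].
move=> N4; have [B [B0 HB]] := Edecay N4.
(* The energy bound [B] is stated for t > 0 only, which suffices near infinity; it is nonnegative
   there because it dominates an energy, so its root of order N + 2 tends to 0. *)
apply: (@squeeze_cvge _ _ _ _ (cst 0%E) _
  (fun t => ((3 * ball_vol * (N + 2) * B t) `^ (N + 2)^-1)%:E)).
- near=> t; have t0 : 0 < t by near: t; exact: nbhs_pinfty_gt.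
  rewrite norm_LqE poweR_ge0/= -norm_LqE normE ?(ltW t0)//.
  by have := mono _ _ (E0 t) (HB t t0); rewrite -EFinM poweR_EFin.
- exact: cvg_cst.
- apply: cvg_EFin; first by near=> t.
  apply: cvg_powR0 => //.
    near=> t; have t0 : 0 < t by near: t; exact: nbhs_pinfty_gt.
    by apply: mulr_ge0 => //; rewrite -lee_fin; apply: le_trans (E0 t) (HB t t0).
  rewrite -[X in _ --> X](mulr0 (3 * @ball_vol R * (N + 2))).
  by apply: cvgM; [exact: cvg_cst|exact: B0].
Unshelve. all: by end_near. Qed.
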